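(* There is an isomorphism of $k$-algebras ${\mathcal U}_q^{\widehat c_m}\cong({\mathcal U}_q^{c_m})^\#$.
   Context: $k$ algebraically closed of characteristic $0$, $q\in k^\times$ transcendental over $\mathbb Q$, $\hat q=q-q^{-1}$, $m>1$, $[u,v]=uv-q^{-1}vu$. $Q(A_m)$ is the lattice of $(a_1,\dots,a_{m+1})\in\mathbb Z^{m+1}$ with $\sum a_i=0$, standard inner product; $Q(\widehat A_m)=Q(A_m)\oplus\mathbb Z\delta$ with $\delta$ orthogonal to everything; simple roots $\alpha_i=e_i-e_{i+1}$ ($1\le i\le m$), $\alpha_0=e_{m+1}-e_1+\delta$; reflections $s_i(\mu)=\mu-\langle\mu,\alpha_i\rangle\alpha_i$. For $I=\{1,\dots,m\}$ (lattice $Q(A_m)$) resp. $I=\{0,\dots,m\}$ (lattice $Q(\widehat A_m)$), ${\mathcal U}_q(\mathfrak{sl}_{m+1})$ resp. ${\mathcal U}_q(\widehat{\mathfrak{sl}}_{m+1})$ is generated by $E_i,F_i$ ($i\in I$), $K_\mu$ with relations $K_0=1$, $K_\mu K_\lambda=K_{\mu+\lambda}$, $K_\mu E_i=q^{\langle\mu,\alpha_i\rangle}E_iK_\mu$, $K_\mu F_i=q^{-\langle\mu,\alpha_i\rangle}F_iK_\mu$, $E_iE_j=E_jE_i$, $F_iF_j=F_jF_i$ if $\langle\alpha_i,\alpha_j\rangle\in\{0,2\}$, $E_i[E_i,E_j]=q[E_i,E_j]E_i$, $F_i[F_i,F_j]=q[F_i,F_j]F_i$ if $\langle\alpha_i,\alpha_j\rangle=-1$,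 $E_iF_j-F_jE_i=\delta_{ij}(K_{\alpha_i}-K_{-\alpha_i})/\hat q$; Hopf structure $\Delta(E_i)=K_{-\alpha_i}\otimes E_i+E_i\otimes1$, $\Delta(K_\mu)=K_\mu\otimes K_\mu$, $S(E_i)=-K_{\alpha_i}E_i$, $S(K_\mu)=K_{-\mu}$; Lusztig automorphisms $T_iK_\mu=K_{s_i\mu}$, $T_iE_i=-F_iK_{\alpha_i}$, $T_iF_i=-K_{-\alpha_i}E_i$, and for $j\ne i$: $T_iE_j=E_j$ if $\langle\alpha_i,\alpha_j\rangle=0$, $T_iE_j=E_iE_j-q^{-1}E_jE_i$ if $\langle\alpha_i,\alpha_j\rangle=-1$. For a reduced word $w=s_{i_1}\cdots s_{i_t}$ the root vectors are $T_{i_1}\cdots T_{i_{\ell-1}}E_{i_\ell}$ and the De Concini–Kac–Procesi algebra ${\mathcal U}_q^w$ is the subalgebra they generate. $c_m=s_1\cdots s_m\in W(A_m)$ and $\widehat c_m=(s_1\cdots s_m)(s_0s_1\cdots s_{m-1})$ in the affine Weyl group. ${\mathcal U}_A^{\ge0}$ is the Hopf subalgebra of ${\mathcal U}_q(\mathfrak{sl}_{m+1})$ generated by $E_1,\dots,E_m$ and the $K_\mu$; $\pi_A$ is the algebra endomorphism of ${\mathcal U}_A^{\ge0}$ with $\pi_A(E_1)=0$, $\pi_A(E_i)=E_i$ ($i>1$), $\pi_A(K_\mu)=K_\mu$; ${\mathcal U}_q^{c_m}$ is a left ${\mathcal U}_A^{\ge0}$-module algebra via $h.v=\sum\pi_A(h)_{(1)}vS(\pi_A(h)_{(2)})$;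 the smash product ${\mathcal U}_q^{c_m}\#{\mathcal U}_A^{\ge0}$ is ${\mathcal U}_q^{c_m}\otimes{\mathcal U}_A^{\ge0}$ with product $(a\#h)(b\#g)=\sum a(h_{(1)}.b)\#h_{(2)}g$, and $({\mathcal U}_q^{c_m})^\#$ is its subalgebra generated by $\{1\#u,\,u\#1:u\in{\mathcal U}_q^{c_m}\}$. *)

(* Defs.v *)
From HB Require Import structures.
From mathcomp Require Import all_boot all_algebra.
Set Implicit Arguments. Unset Strict Implicit. Unset Printing Implicit Defensive.
Import GRing.Theory.
Local Open Scope ring_scope.

(* Free (noncommutative, unital, associative) k-algebra on a set G of   *)
(* generators, as a term language, and the k-algebra congruence         *)
(* generated by a set of relations.  The algebra presented by (G, rel)   *)
(* is the set of terms modulo [feq rel].                                *)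
Section FreeAlg.
Variables (k : fieldType) (G : Type).

Inductive fterm : Type :=
| FG of G
| FC of k
| FAdd of fterm & fterm
| FMul of fterm & fterm.

Definition FSub (x y : fterm) := FAdd x (FMul (FC (-1)) y).

Variable rel : fterm -> fterm -> Prop.

Inductive feq : fterm -> fterm -> Prop :=
| feq_refl x : feq x x
| feq_sym x y : feq x y -> feq y x
| feq_trans x y z : feq x y -> feq y z -> feq x z
| feq_addc x x' y y' : feq x x' -> feq y y' -> feq (FAdd x y) (FAdd x' y')
| feq_mulc x x' y y' : feq x x' -> feq y y' -> feq (FMul x y) (FMul x' y')
| feq_addA x y z : feq (FAdd x (FAdd y z)) (FAdd (FAdd x y) z)
| feq_addC x y : feq (FAdd x y) (FAdd y x)
| feq_add0 x : feq (FAdd (FC 0) x) x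
| feq_addN x : feq (FAdd x (FMul (FC (-1)) x)) (FC 0)
| feq_mulA x y z : feq (FMul x (FMul y z)) (FMul (FMul x y) z)
| feq_mul1l x : feq (FMul (FC 1) x) x
| feq_mul1r x : feq (FMul x (FC 1)) x
| feq_mulDl x y z : feq (FMul (FAdd x y) z) (FAdd (FMul x z) (FMul y z))
| feq_mulDr x y z : feq (FMul x (FAdd y z)) (FAdd (FMul x y) (FMul x z))
| feq_Cadd a b : feq (FC (a + b)) (FAdd (FC a) (FC b))
| feq_Cmul a b : feq (FC (a * b)) (FMul (FC a) (FC b))
| feq_Ccomm a x : feq (FMul (FC a) x) (FMul x (FC a))
| feq_rel x y : rel x y -> feq x y.

Inductive fgen (S : fterm -> Prop) : fterm -> Prop :=
| fgen_S x : S x -> fgen S x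
| fgen_C c : fgen S (FC c)
| fgen_add x y : fgen S x -> fgen S y -> fgen S (FAdd x y)
| fgen_mul x y : fgen S x -> fgen S y -> fgen S (FMul x y).

Definition fsub (S : fterm -> Prop) (x : fterm) : Prop :=
  exists2 y, fgen S y & feq x y.

End FreeAlg.
Arguments FC {k G} c.
Arguments FG {k G} g.
Arguments FAdd {k G}.
Arguments FMul {k G}.

Fixpoint fmap (k : fieldType) (G G' : Type) (f : G -> fterm k G')
    (x : fterm k G) : fterm k G' :=
  match x with
  | FG g => f g
  | FC c => FC c
  | FAdd a b => FAdd (fmap f a) (fmap f b)
  | FMul a b => FMul (fmap f a) (fmap f b)
  end.

Fixpoint inl (T : Type) (x : T) (s : seq T) : Prop :=
  if s is y :: s' then x = y \/ inl x s' else False.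

Record datum := Datum {
  dI : eqType;
  dL : Type;
  dadd : dL -> dL -> dL;
  dzero : dL;
  dopp : dL -> dL;
  dalpha : dI -> dL;
  dpair : dL -> dL -> int;
  drefl : dI -> dL -> dL }.

Inductive ugen (D : datum) : Type :=
| UE of dI D
| UF of dI D
| UK of dL D.

Section QuantumGroup.
Variables (k : fieldType) (q : k) (D : datum).

Local Notation uterm := (fterm k (ugen D)).
Definition gE (i : dI D) : uterm := FG (UE i).
Definition gF (i : dI D) : uterm := FG (UF i).
Definition gK (mu : dL D) : uterm := FG (UK mu).
Local Notation "<< x , y >>" := (dpair x y).

Definition qbr (u v : uterm) : uterm := FSub (FMul u v) (FMul (FC q^-1) (FMul v u)).

Inductive urel : uterm -> uterm -> Prop :=
| ur_K0 : urel (gK (dzero D)) (FC 1)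
| ur_KK mu la : urel (FMul (gK mu) (gK la)) (gK (dadd mu la))
| ur_KE mu i : urel (FMul (gK mu) (gE i))
      (FMul (FC (q ^ << mu, dalpha i >>)) (FMul (gE i) (gK mu)))
| ur_KF mu i : urel (FMul (gK mu) (gF i))
      (FMul (FC (q ^ (- << mu, dalpha i >>))) (FMul (gF i) (gK mu)))
| ur_EE i j : (<< dalpha i, dalpha j >> == 0) || (<< dalpha i, dalpha j >> == 2) ->
      urel (FMul (gE i) (gE j)) (FMul (gE j) (gE i))
| ur_FF i j : (<< dalpha i, dalpha j >> == 0) || (<< dalpha i, dalpha j >> == 2) ->
      urel (FMul (gF i) (gF j)) (FMul (gF j) (gF i))
| ur_Eserre i j : << dalpha i, dalpha j >> = -1 ->
      urel (FMul (gE i) (qbr (gE i) (gE j))) (FMul (FC q) (FMul (qbr (gE i) (gE j)) (gE i)))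
| ur_Fserre i j : << dalpha i, dalpha j >> = -1 ->
      urel (FMul (gF i) (qbr (gF i) (gF j))) (FMul (FC q) (FMul (qbr (gF i) (gF j)) (gF i)))
| ur_EF i j : urel (FSub (FMul (gE i) (gF j)) (FMul (gF j) (gE i)))
      (if i == j then
         FMul (FC (q - q^-1)^-1) (FSub (gK (dalpha i)) (gK (dopp (dalpha i))))
       else FC 0).

Definition Ueq : uterm -> uterm -> Prop := feq urel.

(* Lusztig automorphism T_i on generators *)
Definition Tgen (i : dI D) (g : ugen D) : uterm :=
  match g with
  | UK mu => gK (drefl i mu)
  | UE j => if j == i then FMul (FC (-1)) (FMul (gF i) (gK (dalpha i)))
            else if << dalpha i, dalpha j >> == -1 then qbr (gE i) (gE j)
            else gE j
  | UF j => if j == i then FMul (FC (-1)) (FMul (gK (dopp (dalpha i))) (gE i))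
            else if << dalpha i, dalpha j >> == -1 then
              FSub (FMul (gF j) (gF i)) (FMul (FC q) (FMul (gF i) (gF j)))
            else gF j
  end.

Definition Tl (i : dI D) : uterm -> uterm := fmap (Tgen i).

Fixpoint rootvecs (w : seq (dI D)) : seq uterm :=
  if w is i :: w' then gE i :: map (Tl i) (rootvecs w') else [::].

Definition DCKP (w : seq (dI D)) : uterm -> Prop :=
  fsub urel (fun x => inl x (rootvecs w)).

End QuantumGroup.

Definition ivec n := {ffun 'I_n -> int}.
Definition evec n (a : 'I_n) : ivec n := [ffun j => (j == a)%:Z].
Definition sum0 n (v : ivec n) : bool := \sum_i v i == 0.

Lemma sum0_comb n (u v : ivec n) (c : int) :
  sum0 u -> sum0 v -> sum0 [ffun j => u j + c * v j].
Proof.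
rewrite /sum0 => /eqP hu /eqP hv.
rewrite (eq_bigr (fun j => u j + c * v j)); last by move=> j _; rewrite ffunE.
by rewrite big_split /= -mulr_sumr hu hv mulr0 addr0.
Qed.

Lemma sum0_e n (a b : 'I_n) : sum0 [ffun j => evec a j - evec b j].
Proof.
have S1 (x : 'I_n) : \sum_j evec x j = 1.
  rewrite (bigD1 x) //= big1 ?ffunE ?eqxx ?addr0 // => j /negbTE hj.
  by rewrite ffunE hj.
rewrite /sum0 (eq_bigr (fun j => evec a j - evec b j)); last by move=> j _; rewrite ffunE.
by rewrite sumrB !S1 subrr.
Qed.

Lemma sum0_zero n : sum0 [ffun _ : 'I_n => (0 : int)].
Proof. by rewrite /sum0 big1 // => j _; rewrite ffunE. Qed.

Definition vroot n (a b : 'I_n) : ivec n := [ffun j => evec a j - evec b j].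

(* Q(A_m) : vectors of Z^{m+1} with coordinate sum 0 (coordinates 0-based) *)
Definition QA (m : nat) := {v : ivec m.+1 | sum0 v}.

Section QAops.
Variable m : nat.
Definition QA_comb (u v : QA m) (c : int) : QA m :=
  @exist (ivec m.+1) (@sum0 m.+1) _ (sum0_comb c (svalP u) (svalP v)).
Definition QA_zero : QA m := @exist (ivec m.+1) (@sum0 m.+1) _ (sum0_zero m.+1).
Definition QA_add (u v : QA m) : QA m := QA_comb u v 1.
Definition QA_opp (u : QA m) : QA m := QA_comb QA_zero u (-1).
Definition QA_pair (u v : QA m) : int := \sum_j sval u j * sval v j.
(* alpha_{i+1} = e_{i+1} - e_{i+2}, for i : 'I_m (0-based index i) *)
Definition QA_alpha (i : 'I_m) : QA m :=
  @exist (ivec m.+1) (@sum0 m.+1) (vroot (inord i) (inord i.+1)) (sum0_e _ _).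
Definition QA_refl (i : 'I_m) (mu : QA m) : QA m :=
  QA_comb mu (QA_alpha i) (- QA_pair mu (QA_alpha i)).
End QAops.

(* finite type A_m : I = {1..m}, encoded as 'I_m with i <-> i+1 *)
Definition DA (m : nat) : datum :=
  @Datum 'I_m (QA m) (@QA_add m) (QA_zero m) (@QA_opp m)
    (@QA_alpha m) (@QA_pair m) (@QA_refl m).

(* Q(A_m^) = Q(A_m) + Z delta : pairs (v, d), v in Z^{m+1} with sum 0,
   d the coefficient of delta; delta is orthogonal to everything. *)
Definition QAf (m : nat) := {p : ivec m.+1 * int | sum0 p.1}.

Section QAfops.
Variable m : nat.
Definition QAf_comb (u v : QAf m) (c : int) : QAf m :=
  @exist (ivec m.+1 * int) (fun p => sum0 p.1)
    ([ffun j => (sval u).1 j + c * (sval v).1 j], (sval u).2 + c * (sval v).2)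
    (sum0_comb c (svalP u) (svalP v)).
Definition QAf_zero : QAf m :=
  @exist (ivec m.+1 * int) (fun p => sum0 p.1) ([ffun _ => 0], 0) (sum0_zero m.+1).
Definition QAf_add (u v : QAf m) : QAf m := QAf_comb u v 1.
Definition QAf_opp (u : QAf m) : QAf m := QAf_comb QAf_zero u (-1).
Definition QAf_pair (u v : QAf m) : int := \sum_j (sval u).1 j * (sval v).1 j.
(* index i : 'I_m.+1 = {0,...,m}; alpha_0 = e_{m+1} - e_1 + delta,
   alpha_i = e_i - e_{i+1} (1-based coordinates) for 1 <= i <= m *)
Definition QAf_alpha (i : 'I_m.+1) : QAf m :=
  if i == ord0 then
    @exist (ivec m.+1 * int) (fun p => sum0 p.1) (vroot ord_max ord0, 1) (sum0_e _ _)
  else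
    @exist (ivec m.+1 * int) (fun p => sum0 p.1) (vroot (inord i.-1) i, 0) (sum0_e _ _).
Definition QAf_refl (i : 'I_m.+1) (mu : QAf m) : QAf m :=
  QAf_comb mu (QAf_alpha i) (- QAf_pair mu (QAf_alpha i)).
End QAfops.

Definition DAf (m : nat) : datum :=
  @Datum 'I_m.+1 (QAf m) (@QAf_add m) (QAf_zero m) (@QAf_opp m)
    (@QAf_alpha m) (@QAf_pair m) (@QAf_refl m).

(* c_m = s_1 ... s_m  (in the 0-based encoding of 'I_m: 0,1,...,m-1) *)
Definition cword (m : nat) : seq 'I_m := enum 'I_m.
Definition chatword (m : nat) : seq 'I_m.+1 :=
  [seq inord i | i <- iota 1 m] ++ (ord0 :: [seq inord i | i <- iota 1 m.-1]).

(* Tensor product U (x) U of the vector space underlying an algebra      *)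
(* presented by (G, rel): formal sums of pure tensors modulo the         *)
(* k-vector-space axioms and bilinearity (and equality in each factor).  *)
Section Tensor.
Variables (k : fieldType) (G : Type) (rel : fterm k G -> fterm k G -> Prop).
Local Notation term := (fterm k G).

Inductive tterm : Type :=
| TP of term & term
| TAdd of tterm & tterm
| TScal of k & tterm
| TZero.

Inductive teq : tterm -> tterm -> Prop :=
| teq_refl x : teq x x
| teq_sym x y : teq x y -> teq y x
| teq_trans x y z : teq x y -> teq y z -> teq x z
| teq_addc x x' y y' : teq x x' -> teq y y' -> teq (TAdd x y) (TAdd x' y')
| teq_scalc c x x' : teq x x' -> teq (TScal c x) (TScal c x')
| teq_addA x y z : teq (TAdd x (TAdd y z)) (TAdd (TAdd x y) z)
| teq_addC x y : teq (TAdd x y) (TAdd y x)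
| teq_add0 x : teq (TAdd TZero x) x
| teq_addN x : teq (TAdd x (TScal (-1) x)) TZero
| teq_scal1 x : teq (TScal 1 x) x
| teq_scalA a b x : teq (TScal a (TScal b x)) (TScal (a * b) x)
| teq_scalDl a b x : teq (TScal (a + b) x) (TAdd (TScal a x) (TScal b x))
| teq_scalDr a x y : teq (TScal a (TAdd x y)) (TAdd (TScal a x) (TScal a y))
| teq_lin_l a a' h : teq (TP (FAdd a a') h) (TAdd (TP a h) (TP a' h))
| teq_lin_r a h h' : teq (TP a (FAdd h h')) (TAdd (TP a h) (TP a h'))
| teq_scal_l c a h : teq (TP (FMul (FC c) a) h) (TScal c (TP a h))
| teq_scal_r c a h : teq (TP a (FMul (FC c) h)) (TScal c (TP a h))
| teq_eq_l a a' h : feq rel a a' -> teq (TP a h) (TP a' h)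
| teq_eq_r a h h' : feq rel h h' -> teq (TP a h) (TP a h').

Fixpoint tflat (x : tterm) : seq (k * term * term) :=
  match x with
  | TP a h => [:: (1, a, h)]
  | TAdd x y => tflat x ++ tflat y
  | TScal c x => [seq (c * p.1.1, p.1.2, p.2) | p <- tflat x]
  | TZero => [::]
  end.

Definition tsum (s : seq tterm) : tterm := foldr TAdd TZero s.
End Tensor.
Arguments TZero {k G}.
Arguments TAdd {k G}.
Arguments TP {k G}.
Arguments TScal {k G}.

Section Smash.
Variables (k : fieldType) (q : k) (m : nat).
Local Notation D := (DA m).
Local Notation uterm := (fterm k (ugen D)).
Local Notation E := (@gE k D).
Local Notation F := (@gF k D).
Local Notation K := (@gK k D).

(* terms in the generators E_i, K_mu only (representatives of U_A^{>=0}) *)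
Fixpoint posterm (x : uterm) : Prop :=
  match x with
  | FG (UF _) => False
  | FG _ => True
  | FC _ => True
  | FAdd a b => posterm a /\ posterm b
  | FMul a b => posterm a /\ posterm b
  end.

(* coproduct, as the algebra map determined on generators:
   Delta(E_i) = K_{-alpha_i} (x) E_i + E_i (x) 1, Delta(K_mu) = K_mu (x) K_mu.
   (The value on F_i, the standard compatible one, is never used.) *)
Fixpoint cop (x : uterm) : seq (uterm * uterm) :=
  match x with
  | FG (UE i) => [:: (K (dopp (dalpha i)), E i); (E i, FC 1)]
  | FG (UF i) => [:: (F i, K (dalpha i)); (FC 1, F i)]
  | FG (UK mu) => [:: (K mu, K mu)]
  | FC c => [:: (FC c, FC 1)]
  | FAdd a b => cop a ++ cop b
  | FMul a b => [seq (FMul p.1 r.1, FMul p.2 r.2) | p <- cop a, r <- cop b]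
  end.

Fixpoint antip (x : uterm) : uterm :=
  match x with
  | FG (UE i) => FMul (FC (-1)) (FMul (K (dalpha i)) (E i))
  | FG (UF i) => FMul (FC (-1)) (FMul (F i) (K (dopp (dalpha i))))
  | FG (UK mu) => K (dopp mu)
  | FC c => FC c
  | FAdd a b => FAdd (antip a) (antip b)
  | FMul a b => FMul (antip b) (antip a)
  end.

(* pi_A : E_1 |-> 0, E_i |-> E_i (i > 1), K_mu |-> K_mu.
   E_1 is the generator with 0-based index 0. *)
Definition piA_gen (g : ugen D) : uterm :=
  match g with
  | UE i => if (val i == 0)%N then FC 0 else E i
  | _ => FG g
  end.
Definition piA : uterm -> uterm := fmap piA_gen.

Definition fsum (s : seq uterm) : uterm := foldr FAdd (FC 0) s.

Definition act (h v : uterm) : uterm :=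
  fsum [seq FMul (FMul p.1 v) (antip p.2) | p <- cop (piA h)].

Local Notation tt := (tterm k (ugen D)).

(* (a # h)(b # g) = sum a (h_(1) . b) # h_(2) g, extended bilinearly *)
Definition smul (x y : tt) : tt :=
  tsum [seq
    tsum [seq TScal (u.1.1 * v.1.1) (TP (FMul u.1.2 (act p.1 v.1.2)) (FMul p.2 v.2))
         | p <- cop u.2]
    | u <- tflat x, v <- tflat y].

Definition tone : tt := TP (FC 1) (FC 1).
Definition tscal (c : k) : tt := TScal c tone.

Definition Smash_eq : tt -> tt -> Prop := teq (@urel k q D).

Definition tpos (x : tt) : Prop :=
  foldr (fun p P => posterm p.2 /\ P) True (tflat x).

Definition Uc : uterm -> Prop := @DCKP k q (DA m) (cword m).

Inductive sgen : tt -> Prop :=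
| sg_left u : Uc u -> sgen (TP u (FC 1))
| sg_right h : posterm h -> Uc h -> sgen (TP (FC 1) h)
| sg_scal c : sgen (tscal c)
| sg_add x y : sgen x -> sgen y -> sgen (TAdd x y)
| sg_mul x y : sgen x -> sgen y -> sgen (smul x y).

Definition Usharp (x : tt) : Prop :=
  tpos x /\ exists2 y, sgen y & Smash_eq x y.

End Smash.

Definition Uchat (k : fieldType) (q : k) (m : nat) : fterm k (ugen (DAf m)) -> Prop :=
  @DCKP k q (DAf m) (chatword m).

Definition alg_iso (k : fieldType) (TA TB : Type)
  (eA : TA -> TA -> Prop) (addA mulA : TA -> TA -> TA) (scA : k -> TA)
  (inA : TA -> Prop)
  (eB : TB -> TB -> Prop) (addB mulB : TB -> TB -> TB) (scB : k -> TB)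
  (inB : TB -> Prop) (f : TA -> TB) : Prop :=
  (forall x, inA x -> inB (f x)) /\
  (forall x y, inA x -> inA y -> (eA x y <-> eB (f x) (f y))) /\
  (forall c, eB (f (scA c)) (scB c)) /\
  (forall x y, inA x -> inA y -> eB (f (addA x y)) (addB (f x) (f y))) /\
  (forall x y, inA x -> inA y -> eB (f (mulA x y)) (mulB (f x) (f y))) /\
  (forall z, inB z -> exists2 x, inA x & eB (f x) z).

(* Main.v *)
Require Import Defs.
From HB Require Import structures.
From mathcomp Require Import all_boot all_order all_algebra all_field.
From mathcomp Require Import boolp functions ring zify.
Set Implicit Arguments. Unset Strict Implicit. Unset Printing Implicit Defensive.
Import Order.TTheory GRing.Theory Num.Theory.
Local Open Scope ring_scope.

(* The root vectors of [s_1 .. s_m s_0 s_1 .. s_(m-1)] form two rows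
   [x_0 .. x_(m-1)] and [y_0 .. y_(m-1)], where each row is obtained from its
   first element by q-brackets with [E_2, .., E_m]; this alone forces a set of
   quadratic straightening relations ([tworow_rel]), by which ordered monomials
   span. In the smash product, left multiplication by the root vectors [u # 1]
   and [1 # u] satisfies the same relations, because left multiplication by
   [1 # E_i] plays the role of [E_i] in both rows. Ordered monomials are linearly
   independent on both sides: on the smash product through a pair of q-oscillator
   representations of [U_q(sl_(m+1))], on the affine side through the leading
   terms, for a suitable filtration, of a tensor product of two oscillator
   representations. Hence the same linear relations between words hold on both
   sides, and matching the root vectors is an isomorphism. *)

(** Three obstacles shape the proof. Equality in the Borel part is inherited from the whole quantum
    group, so a derivation between two terms in the [E_i], [K_mu] may pass through the [F_i], where
    killing [E_1] contradicts the relation between [E_1] and [F_1]. Hence left multiplication by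
    [1 # h] is obtained as the constant term, in a scalar [c], of honest representations in which
    [E_1], [F_1] are rescaled by [c], [c^-1]; as [q] is no root of unity, the values at [c != 0]
    determine it. On the affine side [x_l] and [y_l] move a single oscillator by the same vector, so
    one oscillator cannot separate the rows. On a tensor product of two, heights make the
    first-factor part of [x_l] minimal and push away the terms of [y_l] that contain [E_0] of the
    first factor; the remaining unwanted mixed terms are brackets that vanish exactly. For [m = 2]
    the affine diagram is a triangle: [[E_1, E_2]] and [[E_1, E_0]] then satisfy a Serre relation
    instead of commuting, and this case gets its own argument. *)

(* [ncfield k A (h1, h2)] proves an equation in the [k]-algebra [A] after
   rewriting words with the oriented relations [h1] and [h2]. Words are compared
   by dedicated fixpoints, so that [cbv] leaves the coefficients untouched. *)
Section NonCommutativeNormalForm.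
Variables (k : fieldType) (A : algType k).

Inductive nexp : Type :=
| NVar of nat | NZero | NOne
| NAdd of nexp & nexp | NOpp of nexp | NMul of nexp & nexp | NScale of k & nexp.

Fixpoint ndenote (env : seq A) (e : nexp) : A :=
  match e with
  | NVar i => nth 0 env i
  | NZero => 0
  | NOne => 1
  | NAdd a b => ndenote env a + ndenote env b
  | NOpp a => - ndenote env a
  | NMul a b => ndenote env a * ndenote env b
  | NScale c a => c *: ndenote env a
  end.

Fixpoint nmulr (c : k) (w : seq nat) (l : seq (k * seq nat)) :=
  if l is (d, v) :: l' then (c * d, w ++ v) :: nmulr c w l' else [::].
Fixpoint nmul (l1 l2 : seq (k * seq nat)) :=
  if l1 is (c, w) :: l then nmulr c w l2 ++ nmul l l2 else [::].

Fixpoint nnorm (e : nexp) : seq (k * seq nat) :=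
  match e with
  | NVar i => [:: (1, [:: i])]
  | NZero => [::]
  | NOne => [:: (1, [::])]
  | NAdd a b => nnorm a ++ nnorm b
  | NOpp a => nmulr (-1) [::] (nnorm a)
  | NMul a b => nmul (nnorm a) (nnorm b)
  | NScale c a => nmulr c [::] (nnorm a)
  end.

Fixpoint nword (env : seq A) (w : seq nat) : A :=
  if w is i :: w' then nth 0 env i * nword env w' else 1.
Fixpoint nsum (env : seq A) (l : seq (k * seq nat)) : A :=
  if l is (c, w) :: l' then c *: nword env w + nsum env l' else 0.

Fixpoint nateqb (m n : nat) : bool :=
  match m, n with
  | 0%N, 0%N => true | S m', S n' => nateqb m' n' | _, _ => false
  end.
Fixpoint wordeqb (u v : seq nat) : bool :=
  match u, v with
  | [::], [::] => true
  | i :: u', j :: v' => if nateqb i j then wordeqb u' v' else false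
  | _, _ => false
  end.
Fixpoint ninsert (c : k) (w : seq nat) (l : seq (k * seq nat)) :=
  if l is (d, v) :: l' then
    if wordeqb w v then (c + d, v) :: l' else (d, v) :: ninsert c w l'
  else [:: (c, w)].
Fixpoint ncollect (l : seq (k * seq nat)) :=
  if l is (c, w) :: l' then ninsert c w (ncollect l') else [::].
Fixpoint nallzero (l : seq (k * seq nat)) : Prop :=
  if l is (c, _) :: l' then c = 0 /\ nallzero l' else True.

Lemma nword_cat env u v : nword env (u ++ v) = nword env u * nword env v.
Proof. by elim: u => [|i u IH] /=; rewrite ?mul1r // IH mulrA. Qed.

Lemma nsum_cat env u v : nsum env (u ++ v) = nsum env u + nsum env v.
Proof. by elim: u => [|[c w] u IH] /=; rewrite ?add0r // IH addrA. Qed.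

Lemma nsum_mulr env c w l : nsum env (nmulr c w l) = (c *: nword env w) * nsum env l.
Proof.
elim: l => [|[d v] l IH] /=; first by rewrite mulr0.
rewrite IH mulrDr nword_cat; congr (_ + _).
by rewrite -scalerAl -scalerAr scalerA.
Qed.

Lemma nsum_mul env l1 l2 : nsum env (nmul l1 l2) = nsum env l1 * nsum env l2.
Proof.
elim: l1 => [|[c w] l IH] /=; first by rewrite mul0r.
by rewrite nsum_cat nsum_mulr IH mulrDl.
Qed.

Lemma nnormP env e : nsum env (nnorm e) = ndenote env e.
Proof.
elim: e => [i|||a IHa b IHb|a IHa|a IHa b IHb|c a IHa] //=.
- by rewrite scale1r mulr1 addr0.
- by rewrite scale1r addr0.
- by rewrite nsum_cat IHa IHb.
- by rewrite nsum_mulr IHa /= scaleN1r mulN1r.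
- by rewrite nsum_mul IHa IHb.
- by rewrite nsum_mulr IHa /= -scalerAl mul1r.
Qed.

Lemma nateqbP m n : nateqb m n -> m = n.
Proof. by elim: m n => [|m IH] [|n] //= /IH ->. Qed.

Lemma wordeqbP u v : wordeqb u v -> u = v.
Proof.
elim: u v => [|i u IH] [|j v] //=.
by case E: (nateqb i j) => // /IH ->; rewrite (nateqbP E).
Qed.

Lemma nsum_insert env c w l : nsum env (ninsert c w l) = c *: nword env w + nsum env l.
Proof.
elim: l => [|[d v] l IH] //=.
case E: (wordeqb w v) => /=; last by rewrite IH addrCA.
by rewrite (wordeqbP E) scalerDl addrA.
Qed.

Lemma nsum_collect env l : nsum env (ncollect l) = nsum env l.
Proof. by elim: l => [|[c w] l IH] //=; rewrite nsum_insert IH. Qed.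

Lemma nsum_allzero env l : nallzero l -> nsum env l = 0.
Proof. by elim: l => [|[c w] l IH] //= [-> /IH ->]; rewrite scale0r addr0. Qed.

Fixpoint nstrip (p w : seq nat) : option (seq nat) :=
  match p, w with
  | [::], _ => Some w
  | i :: p', j :: w' => if nateqb i j then nstrip p' w' else None
  | _, _ => None
  end.
Fixpoint nfind (p w : seq nat) : option (seq nat * seq nat) :=
  match nstrip p w with
  | Some v => Some ([::], v)
  | None => if w is i :: w' then
      if nfind p w' is Some (u, v) then Some (i :: u, v) else None else None
  end.
Fixpoint nmulrr (v : seq nat) (l : seq (k * seq nat)) :=
  if l is (d, w) :: l' then (d, w ++ v) :: nmulrr v l' else [::].
Fixpoint nstep (rules : seq (seq nat * seq (k * seq nat))) (w : seq nat) :=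
  if rules is (p, r) :: rules' then
    if nfind p w is Some (u, v) then Some (nmulr 1 u (nmulrr v r)) else nstep rules' w
  else None.
(** Arbitrary rules need not terminate, so [fuel] bounds the depth of rewriting. Running out of fuel
    leaves words unreduced, which can spoil success but not soundness. *)
Fixpoint nreduce fuel rules (l : seq (k * seq nat)) :=
  if fuel is S fuel' then
    (fix reduce_all l := match l with
    | [::] => [::]
    | (c, w) :: l' =>
      if nstep rules w is Some r
      then nreduce fuel' rules (nmulr c [::] r) ++ reduce_all l'
      else (c, w) :: reduce_all l'
    end) l
  else l.

Fixpoint nismono (e : nexp) : bool :=
  match e with
  | NVar _ | NOne => true
  | NMul a b => if nismono a then nismono b else false
  | _ => false
  end.
Fixpoint nmono (e : nexp) : seq nat :=
  match e with NVar i => [:: i] | NMul a b => nmono a ++ nmono b | _ => [::] end.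

Fixpoint nrules (l : seq (nexp * nexp)) :=
  if l is (a, b) :: l' then (nmono a, nnorm b) :: nrules l' else [::].
Fixpoint nrules_ok (env : seq A) (l : seq (nexp * nexp)) : Prop :=
  if l is (a, b) :: l' then
    [/\ nismono a, ndenote env a = ndenote env b & nrules_ok env l']
  else True.

Lemma nmonoP env e : nismono e -> nword env (nmono e) = ndenote env e.
Proof.
elim: e => //= [i _|a IHa b IHb]; first by rewrite mulr1.
by case: (nismono a) IHa => // IHa /IHb <-; rewrite nword_cat IHa.
Qed.

Lemma nstripP p w v : nstrip p w = Some v -> w = p ++ v.
Proof.
elim: p w => [|i p IH] [|j w] //=; try by case=> ->.
by case E: (nateqb i j) => // /IH ->; rewrite (nateqbP E).
Qed.

Lemma nfindP p w u v : nfind p w = Some (u, v) -> w = u ++ p ++ v.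
Proof.
elim: w u v => [|i w IH] u v /=; case E: (nstrip p _) => [v'|] //.
- by case=> <- <-; exact: (nstripP E).
- by case=> <- <-; exact: (nstripP E).
by case F: (nfind p w) => [[u' v']|] // [<- <-] /=; rewrite -(IH _ _ F).
Qed.

Lemma nsum_mulrr env v l : nsum env (nmulrr v l) = nsum env l * nword env v.
Proof.
elim: l => [|[d w] l IH] /=; first by rewrite mul0r.
by rewrite IH mulrDl nword_cat scalerAl.
Qed.

Lemma nstepP env l w r : nrules_ok env l -> nstep (nrules l) w = Some r ->
  nsum env r = nword env w.
Proof.
elim: l => [|[a b] l IH] //= [mono_a eab ok].
case E: (nfind _ w) => [[u v]|]; last exact: IH ok.
case=> <-; rewrite nsum_mulr nsum_mulrr nnormP -eab scale1r -nmonoP //.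
by rewrite (nfindP E) !nword_cat.
Qed.

Lemma nreduceP env rules fuel l : nrules_ok env rules ->
  nsum env (nreduce fuel (nrules rules) l) = nsum env l.
Proof.
move=> ok; elim: fuel l => [|fuel IH] //; elim=> [|[c w] l IHl] //=.
case E: (nstep _ w) => [r|] /=; last by rewrite IHl.
by rewrite nsum_cat IH IHl nsum_mulr /= (nstepP ok E) -scalerAl mul1r.
Qed.

(** After reduction one scalar identity per word is left, a goal for [ring] or [field]. *)
Lemma ndenote_eq env rules fuel e1 e2 : nrules_ok env rules ->
  nallzero (ncollect (nreduce fuel (nrules rules) (nnorm (NAdd e1 (NOpp e2))))) ->
  ndenote env e1 = ndenote env e2.
Proof.
move=> ok /(@nsum_allzero env); rewrite nsum_collect nreduceP // nnormP /= => /eqP.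
by rewrite subr_eq0 => /eqP.
Qed.
End NonCommutativeNormalForm.

(** * Reification into noncommutative expressions *)

Ltac nc_in a l :=
  lazymatch l with
  | nil => constr:(false)
  | cons a _ => constr:(true)
  | cons _ ?l' => nc_in a l'
  end.
Ltac nc_atoms l t :=
  lazymatch t with
  | (?x + ?y)%R => let l := nc_atoms l x in nc_atoms l y
  | (?x * ?y)%R => let l := nc_atoms l x in nc_atoms l y
  | (- ?x)%R => nc_atoms l x
  | (_ *: ?x)%R => nc_atoms l x
  | 0%R => l
  | 1%R => l
  | _ => let b := nc_in t l in
         lazymatch b with true => l | false => constr:(cons t l) end
  end.
Ltac nc_index a l :=
  lazymatch l with
  | cons a _ => constr:(0%N)
  | cons _ ?l' => let n := nc_index a l' in constr:(S n)
  end.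
Ltac nc_reify k l t :=
  lazymatch t with
  | (?x + ?y)%R => let a := nc_reify k l x in let b := nc_reify k l y in constr:(@NAdd k a b)
  | (?x * ?y)%R => let a := nc_reify k l x in let b := nc_reify k l y in constr:(@NMul k a b)
  | (- ?x)%R => let a := nc_reify k l x in constr:(@NOpp k a)
  | (?c *: ?x)%R => let a := nc_reify k l x in constr:(@NScale k c a)
  | 0%R => constr:(@NZero k)
  | 1%R => constr:(@NOne k)
  | _ => let n := nc_index t l in constr:(@NVar k n)
  end.
Ltac nc_hyps_atoms l hs :=
  lazymatch hs with
  | (?a, ?b) => let l := nc_hyps_atoms l a in nc_hyps_atoms l b
  | tt => l
  | ?h => lazymatch type of h with ?x = ?y => let l := nc_atoms l x in nc_atoms l y end
  end.
Ltac nc_hyps_rules k l hs acc :=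
  lazymatch hs with
  | (?a, ?b) => let acc := nc_hyps_rules k l b acc in nc_hyps_rules k l a acc
  | tt => acc
  | ?h => lazymatch type of h with
          | ?x = ?y => let e1 := nc_reify k l x in let e2 := nc_reify k l y in
                       constr:(cons (e1, e2) acc)
          end
  end.
Ltac nc_hyps_proof hs acc :=
  lazymatch hs with
  | (?a, ?b) => let acc := nc_hyps_proof b acc in nc_hyps_proof a acc
  | tt => acc
  | ?h => constr:(And3 (erefl true) h acc)
  end.
Ltac ncreduce k A fuel hs :=
  lazymatch goal with
  | |- ?x = ?y =>
    let l := nc_atoms (@nil A) x in
    let l := nc_atoms l y in
    let l := nc_hyps_atoms l hs in
    let e1 := nc_reify k l x in
    let e2 := nc_reify k l y in
    let rs := nc_hyps_rules k l hs (@nil (nexp k * nexp k)) in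
    apply: (@ndenote_eq k A l rs fuel e1 e2);
    [ let p := nc_hyps_proof hs I in exact p
    | cbv [nnorm nmul nmulr nmulrr nateqb wordeqb ninsert ncollect nallzero cat nstrip
           nfind nstep nreduce nmono nrules];
      repeat (match goal with |- _ /\ _ => split end); try exact I ]
  end.
Ltac ncring k A hs := ncreduce k A 12%N hs; try ring.
Ltac ncfield k A hs := ncreduce k A 12%N hs; try (field; repeat (apply/andP; split); done).

(** * Presented algebras and their modules *)

Section Evaluation.
Variables (k : fieldType) (G : Type).

Fixpoint feval (R : pzRingType) (s : k -> R) (g : G -> R) (x : fterm k G) : R :=
  match x with
  | FG a => g a
  | FC c => s c
  | FAdd a b => feval s g a + feval s g b
  | FMul a b => feval s g a * feval s g b
  end.

Definition aeval (A : algType k) (g : G -> A) : fterm k G -> A :=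
  feval (fun c => c%:A) g.

Lemma aevalG (A : algType k) (g : G -> A) a : aeval g (FG a) = g a. Proof. by []. Qed.
Lemma aevalC (A : algType k) (g : G -> A) c : aeval g (FC c) = c%:A. Proof. by []. Qed.
Lemma aevalD (A : algType k) (g : G -> A) x y :
  aeval g (FAdd x y) = aeval g x + aeval g y. Proof. by []. Qed.
Lemma aevalM (A : algType k) (g : G -> A) x y :
  aeval g (FMul x y) = aeval g x * aeval g y. Proof. by []. Qed.

Definition rel_ok (A : algType k) (rel : fterm k G -> fterm k G -> Prop) (g : G -> A) :=
  forall x y, rel x y -> aeval g x = aeval g y.

Lemma aeval_sound (A : algType k) rel (g : G -> A) :
  rel_ok rel g -> forall x y, feq rel x y -> aeval g x = aeval g y.
Proof.
move=> ok x y; elim=> {x y} /=; rewrite /aeval /=.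
- by [].
- by move=> x y _ ->.
- by move=> x y z _ -> _ ->.
- by move=> x x' y y' _ -> _ ->.
- by move=> x x' y y' _ -> _ ->.
- by move=> x y z; rewrite addrA.
- by move=> x y; rewrite addrC.
- by move=> x; rewrite scale0r add0r.
- by move=> x; rewrite scaleN1r mulN1r subrr scale0r.
- by move=> x y z; rewrite mulrA.
- by move=> x; rewrite scale1r mul1r.
- by move=> x; rewrite scale1r mulr1.
- by move=> x y z; rewrite mulrDl.
- by move=> x y z; rewrite mulrDr.
- by move=> a b; rewrite scalerDl.
- by move=> a b; rewrite -scalerAl mul1r scalerA.
- by move=> a x; rewrite mulr_algl mulr_algr.
- exact: ok.
Qed.

Lemma eq_aeval (A : algType k) (g g' : G -> A) (x : fterm k G) :
  g =1 g' -> aeval g x = aeval g' x.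
Proof. by rewrite /aeval => eg; elim: x => //= a -> b ->. Qed.

End Evaluation.

Lemma aeval_fmap (k : fieldType) (A : algType k) (G G' : Type) (f : G' -> fterm k G)
    (g : G -> A) (x : fterm k G') :
  aeval g (fmap f x) = aeval (fun a => aeval g (f a)) x.
Proof. by rewrite /aeval; elim: x => //= [a -> b ->|a -> b ->]. Qed.

(** * Quotients by arbitrary equivalence relations *)

Section ClassicalQuotient.
Variables (T : Type) (e : T -> T -> Prop).
Hypotheses (e_refl : forall x, e x x) (e_sym : forall x y, e x y -> e y x).
Hypothesis e_trans : forall x y z, e x y -> e y z -> e x z.

(** The congruences are undecidable propositions, so classes are predicates, and extensionality
    identifies the predicates of equivalent elements. *)
Record cquot := CQuot { cq_class : T -> Prop; cq_inh : exists x, cq_class = e x }.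

Definition cpi (x : T) : cquot := @CQuot (e x) (ex_intro _ x erefl).
Definition crepr (u : cquot) : T := sval (cid (cq_inh u)).

Lemma cpiP x y : cpi x = cpi y <-> e x y.
Proof.
split=> [[exy]|exy]; first by rewrite exy; apply: e_refl.
have eE : e x = e y.
  by apply/funext => z; apply/propext; split; apply: e_trans; first exact: e_sym.
rewrite /cpi; move: (ex_intro _ x _) (ex_intro _ y _); rewrite eE => p1 p2.
by rewrite (Prop_irrelevance p1 p2).
Qed.

Lemma creprK u : cpi (crepr u) = u.
Proof.
case: u => P hP; rewrite /cpi /crepr; case: cid => x /= eP.
by subst P; congr CQuot; apply: Prop_irrelevance.
Qed.

End ClassicalQuotient.

Section FtermQuotient.
Variables (k : fieldType) (G : Type).
Variable rel : fterm k G -> fterm k G -> Prop.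

(* The consistency proof is a parameter of the carrier because algebras in
   the hierarchy are nontrivial rings. *)
Definition fquot of ~ feq rel (FC 1) (FC 0) := cquot (feq rel).
Hypothesis consistent : ~ feq rel (FC 1) (FC 0).
Local Notation Q := (fquot consistent).

HB.instance Definition _ := gen_eqMixin Q.
HB.instance Definition _ := gen_choiceMixin Q.

Definition fpi (x : fterm k G) : Q := cpi (feq rel) x.
Definition frepr (u : Q) : fterm k G := crepr u.

Lemma fpiP x y : fpi x = fpi y <-> feq rel x y.
Proof.
exact: (cpiP (@feq_refl _ _ rel) (@feq_sym _ _ rel) (@feq_trans _ _ rel)).
Qed.

Lemma freprK u : fpi (frepr u) = u.
Proof. exact: creprK. Qed.

Lemma frepr_pi x : feq rel (frepr (fpi x)) x.
Proof. by apply/fpiP; rewrite freprK. Qed.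

Lemma fquotP (P : Q -> Prop) : (forall x, P (fpi x)) -> forall u, P u.
Proof. by move=> h u; rewrite -(freprK u). Qed.

Let fadd (u v : Q) : Q := fpi (FAdd (frepr u) (frepr v)).
Let fmul (u v : Q) : Q := fpi (FMul (frepr u) (frepr v)).
Let fscale (c : k) (v : Q) : Q := fpi (FMul (FC c) (frepr v)).

Let faddE x y : fadd (fpi x) (fpi y) = fpi (FAdd x y).
Proof. by apply/fpiP; apply: feq_addc; apply: frepr_pi. Qed.
Let fmulE x y : fmul (fpi x) (fpi y) = fpi (FMul x y).
Proof. by apply/fpiP; apply: feq_mulc; apply: frepr_pi. Qed.
Let fscaleE c y : fscale c (fpi y) = fpi (FMul (FC c) y).
Proof. by apply/fpiP; apply: feq_mulc; [apply: feq_refl | apply: frepr_pi]. Qed.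

Let faddA : associative fadd.
Proof.
elim/fquotP => x; elim/fquotP => y; elim/fquotP => z; rewrite !faddE.
by apply/fpiP; apply: feq_addA.
Qed.
Let faddC : commutative fadd.
Proof.
by elim/fquotP => x; elim/fquotP => y; rewrite !faddE; apply/fpiP; apply: feq_addC.
Qed.
Let fadd0 : left_id (fpi (FC 0)) fadd.
Proof. by elim/fquotP => x; rewrite !faddE; apply/fpiP; apply: feq_add0. Qed.
Let faddN : left_inverse (fpi (FC 0)) (fscale (-1)) fadd.
Proof.
elim/fquotP => x; rewrite faddC fscaleE !faddE; apply/fpiP; exact: feq_addN.
Qed.
HB.instance Definition _ := @GRing.isZmodule.Build Q (fpi (FC 0)) (fscale (-1)) fadd
  faddA faddC fadd0 faddN.

Let fmulA : associative fmul.
Proof.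
elim/fquotP => x; elim/fquotP => y; elim/fquotP => z; rewrite !fmulE.
by apply/fpiP; apply: feq_mulA.
Qed.
Let fmul1l : left_id (fpi (FC 1)) fmul.
Proof. by elim/fquotP => x; rewrite !fmulE; apply/fpiP; apply: feq_mul1l. Qed.
Let fmul1r : right_id (fpi (FC 1)) fmul.
Proof. by elim/fquotP => x; rewrite !fmulE; apply/fpiP; apply: feq_mul1r. Qed.
Let fmulDl : left_distributive fmul fadd.
Proof.
elim/fquotP => x; elim/fquotP => y; elim/fquotP => z; rewrite !(fmulE, faddE).
by apply/fpiP; apply: feq_mulDl.
Qed.
Let fmulDr : right_distributive fmul fadd.
Proof.
elim/fquotP => x; elim/fquotP => y; elim/fquotP => z; rewrite !(fmulE, faddE).
by apply/fpiP; apply: feq_mulDr.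
Qed.
Let fone_neq0 : fpi (FC 1) != fpi (FC 0).
Proof. by apply/eqP => /fpiP. Qed.
HB.instance Definition _ := @GRing.Zmodule_isNzRing.Build Q (fpi (FC 1)) fmul
  fmulA fmul1l fmul1r fmulDl fmulDr fone_neq0.

Let fscaleA a b v : fscale a (fscale b v) = fscale (a * b) v.
Proof.
elim/fquotP: v => x; rewrite !fscaleE -!fmulE fmulA; congr fmul.
by rewrite fmulE; apply/fpiP; apply: feq_sym; apply: feq_Cmul.
Qed.
Let fscale1 : left_id 1 fscale.
Proof. by elim/fquotP => x; rewrite fscaleE -fmulE fmul1l. Qed.
Let fscaleDr : right_distributive fscale +%R.
Proof.
by move=> c; elim/fquotP => x; elim/fquotP => y; rewrite [_ + _]faddE !fscaleE [RHS]faddE;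
  apply/fpiP; apply: feq_mulDr.
Qed.
Let fscaleDl v : {morph fscale^~ v : a b / a + b}.
Proof.
move=> a b; elim/fquotP: v => x; rewrite !fscaleE [RHS]faddE -fmulE -faddE -!fmulE -fmulDl.
by congr fmul; rewrite faddE; apply/fpiP; apply: feq_Cadd.
Qed.
HB.instance Definition _ := @GRing.Zmodule_isLmodule.Build k Q fscale
  fscaleA fscale1 fscaleDr fscaleDl.

Let fscaleAl a (u v : Q) : a *: (u * v) = (a *: u) * v.
Proof.
elim/fquotP: u => x; elim/fquotP: v => y.
rewrite [_ * _]fmulE [LHS]fscaleE [_ *: _]fscaleE [RHS]fmulE.
by apply/fpiP; apply: feq_mulA.
Qed.
HB.instance Definition _ := @GRing.Lmodule_isLalgebra.Build k Q fscaleAl.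

Let fscaleAr a (u v : Q) : a *: (u * v) = u * (a *: v).
Proof.
elim/fquotP: u => x; elim/fquotP: v => y.
rewrite [_ * _]fmulE [LHS]fscaleE [_ *: _]fscaleE [RHS]fmulE.
apply/fpiP; apply: (feq_trans (feq_mulA _ _ _ _)).
apply: feq_trans (feq_sym (feq_mulA _ _ _ _)).
by apply: feq_mulc; [apply: feq_Ccomm | apply: feq_refl].
Qed.
HB.instance Definition _ := @GRing.Lalgebra_isAlgebra.Build k Q fscaleAr.

Lemma fpiD x y : fpi (FAdd x y) = fpi x + fpi y.
Proof. by rewrite [RHS]faddE. Qed.
Lemma fpiM x y : fpi (FMul x y) = fpi x * fpi y.
Proof. by rewrite [RHS]fmulE. Qed.
Lemma fpiC c : fpi (FC c) = c%:A.
Proof. by rewrite [RHS]fscaleE; apply/fpiP; apply: feq_sym; apply: feq_mul1r. Qed.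
Lemma fpiE x : fpi x = aeval (fun a => fpi (FG a)) x.
Proof.
by rewrite /aeval; elim: x => //= [c|a <- b <-|a <- b <-]; rewrite ?fpiC ?fpiD ?fpiM.
Qed.

Lemma fpi_rel x y : rel x y -> fpi x = fpi y.
Proof. by move=> r; apply/fpiP; apply: feq_rel. Qed.

Lemma fpi_ok : rel_ok rel (fun a => fpi (FG a)).
Proof. by move=> x y r; rewrite -!fpiE; apply: fpi_rel. Qed.

Section Lift.
Variables (A : algType k) (g : G -> A).
Hypothesis ok : rel_ok rel g.

Definition flift (u : Q) : A := aeval g (frepr u).

Lemma fliftE x : flift (fpi x) = aeval g x.
Proof. by apply: (aeval_sound ok); apply: frepr_pi. Qed.

Lemma fliftM u v : flift (u * v) = flift u * flift v.
Proof. by elim/fquotP: u => x; elim/fquotP: v => y; rewrite -fpiM !fliftE. Qed.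

Lemma flift_linear c u v : flift (c *: u + v) = c *: flift u + flift v.
Proof.
elim/fquotP: u => x; elim/fquotP: v => y.
by rewrite -mulr_algl -fpiC -fpiM -fpiD !fliftE /aeval /= mulr_algl.
Qed.

End Lift.
End FtermQuotient.

Section LinearFunctions.
Variables (k : fieldType) (V W : lmodType k) (f : V -> W).
Hypothesis f_lin : linear f.

Lemma lin_add u v : f (u + v) = f u + f v.
Proof. by rewrite -[u]scale1r f_lin !scale1r. Qed.
Lemma lin_zero : f 0 = 0.
Proof. by apply: (addIr (f 0)); rewrite -lin_add !add0r. Qed.
Lemma lin_scale c u : f (c *: u) = c *: f u.
Proof. by rewrite -[_ *: u]addr0 f_lin lin_zero addr0. Qed.
End LinearFunctions.

(** * The algebra of linear endomorphisms *)

Section Endomorphisms.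
Variables (k : fieldType) (V : lmodType k).

Record endo := Endo { endo_fun :> V -> V; endo_linear : linear endo_fun }.

Lemma endoP (f g : endo) : f =1 g -> f = g.
Proof.
case: f g => f lf [g lg] /= /funext efg; subst g.
by congr Endo; apply: Prop_irrelevance.
Qed.

Lemma endoD (f : endo) x y : f (x + y) = f x + f y.
Proof. exact: lin_add (endo_linear f) x y. Qed.
Lemma endo0 (f : endo) : f 0 = 0.
Proof. exact: lin_zero (endo_linear f). Qed.
Lemma endoZ (f : endo) c x : f (c *: x) = c *: f x.
Proof. exact: lin_scale (endo_linear f) c x. Qed.

(** The nonzero vector serves to prove that [1 != 0] in the endomorphism ring. *)
Definition nzendo (v : V) of v != 0 := endo.

Variables (v : V) (v_neq0 : v != 0).
Local Notation End := (nzendo v_neq0).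

HB.instance Definition _ := gen_eqMixin End.
HB.instance Definition _ := gen_choiceMixin End.

Let zero_linear : linear (fun _ : V => 0 : V).
Proof. by move=> c x y; rewrite scaler0 addr0. Qed.
Let one_linear : linear (@id V).
Proof. by []. Qed.
Let add_linear (f g : End) : linear (fun x => endo_fun f x + endo_fun g x).
Proof. by move=> c x y; rewrite !endo_linear scalerDr addrACA. Qed.
Let opp_linear (f : End) : linear (fun x => - endo_fun f x).
Proof. by move=> c x y; rewrite endo_linear opprD scalerN. Qed.
Let mul_linear (f g : End) : linear (fun x => endo_fun f (endo_fun g x)).
Proof. by move=> c x y; rewrite !endo_linear. Qed.
Let scale_linear a (f : End) : linear (fun x => a *: endo_fun f x).
Proof. by move=> c x y; rewrite endo_linear scalerDr !scalerA mulrC. Qed.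

Definition endo_zero : End := Endo zero_linear.
Definition endo_one : End := Endo one_linear.
Definition endo_add (f g : End) : End := Endo (add_linear f g).
Definition endo_opp (f : End) : End := Endo (opp_linear f).
Definition endo_mul (f g : End) : End := Endo (mul_linear f g).
Definition endo_scale a (f : End) : End := Endo (scale_linear a f).

Let eaddA : associative endo_add.
Proof. by move=> f g h; apply: endoP => x /=; rewrite addrA. Qed.
Let eaddC : commutative endo_add.
Proof. by move=> f g; apply: endoP => x /=; rewrite addrC. Qed.
Let eadd0 : left_id endo_zero endo_add.
Proof. by move=> f; apply: endoP => x /=; rewrite add0r. Qed.
Let eaddN : left_inverse endo_zero endo_opp endo_add.
Proof. by move=> f; apply: endoP => x /=; rewrite addNr. Qed.
HB.instance Definition _ := @GRing.isZmodule.Build End endo_zero endo_opp endo_add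
  eaddA eaddC eadd0 eaddN.

Let emulA : associative endo_mul.
Proof. by move=> f g h; apply: endoP. Qed.
Let emul1l : left_id endo_one endo_mul.
Proof. by move=> f; apply: endoP. Qed.
Let emul1r : right_id endo_one endo_mul.
Proof. by move=> f; apply: endoP. Qed.
Let emulDl : left_distributive endo_mul endo_add.
Proof. by move=> f g h; apply: endoP. Qed.
Let emulDr : right_distributive endo_mul endo_add.
Proof. by move=> f g h; apply: endoP => x /=; rewrite endoD. Qed.
Let eone_neq0 : endo_one != endo_zero.
Proof.
apply/eqP => /(congr1 (fun f : End => endo_fun f v)) /= v0.
by have := v_neq0; rewrite v0 eqxx.
Qed.
HB.instance Definition _ := @GRing.Zmodule_isNzRing.Build End endo_one endo_mul
  emulA emul1l emul1r emulDl emulDr eone_neq0.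

Let escaleA a b f : endo_scale a (endo_scale b f) = endo_scale (a * b) f.
Proof. by apply: endoP => x /=; rewrite scalerA. Qed.
Let escale1 : left_id 1 endo_scale.
Proof. by move=> f; apply: endoP => x /=; rewrite scale1r. Qed.
Let escaleDr : right_distributive endo_scale +%R.
Proof. by move=> a f g; apply: endoP => x /=; rewrite scalerDr. Qed.
Let escaleDl f : {morph endo_scale^~ f : a b / a + b}.
Proof. by move=> a b; apply: endoP => x /=; rewrite scalerDl. Qed.
HB.instance Definition _ := @GRing.Zmodule_isLmodule.Build k End endo_scale
  escaleA escale1 escaleDr escaleDl.

Let escaleAl a (f g : End) : a *: (f * g) = (a *: f) * g.
Proof. by apply: endoP. Qed.
HB.instance Definition _ := @GRing.Lmodule_isLalgebra.Build k End escaleAl.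
Let escaleAr a (f g : End) : a *: (f * g) = f * (a *: g).
Proof. by apply: endoP => x /=; rewrite endoZ. Qed.
HB.instance Definition _ := @GRing.Lalgebra_isAlgebra.Build k End escaleAr.

Lemma endo_addE (f g : End) x : (f + g : End) x = f x + g x. Proof. by []. Qed.
Lemma endo_mulE (f g : End) x : (f * g : End) x = f (g x). Proof. by []. Qed.
Lemma endo_scaleE a (f : End) x : (a *: f : End) x = a *: f x. Proof. by []. Qed.
Lemma endo_oppE (f : End) x : (- f : End) x = - f x. Proof. by []. Qed.
Lemma endo_sumE (I : Type) (r : seq I) (P : pred I) (F : I -> End) x :
  (\sum_(i <- r | P i) F i : End) x = \sum_(i <- r | P i) F i x.
Proof. by elim/big_rec2: _ => // i y z _ <-. Qed.

End Endomorphisms.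

(** * Representations of quantum groups *)

Section Brackets.
Variables (k : fieldType) (A : algType k).
Implicit Types (q : k) (a b : A).

Definition br q a b : A := a * b - q^-1 *: (b * a).
(** The cubic form isolates [a * a * b], so that it can serve as a rewriting rule. It is invariant
    under exchanging [q] and [q^-1], hence also applies to brackets formed with [q^-1]. *)
Definition serre q a b : Prop := a * a * b = (q + q^-1) *: (a * b * a) - b * a * a.

Lemma serreP q a b : q != 0 ->
  (a * br q a b = q *: (br q a b * a)) <-> serre q a b.
Proof.
rewrite /serre /br => q0; split=> s; apply/eqP; rewrite -subr_eq0.
  move/eqP: s; rewrite -subr_eq0 => /eqP <-; apply/eqP; ncfield k A tt.
move/eqP: s; rewrite -subr_eq0 => /eqP <-; apply/eqP; ncfield k A tt.
Qed.

Lemma serreV q a b : serre q^-1 a b <-> serre q a b.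
Proof. by rewrite /serre invrK (addrC q^-1 q); split. Qed.

Lemma serre_scale q c d a b : q != 0 -> serre q a b -> serre q (c *: a) (d *: b).
Proof. by rewrite /serre => q0 s; ncfield k A s. Qed.

(** The three q-commutations are those between [K_(-alpha) (x) E] and [E (x) 1]; they make the mixed
    terms of the Serre expression cancel. *)
Lemma serre_sum q (a1 b1 a2 b2 : A) : q != 0 ->
  a1 * a2 = q ^- 2 *: (a2 * a1) -> a1 * b2 = q *: (b2 * a1) -> b1 * a2 = q *: (a2 * b1) ->
  serre q a1 b1 -> serre q a2 b2 -> serre q (a1 + a2) (b1 + b2).
Proof.
rewrite /serre => q0 r1 r2 r3 s1 s2.
ncfield k A (r1, r2, r3, s1, s2).
Qed.

End Brackets.

Lemma expzN1 (k : fieldType) (q : k) : q ^ (-1 : int) = q^-1.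
Proof. by rewrite -invr_expz expr1z. Qed.

Lemma sqr_sub1_neq0 (k : fieldType) (q : k) : q != 0 -> q - q^-1 != 0 -> q * q - 1 != 0.
Proof.
move=> q0; apply: contraNneq => /eqP; rewrite subr_eq0 => /eqP e.
by rewrite subr_eq0 -[q^-1]mulr1 -e mulKf.
Qed.

Section QuantumGroupReps.
Variables (k : fieldType) (q : k) (D : datum).
Hypothesis q0 : q != 0.
Local Notation "<< x , y >>" := (dpair x y).

Record datum_ok : Prop := DatumOk {
  dok_addC : forall u v : dL D, dadd u v = dadd v u;
  dok_addN : forall u : dL D, dadd u (dopp u) = dzero D;
  dok_oppD : forall u v : dL D, dopp (dadd u v) = dadd (dopp u) (dopp v);
  dok_opp0 : dopp (dzero D) = dzero D;
  dok_oppK : forall u : dL D, dopp (dopp u) = u;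
  dok_pairN : forall u v : dL D, << dopp u, v >> = - << u, v >>;
  dok_sym : forall i j : dI D, << dalpha i, dalpha j >> = << dalpha j, dalpha i >>;
  dok_diag : forall i : dI D, << dalpha i, dalpha i >> = 2;
  dok_two : forall i j : dI D, << dalpha i, dalpha j >> = 2 -> i = j }.

Section Algebra.
Variable A : algType k.

(** The defining relations at the level of values, oriented as rewriting rules. The case of pairing
    2 is left out because it forces [i = j], where commutation is trivial. *)
Record urep (g : ugen D -> A) : Prop := URep {
  ur_K0E : g (UK (dzero D)) = 1;
  ur_KKE : forall mu la, g (UK mu) * g (UK la) = g (UK (dadd mu la));
  ur_KEE : forall mu i, g (UK mu) * g (UE i) = q ^ << mu, dalpha i >> *: (g (UE i) * g (UK mu));
  ur_KFE : forall mu i, g (UK mu) * g (UF i) = q ^ (- << mu, dalpha i >>) *: (g (UF i) * g (UK mu));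
  ur_EEE : forall i j, << dalpha i, dalpha j >> = 0 -> g (UE i) * g (UE j) = g (UE j) * g (UE i);
  ur_FFE : forall i j, << dalpha i, dalpha j >> = 0 -> g (UF i) * g (UF j) = g (UF j) * g (UF i);
  ur_EsE : forall i j, << dalpha i, dalpha j >> = -1 -> serre q (g (UE i)) (g (UE j));
  ur_FsE : forall i j, << dalpha i, dalpha j >> = -1 -> serre q (g (UF i)) (g (UF j));
  ur_EFne : forall i j, i != j -> g (UE i) * g (UF j) = g (UF j) * g (UE i);
  ur_EFeq : forall i, g (UE i) * g (UF i) =
    g (UF i) * g (UE i) + (q - q^-1)^-1 *: (g (UK (dalpha i)) - g (UK (dopp (dalpha i)))) }.

Lemma aeval_sub (G : Type) (g : G -> A) x y : aeval g (FSub x y) = aeval g x - aeval g y.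
Proof. by rewrite /aeval /= -[X in _ + X]scalerAl mul1r scaleN1r. Qed.

Lemma aeval_qbr (g : ugen D -> A) x y : aeval g (qbr q x y) = br q (aeval g x) (aeval g y).
Proof. by rewrite aeval_sub /aeval /br /= -[X in _ - X]scalerAl mul1r. Qed.

Lemma aeval_scale (G : Type) (g : G -> A) c x : aeval g (FMul (FC c) x) = c *: aeval g x.
Proof. by rewrite /aeval /= mulr_algl. Qed.

Lemma urepP (g : ugen D -> A) : datum_ok -> urep g <-> rel_ok (@urel k q D) g.
Proof.
move=> ok; split=> [[K0 KK KE KF EE FF Es Fs EF0 EF1]|r].
  move=> x y; case=> {x y}; rewrite /gE /gF /gK.
  - by rewrite /aeval /= K0 scale1r.
  - by move=> *; exact: KK.
  - by move=> mu i; rewrite aeval_scale; apply: KE.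
  - by move=> mu i; rewrite aeval_scale; apply: KF.
  - by move=> i j /orP[/eqP/EE//|/eqP/(dok_two ok) ->].
  - by move=> i j /orP[/eqP/FF//|/eqP/(dok_two ok) ->].
  - by move=> i j /Es /serreP s; rewrite aeval_scale !aevalM !aeval_qbr !aevalG s.
  - by move=> i j /Fs /serreP s; rewrite aeval_scale !aevalM !aeval_qbr !aevalG s.
  - move=> i j; rewrite aeval_sub; case: eqVneq => [<-|ne]; last first.
      by rewrite /aeval /= EF0 // subrr scale0r.
    by rewrite aeval_scale aeval_sub /aeval /= EF1 addrAC subrr add0r.
have R x y : urel q x y -> aeval g x = aeval g y by exact: r.
split.
- by have := R _ _ (ur_K0 q D); rewrite /aeval /= scale1r.
- by move=> mu la; have := R _ _ (ur_KK q mu la).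
- by move=> mu i; have := R _ _ (ur_KE q mu i); rewrite aeval_scale.
- by move=> mu i; have := R _ _ (ur_KF q mu i); rewrite aeval_scale.
- by move=> i j ij; have := R _ _ (@ur_EE k q D i j _); rewrite ij; apply.
- by move=> i j ij; have := R _ _ (@ur_FF k q D i j _); rewrite ij; apply.
- move=> i j ij; apply/serreP => //; have := R _ _ (@ur_Eserre k q D i j ij).
  by rewrite aeval_scale !aevalM !aeval_qbr.
- move=> i j ij; apply/serreP => //; have := R _ _ (@ur_Fserre k q D i j ij).
  by rewrite aeval_scale !aevalM !aeval_qbr.
- move=> i j /negbTE ne; have := R _ _ (ur_EF q i j); rewrite ne aeval_sub /aeval /= scale0r.
  by move/eqP; rewrite subr_eq0 => /eqP.
- move=> i; have := R _ _ (ur_EF q i i); rewrite eqxx aeval_sub aeval_scale aeval_sub /aeval /=.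
  by move=> <-; rewrite addrC subrK.
Qed.

Hypothesis ok : datum_ok.

Lemma urep_KN g : urep g -> forall mu, g (UK mu) * g (UK (dopp mu)) = 1.
Proof. by move=> u mu; rewrite (ur_KKE u) (dok_addN ok) (ur_K0E u). Qed.

Lemma urep_KC g : urep g -> forall mu la, g (UK mu) * g (UK la) = g (UK la) * g (UK mu).
Proof. by move=> u mu la; rewrite !(ur_KKE u) (dok_addC ok). Qed.

Definition utwist (t : dI D -> k) (g : ugen D -> A) (a : ugen D) : A :=
  match a with
  | UE i => t i *: g (UE i)
  | UF i => (t i)^-1 *: g (UF i)
  | UK mu => g (UK mu)
  end.

(** The product of [E_i] and [F_i] is unchanged, and all other relations are homogeneous in each
    generator. *)
Lemma urep_twist t g : (forall i, t i != 0) -> urep g -> urep (utwist t g).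
Proof.
move=> t0 u; split=> /=.
- exact: ur_K0E.
- exact: ur_KKE.
- by move=> mu i; rewrite -scalerAr (ur_KEE u) -scalerAl !scalerA mulrC.
- by move=> mu i; rewrite -scalerAr (ur_KFE u) -scalerAl !scalerA mulrC.
- move=> i j ij; rewrite -!(scalerAl, scalerAr) (ur_EEE u ij) !scalerA mulrC //.
- move=> i j ij; rewrite -!(scalerAl, scalerAr) (ur_FFE u ij) !scalerA mulrC //.
- by move=> i j ij; apply: serre_scale => //; apply: (ur_EsE u).
- by move=> i j ij; apply: serre_scale => //; apply: (ur_FsE u).
- move=> i j ij; rewrite -!(scalerAl, scalerAr) (ur_EFne u ij) !scalerA mulrC //.
- move=> i; rewrite -!(scalerAl, scalerAr) (ur_EFeq u) !scalerA divff // mulVf //.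
  by rewrite !scale1r.
Qed.

Definition ucomb (g1 g2 : ugen D -> A) (a : ugen D) : A :=
  match a with
  | UE i => g1 (UK (dopp (dalpha i))) * g2 (UE i) + g1 (UE i)
  | UF i => g1 (UF i) * g2 (UK (dalpha i)) + g2 (UF i)
  | UK mu => g1 (UK mu) * g2 (UK mu)
  end.

(** [ucomb] copies the coproduct, so this is the compatibility of the coproduct with the relations.
    It yields the tensor product of two oscillators, and the deformed left multiplications of the
    smash product together with the adjoint actions inside them. *)
Lemma urep_comb g1 g2 : urep g1 -> urep g2 ->
  (forall a b, g1 a * g2 b = g2 b * g1 a) -> urep (ucomb g1 g2).
Proof.
move=> u1 u2 c12.
have c21 a b : g2 b * g1 a = g1 a * g2 b by rewrite c12.
have qn0 (n : int) : q ^ n != 0 by rewrite expfz_neq0.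
have NE1 i j : g1 (UK (dopp (dalpha i))) * g1 (UE j) =
    (q ^ << dalpha i, dalpha j >>)^-1 *: (g1 (UE j) * g1 (UK (dopp (dalpha i)))).
  by rewrite (ur_KEE u1) (dok_pairN ok) -invr_expz.
have KF2 i j : g2 (UK (dalpha i)) * g2 (UF j) =
    (q ^ << dalpha i, dalpha j >>)^-1 *: (g2 (UF j) * g2 (UK (dalpha i))).
  by rewrite (ur_KFE u2) -invr_expz.
have NF1 i j : g1 (UK (dopp (dalpha i))) * g1 (UF j) =
    q ^ << dalpha i, dalpha j >> *: (g1 (UF j) * g1 (UK (dopp (dalpha i)))).
  by rewrite (ur_KFE u1) (dok_pairN ok) opprK.
split=> /=.
- by rewrite (ur_K0E u1) (ur_K0E u2) mulr1.
- move=> mu la; rewrite -(ur_KKE u1) -(ur_KKE u2).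
  ncfield k A (c21 (UK la) (UK mu)).
- move=> mu i.
  have h1 := ur_KEE u1 mu i; have h2 := ur_KEE u2 mu i.
  have h3 := urep_KC u1 mu (dopp (dalpha i)).
  have h4 := c21 (UK (dopp (dalpha i))) (UK mu).
  have h5 := c21 (UE i) (UK mu).
  have h6 := c21 (UK mu) (UE i).
  ncfield k A (h1, h2, h3, h4, h5, h6).
- move=> mu i.
  have h1 := ur_KFE u1 mu i; have h2 := ur_KFE u2 mu i.
  have h3 := urep_KC u2 mu (dalpha i).
  have h4 := c21 (UK mu) (UF i).
  have h5 := c21 (UF i) (UK mu).
  have h6 := c21 (UF i) (UK (dalpha i)).
  have h7 := c21 (UK mu) (UK (dalpha i)).
  ncfield k A (h1, h2, h3, h4, h5, h6, h7).
- move=> i j ij.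
  have h1 := NE1 i j; have h2 := NE1 j i; rewrite (dok_sym ok) in h2.
  rewrite ij expr0z invr1 in h1 h2.
  have h3 := urep_KC u1 (dopp (dalpha i)) (dopp (dalpha j)).
  have h4 := ur_EEE u1 ij; have h5 := ur_EEE u2 ij.
  ncfield k A (h1, h2, h3, h4, h5,
    c21 (UE i) (UE j), c21 (UE j) (UE i),
    c21 (UK (dopp (dalpha i))) (UE j), c21 (UK (dopp (dalpha j))) (UE i)).
- move=> i j ij.
  have h1 := KF2 i j; have h2 := KF2 j i; rewrite (dok_sym ok) in h2.
  rewrite ij expr0z invr1 in h1 h2.
  have h3 := urep_KC u2 (dalpha i) (dalpha j).
  have h4 := ur_FFE u1 ij; have h5 := ur_FFE u2 ij.
  ncfield k A (h1, h2, h3, h4, h5,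
    c21 (UF i) (UF j), c21 (UF j) (UF i),
    c21 (UF i) (UK (dalpha j)), c21 (UF j) (UK (dalpha i))).
- move=> i j ij.
  have h1 := NE1 i j; have h2 := NE1 j i; have h0 := NE1 i i.
  rewrite (dok_sym ok) in h2; rewrite ij in h1 h2.
  rewrite (dok_diag ok) -exprnP in h0.
  rewrite -[-1]/(- (1 : int)) -invr_expz expr1z invrK in h1 h2.
  have h3 := urep_KC u1 (dopp (dalpha i)) (dopp (dalpha j)).
  apply: serre_sum => //.
  + ncfield k A (h0, c21 (UE i) (UE i)).
  + ncfield k A (h1, c21 (UE j) (UE i)).
  + ncfield k A (h2, c21 (UE i) (UE j)).
  + have := ur_EsE u2 ij; rewrite /serre => s.
    ncfield k A (c21 (UK (dopp (dalpha i))) (UE j), c21 (UK (dopp (dalpha j))) (UE i),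
      c21 (UK (dopp (dalpha i))) (UE i), h3, s).
  + exact: ur_EsE.
- move=> i j ij.
  have h1 := KF2 i j; have h2 := KF2 j i; have h0 := KF2 i i.
  rewrite (dok_sym ok) in h2; rewrite ij in h1 h2.
  rewrite (dok_diag ok) -exprnP in h0.
  rewrite -[-1]/(- (1 : int)) -invr_expz expr1z invrK in h1 h2.
  have h3 := urep_KC u2 (dalpha i) (dalpha j).
  apply: serre_sum => //.
  + ncfield k A (h0, c21 (UF i) (UF i)).
  + ncfield k A (h1, c21 (UF i) (UF j)).
  + ncfield k A (h2, c21 (UF j) (UF i)).
  + have := ur_FsE u1 ij; rewrite /serre => s.
    ncfield k A (c21 (UF i) (UK (dalpha j)), c21 (UF j) (UK (dalpha i)),
      c21 (UF i) (UK (dalpha i)), h3, s).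
  + exact: ur_FsE.
- move=> i j ij.
  have h1 := NF1 i j.
  have h2 := ur_KEE u2 (dalpha j) i; rewrite (dok_sym ok) in h2.
  have h3 := ur_EFne u1 ij; have h4 := ur_EFne u2 ij.
  ncfield k A (h1, h2, h3, h4, c21 (UF j) (UE i), c21 (UE i) (UF j),
    c21 (UE i) (UK (dalpha j)), c21 (UK (dopp (dalpha i))) (UK (dalpha j)),
    c21 (UK (dopp (dalpha i))) (UF j)).
- move=> i.
  have h1 := NF1 i i.
  have h2 := ur_KEE u2 (dalpha i) i.
  have h3 := ur_EFeq u1 i; have h4 := ur_EFeq u2 i.
  set d := (q - q^-1)^-1 in h3 h4 *.
  ncfield k A (h1, h2, h3, h4, c21 (UF i) (UE i), c21 (UE i) (UF i),
    c21 (UE i) (UK (dalpha i)), c21 (UK (dopp (dalpha i))) (UK (dalpha i)),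
    c21 (UK (dopp (dalpha i))) (UF i)).
Qed.

End Algebra.
End QuantumGroupReps.

(** * Quantum Serre relations and chains of brackets *)

Section SerreConsequences.
Variables (k : fieldType) (A : algType k) (q : k).
Hypotheses (q0 : q != 0) (q2 : q + q^-1 != 0).
Implicit Types e a b : A.

Lemma scale_cancel (c : k) (v : A) : c != 0 -> c *: v = 0 -> v = 0.
Proof. by move=> c0 /eqP; rewrite scaler_eq0 (negbTE c0) => /eqP. Qed.

(* Both ways of straightening [a a e b = a a b e] agree. *)
Lemma serre_overlap a e b : e * b = b * e -> serre q a e -> serre q a b ->
  a * e * a * b = e * a * b * a + a * b * a * e - b * a * e * a.
Proof.
rewrite /serre => eb s1 s2.
apply/eqP; rewrite -subr_eq0; apply/eqP/(scale_cancel q2).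
have ->: (q + q^-1) *: (a * e * a * b - (e * a * b * a + a * b * a * e - b * a * e * a)) =
  a * a * (e * b - b * e) - (e * b - b * e) * a * a by ncfield k A (s1, s2).
by rewrite eb subrr mulr0 !mul0r subrr.
Qed.

(** The overlap identity read as a commutator. On a path [e - a - b] the vector has weight
    orthogonal to the root of the middle node [a]. *)
Lemma chain_comm e a b : e * b = b * e -> serre q a e -> serre q a b ->
  a * br q (br q e a) b = br q (br q e a) b * a.
Proof.
move=> eb s1 s2; have h := serre_overlap eb s1 s2.
by move: s1 s2; rewrite /serre /br => s1 s2; ncfield k A (eb, s1, s2, h).
Qed.

Lemma chain_serre_r e a b : e * b = b * e -> serre q b a -> serre q b (br q e a).
Proof. by rewrite /serre /br => /esym be s; ncfield k A (be, s). Qed.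

Lemma serre_br e a : serre q e a -> e * br q e a = q *: (br q e a * e).
Proof. by move=> s; apply/serreP. Qed.

Lemma serre_br_r e a : serre q a e -> br q e a * a = q *: (a * br q e a).
Proof. by rewrite /serre /br => s; ncfield k A s. Qed.

(** Let [z] be the bracket of [br q e a] with [b]. Since [a] commutes and [e] q-commutes with [z],
    their bracket q-commutes with [z], and this is the Serre relation by [serreP]. *)
Lemma chain_serre_l e a b : e * b = b * e -> serre q e a -> serre q a e -> serre q a b ->
  serre q (br q e a) b.
Proof.
move=> eb s1 s2 s3; apply/serreP => //.
have az := chain_comm eb s2 s3; set z := br q (br q e a) b in az *.
have ex := serre_br s1.
have ez : e * z = q *: (z * e).
  by rewrite /z [br q _ b]/br; set x := br q e a in ex *; ncfield k A (ex, eb).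
by rewrite /br; ncfield k A (az, ez).
Qed.

(** Here [a] and [b] are two neighbours of the node [e] that are not joined to each other;
    [serre_overlap] is again the only identity beyond the Serre relations themselves. *)
Lemma fork_comm e a b : a * b = b * a -> serre q e a -> serre q e b ->
  br q e a * br q e b = br q e b * br q e a.
Proof.
move=> ab s1 s2; have h := serre_overlap ab s1 s2.
by move: s1 s2; rewrite /serre /br => s1 s2; ncfield k A (ab, s1, s2, h).
Qed.

(* The adjoint action of [e] on the Serre element of [a], [b], applied three
   times, is [[2][3]] times the Serre element of [br q e a], [br q e b]. *)
Lemma fork_serre e a b : q ^+ 2 + 1 + q ^- 2 != 0 ->
  serre q e a -> serre q e b -> serre q a b -> serre q (br q e a) (br q e b).
Proof.
rewrite /serre => q3 s1 s2 s3.
pose u := a * a * b - ((q + q^-1) *: (a * b * a) - b * a * a).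
have u0 : u = 0 by rewrite /u s3 subrr.
pose w1 := e * u - q ^- 3 *: (u * e).
pose w2 := e * w1 - q ^- 1 *: (w1 * e).
apply/eqP; rewrite -subr_eq0; apply/eqP.
apply: (@scale_cancel ((q + q^-1) * (q ^+ 2 + 1 + q ^- 2))); first by rewrite mulf_neq0.
transitivity (e * w2 - q *: (w2 * e)); last first.
  by rewrite /w2 /w1 u0 !(mulr0, mul0r, scaler0, subrr).
rewrite /w2 /w1 /u /br {w1 w2 u0 u}.
ncreduce k A 20%N (s1, s2); try (field; done).
Qed.

Hypothesis qm : q - q^-1 != 0.
Local Notation d := (q - q^-1)^-1.

(** In the application [c], [w] are the torus elements of two adjacent roots and [c'], [w'] their
    inverses; the conclusion is the relation between [E] and [F] for the sum of the roots. Only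
    relations that reappear for the new vectors are assumed, so the lemma iterates along a chain. *)
Lemma br_sl2 e f e' f' (c c' w w' : A) :
  e * f = f * e + d *: (c - c') -> e' * f' = f' * e' + d *: (w - w') ->
  e * f' = f' * e -> e' * f = f * e' ->
  c * e' = q^-1 *: (e' * c) -> c' * e' = q *: (e' * c') ->
  c * f' = q *: (f' * c) -> c' * f' = q^-1 *: (f' * c') ->
  w * e = q^-1 *: (e * w) -> w' * e = q *: (e * w') ->
  w * f = q *: (f * w) -> w' * f = q^-1 *: (f * w') ->
  c * w = w * c -> c' * w' = w' * c' -> c * w' = w' * c -> c' * w = w * c' ->
  br q e e' * (f' * f - q *: (f * f')) =
  (f' * f - q *: (f * f')) * br q e e' + d *: (w * c - w' * c').
Proof.
rewrite /br.
move=> h1 h2 h3 h4 h5 h6 h7 h8 h9 h10 h11 h12 h13 h14 h15 h16.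
ncreduce k A 12%N (h1, h2, h3, h4, h5, h6, h7, h8, h9, h10, h11, h12, h13, h14, h15, h16).
all: try (field; rewrite ?q0 ?(sqr_sub1_neq0 q0 qm); done).
Qed.

(** This is [T_i T_j E_i = E_j] for adjacent nodes: [br q e e'] is [T_i E_j], and [- (f * c)] is
    [T_i E_i]. *)
Lemma br_cancel e f e' (c c' : A) :
  e * f = f * e + d *: (c - c') -> e' * f = f * e' -> c * e' = q^-1 *: (e' * c) ->
  c' * e' = q *: (e' * c') -> c * e = q ^+ 2 *: (e * c) -> c' * c = 1 ->
  br q (br q e e') (- (f * c)) = e'.
Proof.
rewrite /br => h1 h2 h3 h4 h5 h6.
ncreduce k A 12%N (h1, h2, h3, h4, h5, h6).
all: try (field; rewrite ?q0 ?(sqr_sub1_neq0 q0 qm); done).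
Qed.
End SerreConsequences.

Section Chains.
Variables (k : fieldType) (A : algType k) (q : k).
Hypotheses (q0 : q != 0) (q2 : q + q^-1 != 0).

Fixpoint chain (e : nat -> A) (n : nat) : A :=
  if n is n'.+1 then br q (chain e n') (e n) else e 0%N.

Lemma br_comm (u v w : A) : u * w = w * u -> v * w = w * v -> br q u v * w = w * br q u v.
Proof. by rewrite /br => h1 h2; ncfield k A (h1, h2). Qed.

Lemma eq_chain (e e' : nat -> A) n : (forall j, (j <= n)%N -> e j = e' j) -> chain e n = chain e' n.
Proof.
elim: n => [|n IH] h /=; first exact: h.
by rewrite IH ?h // => j jn; apply: h; apply: leqW.
Qed.

Section TypeA.
Variables (m : nat) (e : nat -> A).

Record typeA : Prop := TypeA {
  typeA_far : forall i j, (i < m)%N -> (j < m)%N -> (i.+1 < j)%N -> e i * e j = e j * e i;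
  typeA_up : forall i, (i.+1 < m)%N -> serre q (e i) (e i.+1);
  typeA_down : forall i, (i.+1 < m)%N -> serre q (e i.+1) (e i) }.

Hypothesis eA : typeA.
Let x := chain e.

Lemma chain_far i j : (i.+1 < j)%N -> (j < m)%N -> x i * e j = e j * x i.
Proof.
elim: i => [|i IH] ij jm; first by apply: (typeA_far eA) => //; lia.
by apply: br_comm; [apply: IH; lia | apply: (typeA_far eA); lia].
Qed.

Lemma chain_serre i : (i.+1 < m)%N -> serre q (x i) (e i.+1) /\ serre q (e i.+1) (x i).
Proof.
elim: i => [|i IH] im; first by split; [apply: (typeA_up eA) | apply: (typeA_down eA)].
have [s1 s2] := IH (ltnW im).
have far : x i * e i.+2 = e i.+2 * x i by apply: chain_far.
split; first by apply: chain_serre_l => //; apply: (typeA_up eA).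
by apply: chain_serre_r => //; apply: (typeA_down eA).
Qed.

Lemma chain_top i : (i.+1 < m)%N -> x i.+1 * e i.+1 = q *: (e i.+1 * x i.+1).
Proof. by move=> im; have [_ s] := chain_serre im; apply: serre_br_r. Qed.

(** All cases are inherited through the brackets except the last interior node, where [x i] is a
    bracket along a path centred at [e j] and [chain_comm] applies. *)
Lemma chain_below i j : (0 < j)%N -> (j < i)%N -> (i < m)%N -> x i * e j = e j * x i.
Proof.
elim: i => // i IH j0 ji im; have [ltji|eqij] : (j < i)%N \/ j = i by lia.
  apply: br_comm; first by apply: IH => //; lia.
  by apply/esym; apply: (typeA_far eA); lia.
case: i => [|i] in IH ji im eqij *; first lia.
have im' : (i.+1 < m)%N by lia.
rewrite eqij; apply/esym; apply: chain_comm => //; first by apply: chain_far.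
  by case: (chain_serre im').
exact: (typeA_up eA).
Qed.

(** For [j = i + 1] this is the Serre relation between [x i] and the next generator; later
    generators commute with [x i] and preserve the relation. *)
Lemma chain_qcomm i j : (i < j)%N -> (j < m)%N -> x i * x j = q *: (x j * x i).
Proof.
elim: j => // j IH ij jm; have [ltij|eqij] : (i < j)%N \/ i = j by lia.
  have h := IH ltij (ltnW jm).
  have far : x i * e j.+1 = e j.+1 * x i by apply: chain_far.
  by rewrite [x j.+1]/(br q (x j) (e j.+1)) /br; ncfield k A (h, far).
by rewrite eqij; apply: serre_br => //; case: (chain_serre jm).
Qed.

End TypeA.

(* Straightening relations between two rows [x], [y] of generators, as soon as
   they are generated from the first elements by the same operators [e]. *)
Section TwoRows.
Variables (m : nat) (x y e : nat -> A).
Hypothesis xe_next : forall i, (i.+1 < m)%N ->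
  x i * e i.+1 = q^-1 *: (e i.+1 * x i) + x i.+1.
Hypothesis xe_top : forall i, (0 < i < m)%N -> x i * e i = q *: (e i * x i).
Hypothesis xe_far : forall i j, (i < m)%N -> (0 < j < m)%N -> j != i -> j != i.+1 ->
  x i * e j = e j * x i.
Hypothesis ee_far : forall i j, (0 < i)%N -> (i.+1 < j < m)%N -> e i * e j = e j * e i.
Hypothesis y_next : forall i, (i.+1 < m)%N -> y i.+1 = br q (y i) (e i.+1).
Hypothesis y0e : forall j, (1 < j < m)%N -> y 0%N * e j = e j * y 0%N.
Hypothesis x0y0 : x 0%N * y 0%N = q ^+ 2 *: (y 0%N * x 0%N).
Hypothesis xy0 : forall j, (0 < j < m)%N -> x j * y 0%N = q *: (y 0%N * x j).

Lemma tworows_ye i j : (i.+1 < j < m)%N -> y i * e j = e j * y i.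
Proof.
elim: i => [|i IH] ij; first exact: y0e.
rewrite y_next; last lia.
by apply: br_comm; [apply: IH; lia | apply: ee_far; lia].
Qed.

Lemma tworows_gt i j : (i < j < m)%N -> x j * y i = q *: (y i * x j).
Proof.
elim: i => [|i IH] ij; first by apply: xy0.
have h := IH ltac:(lia).
have c : x j * e i.+1 = e i.+1 * x j by apply: xe_far; lia.
by rewrite y_next; [rewrite /br; ncfield k A (h, c) | lia].
Qed.

Lemma tworows_eq i : (i < m)%N -> x i * y i = q ^+ 2 *: (y i * x i).
Proof.
elim: i => [|i IH] im //.
have h : x i.+1 * y i = q *: (y i * x i.+1) by apply: tworows_gt; lia.
have c : x i.+1 * e i.+1 = q *: (e i.+1 * x i.+1) by apply: xe_top.
by rewrite y_next //; rewrite /br; ncfield k A (h, c).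
Qed.

(** The correction term is born at [j = i + 1], out of the summand [x (i + 1)] of [x i * e (i + 1)];
    each further bracket moves it from [x j] to [x (j + 1)]. *)
Lemma tworows_lt i j : (i < j < m)%N ->
  x i * y j = q *: (y j * x i) + (q - q^-1) *: (x j * y i).
Proof.
elim: j => [|j IH] ij; first lia.
have jm : (j.+1 < m)%N by lia.
rewrite y_next //; have [ltij|eqij] : (i < j)%N \/ i = j by lia.
  have h := IH ltac:(lia).
  have c1 : x i * e j.+1 = e j.+1 * x i by apply: xe_far; lia.
  have c2 : y i * e j.+1 = e j.+1 * y i by apply: tworows_ye; lia.
  have c3 := xe_next jm.
  by rewrite /br; ncfield k A (h, c1, c2, c3).
rewrite eqij.
have h1 : x j * y j = q ^+ 2 *: (y j * x j) by apply: tworows_eq; lia.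
have h2 : x j.+1 * y j = q *: (y j * x j.+1) by apply: tworows_gt; lia.
have c := xe_next jm.
by rewrite /br; ncfield k A (h1, h2, c).
Qed.

End TwoRows.

(** With right-hand sides written with [y] before [x], these are the relations of quantum 2 x m
    matrices, except that each relation between an [x] and a [y] carries an extra factor [q]. *)
Record tworow_rel (m : nat) (x y : nat -> A) : Prop := TwoRowRel {
  tr_xx : forall i j, (i < j < m)%N -> x i * x j = q *: (x j * x i);
  tr_yy : forall i j, (i < j < m)%N -> y i * y j = q *: (y j * y i);
  tr_xy_eq : forall i, (i < m)%N -> x i * y i = q ^+ 2 *: (y i * x i);
  tr_xy_gt : forall i j, (i < j < m)%N -> x j * y i = q *: (y i * x j);
  tr_xy_lt : forall i j, (i < j < m)%N ->
    x i * y j = q *: (y j * x i) + (q - q^-1) *: (x j * y i) }.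

End Chains.

(** * Root vectors *)

Section Lattices.

Lemma evec_sum n (v : ivec n) (a : 'I_n) : \sum_j v j * evec a j = v a.
Proof.
rewrite (bigD1 a) //= big1 ?addr0 ?ffunE ?eqxx ?mulr1 // => j /negbTE ja.
by rewrite ffunE ja mulr0.
Qed.

Lemma vroot_sum n (v : ivec n) (a b : 'I_n) : \sum_j v j * vroot a b j = v a - v b.
Proof.
rewrite -(evec_sum v a) -(evec_sum v b) -sumrB; apply: eq_bigr => j _.
by rewrite ffunE mulrBr.
Qed.

Lemma vrootE n (a b j : 'I_n) : vroot a b j = (j == a)%:Z - (j == b)%:Z.
Proof. by rewrite !ffunE. Qed.

Variable m : nat.

(** In cyclic 0-based coordinates every simple root is [e_(i-1) - e_i] up to delta, with [e_m] as
    predecessor of [e_0]; this makes node 0 look like the others. *)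
Definition af_src (i : 'I_m.+1) : 'I_m.+1 := if i == ord0 then ord_max else inord i.-1.

Lemma af_alphaE i : (sval (QAf_alpha i)).1 = vroot (af_src i) i.
Proof. by rewrite /QAf_alpha /af_src; case: eqP => [->|]. Qed.

Lemma af_srcE (i : 'I_m.+1) : af_src i = (if i == 0%N :> nat then m else i.-1) :> nat.
Proof.
rewrite /af_src -val_eqE /=; case: eqP => // _.
by rewrite inordK //; have := ltn_ord i; lia.
Qed.

Lemma af_pairE mu i : dpair (d := DAf m) mu (dalpha i) = (sval mu).1 (af_src i) - (sval mu).1 i.
Proof. by rewrite -vroot_sum /= /QAf_pair af_alphaE. Qed.

Lemma af_src_inj : injective af_src.
Proof.
move=> i j /(congr1 val) /=; rewrite !af_srcE => e; apply/val_inj => /=.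
have := ltn_ord i; have := ltn_ord j; move: e.
case: (eqVneq (i : nat) 0%N) => [->|i0]; case: (eqVneq (j : nat) 0%N) => [->|j0] //; lia.
Qed.

Lemma af_src_neq i : (0 < m)%N -> af_src i != i.
Proof. by move=> m0; rewrite -val_eqE /= af_srcE; case: (eqVneq (i : nat) 0%N) => [->|i0]; lia. Qed.

Lemma af_cartan i j : dpair (d := DAf m) (dalpha i) (dalpha j) =
  ((i == j)%:Z *+ 2 - (af_src j == i)%:Z - (af_src i == j)%:Z).
Proof.
rewrite af_pairE [sval _]/= af_alphaE !vrootE (inj_eq af_src_inj).
by rewrite (eq_sym j i) (eq_sym j (af_src i)); ring.
Qed.

Lemma fin_pairE mu i :
  dpair (d := DA m) mu (@dalpha (DA m) i) = sval mu (inord i) - sval mu (inord i.+1).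
Proof. by rewrite -vroot_sum. Qed.

Lemma fin_cartan (i j : 'I_m) : dpair (d := DA m) (@dalpha (DA m) i) (@dalpha (DA m) j) =
  ((i == j)%:Z *+ 2 - (i == j.+1 :> nat)%:Z - (j == i.+1 :> nat)%:Z).
Proof.
have eqE (a b : nat) : (a <= m)%N -> (b <= m)%N -> (inord a == inord b :> 'I_m.+1) = (a == b).
  by move=> am bm; rewrite -val_eqE /= !inordK.
rewrite fin_pairE /= !vrootE !eqE //; try by have := ltn_ord i; have := ltn_ord j; lia.
by rewrite eqSS (eq_sym (i : nat) j.+1) -(val_eqE i) /= (eq_sym (i : nat) j); ring.
Qed.

Lemma QAf_eq (u v : QAf m) : sval u = sval v -> u = v.
Proof. exact: val_inj. Qed.
Lemma QA_eq (u v : QA m) : sval u = sval v -> u = v.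
Proof. exact: val_inj. Qed.

Lemma DAf_ok : (1 < m)%N -> datum_ok (DAf m).
Proof.
move=> m1; split.
- by move=> u v; apply: QAf_eq; congr (_, _); [apply/ffunP => j; rewrite !ffunE|]; ring.
- by move=> u; apply: QAf_eq; congr (_, _); [apply/ffunP => j; rewrite !ffunE|]; rewrite /=; ring.
- by move=> u v; apply: QAf_eq; congr (_, _); [apply/ffunP => j; rewrite !ffunE|]; rewrite /=; ring.
- by apply: QAf_eq; congr (_, _); apply/ffunP => j; rewrite !ffunE.
- move=> u; apply: QAf_eq; rewrite [RHS]surjective_pairing.
  by congr (_, _); [apply/ffunP => j; rewrite !ffunE|]; rewrite /=; ring.
- move=> u v; rewrite /= /QAf_pair -sumrN; apply: eq_bigr => j _.
  by rewrite /= !ffunE; ring.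
- by move=> i j; rewrite !af_cartan eq_sym; ring.
- by move=> i; rewrite af_cartan eqxx (negbTE (af_src_neq _ _)) //; apply: ltnW.
- move=> i j; rewrite af_cartan; case: eqVneq => // _.
  by case: eqP; case: eqP.
Qed.

Lemma DA_ok : datum_ok (DA m).
Proof.
split.
- by move=> u v; apply: QA_eq; apply/ffunP => j; rewrite !ffunE; ring.
- by move=> u; apply: QA_eq; apply/ffunP => j; rewrite !ffunE; ring.
- by move=> u v; apply: QA_eq; apply/ffunP => j; rewrite !ffunE; ring.
- by apply: QA_eq; apply/ffunP => j; rewrite !ffunE.
- by move=> u; apply: QA_eq; apply/ffunP => j; rewrite !ffunE; ring.
- by move=> u v; rewrite /= /QA_pair -sumrN; apply: eq_bigr => j _; rewrite /= !ffunE; ring.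
- by move=> i j; rewrite !fin_cartan eq_sym; ring.
- by move=> i; rewrite fin_cartan eqxx; lia.
- move=> i j; rewrite fin_cartan; case: eqVneq => // _; lia.
Qed.
End Lattices.

Lemma take_mkseq (T : Type) (f : nat -> T) l n : (l <= n)%N -> take l (mkseq f n) = mkseq f l.
Proof. by move=> ln; rewrite /mkseq -map_take take_iota (minn_idPl ln). Qed.

(** * Lusztig operators acting on assignments of generators *)

Section LusztigAction.
Variables (k : fieldType) (q : k) (D : datum) (A : algType k).
Local Notation "<< x , y >>" := (dpair x y).
Implicit Types (g : ugen D -> A) (w : seq (dI D)).

(* Evaluating [T_i x] at [g] amounts to evaluating [x] at [lusztig i g]; hence
   the words act on assignments in the reverse order. *)
Definition lusztig (i : dI D) g : ugen D -> A := fun a => aeval g (Tgen q i a).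

Lemma aeval_Tl i g x : aeval g (Tl q i x) = aeval (lusztig i g) x.
Proof. by rewrite /Tl aeval_fmap. Qed.

Lemma lusztig_E i g j : lusztig i g (UE j) =
  if j == i then - (g (UF i) * g (UK (dalpha i)))
  else if << dalpha i, dalpha j >> == -1 then br q (g (UE i)) (g (UE j)) else g (UE j).
Proof.
rewrite /lusztig /=; case: eqP => _; first by rewrite aeval_scale aevalM scaleN1r.
by case: eqP => _ //; rewrite aeval_qbr.
Qed.

Lemma lusztig_F i g j : lusztig i g (UF j) =
  if j == i then - (g (UK (dopp (dalpha i))) * g (UE i))
  else if << dalpha i, dalpha j >> == -1
  then g (UF j) * g (UF i) - q *: (g (UF i) * g (UF j)) else g (UF j).
Proof.
rewrite /lusztig /=; case: eqP => _; first by rewrite aeval_scale aevalM scaleN1r.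
by case: eqP => _ //; rewrite aeval_sub aeval_scale.
Qed.

Lemma lusztig_K i g mu : lusztig i g (UK mu) = g (UK (drefl i mu)).
Proof. by []. Qed.

Fixpoint lusztigs w g := if w is i :: w' then lusztigs w' (lusztig i g) else g.

Lemma lusztigs_rcons w i g : lusztigs (rcons w i) g = lusztig i (lusztigs w g).
Proof. by elim: w g => //= j w IH g; rewrite IH. Qed.

Lemma lusztigs_cat w1 w2 g : lusztigs (w1 ++ w2) g = lusztigs w2 (lusztigs w1 g).
Proof. by elim: w1 g => //= i w IH g; rewrite IH. Qed.

Lemma size_rootvecs w : size (@rootvecs k q D w) = size w.
Proof. by elim: w => //= i w <-; rewrite size_map. Qed.

Lemma aeval_rootvec w g i0 l : (l < size w)%N ->
  aeval g (nth (FC 0) (rootvecs q w) l) = lusztigs (take l w) g (UE (nth i0 w l)).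
Proof.
elim: w g l => // i w IH g [|l] //= lw.
by rewrite (nth_map (FC 0)) ?size_rootvecs // aeval_Tl IH.
Qed.

(* Along a path of the Dynkin diagram no [F] occurs in the root vectors. *)
Section Path.
Variables (n : nat) (ix : nat -> dI D) (g : ugen D -> A).
Hypothesis ix_neq : forall i j, (i < j < n)%N -> ix j != ix i.
Hypothesis ix_adj : forall i, (i.+1 < n)%N -> << dalpha (ix i), dalpha (ix i.+1) >> = -1.
Hypothesis ix_far : forall i j, (i.+1 < j < n)%N -> << dalpha (ix i), dalpha (ix j) >> = 0.
Local Notation G l := (lusztigs (mkseq ix l) g).

Lemma lusztigs_mkseqS l : G l.+1 = lusztig (ix l) (G l).
Proof. by rewrite mkseqS lusztigs_rcons. Qed.

Lemma path_untouched l j : (l < j < n)%N ->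
  G l (UE (ix j)) = g (UE (ix j)) /\ G l (UF (ix j)) = g (UF (ix j)).
Proof.
elim: l => // l IH lj; rewrite lusztigs_mkseqS lusztig_E lusztig_F.
rewrite (negbTE (ix_neq _)); last lia.
by rewrite ix_far; [apply: IH; lia | lia].
Qed.

Lemma path_chain l : (l < n)%N -> G l (UE (ix l)) = chain q (fun j => g (UE (ix j))) l.
Proof.
elim: l => // l IH ln; rewrite lusztigs_mkseqS lusztig_E (negbTE (ix_neq _)); last lia.
by rewrite ix_adj // eqxx IH 1?ltnW // (path_untouched _).1 //; lia.
Qed.
End Path.

End LusztigAction.

Section FiniteRootVectors.
Variables (k : fieldType) (q : k) (m : nat) (A : algType k) (g : ugen (DA m.+1) -> A).

Definition finE (j : nat) : A := g (UE (inord j : dI (DA m.+1))).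

Lemma cwordE : cword m.+1 = mkseq (fun j => inord j : 'I_m.+1) m.+1.
Proof.
apply: (@eq_from_nth _ ord0); rewrite ?size_mkseq /cword ?size_enum_ord // => i im.
by rewrite nth_mkseq //; apply: val_inj; rewrite /= nth_enum_ord // inordK.
Qed.

Lemma finite_rootvec l : (l < m.+1)%N ->
  aeval g (nth (FC 0) (@rootvecs k q (DA m.+1) (cword m.+1)) l) = chain q finE l.
Proof.
move=> lm; rewrite (@aeval_rootvec k q (DA m.+1) A _ _ ord0) ?cwordE ?size_mkseq // nth_mkseq //.
rewrite take_mkseq 1?ltnW //.
apply: (@path_chain k q (DA m.+1) A m.+1 (fun j => inord j)) => //.
- by move=> i j ij; rewrite -val_eqE /= !inordK; lia.
- by move=> i im; rewrite fin_cartan -val_eqE /= !inordK; lia.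
- by move=> i j ij; rewrite fin_cartan -val_eqE /= !inordK; lia.
Qed.

Lemma fin_typeA : q != 0 -> urep q g -> typeA q m.+1 finE.
Proof.
move=> q0 u; split.
- by move=> i j im jm ij; apply: (ur_EEE u); rewrite fin_cartan -val_eqE /= !inordK; lia.
- by move=> i im; apply: (ur_EsE u); rewrite fin_cartan -val_eqE /= !inordK; lia.
- by move=> i im; apply: (ur_EsE u); rewrite fin_cartan -val_eqE /= !inordK; lia.
Qed.
End FiniteRootVectors.

Lemma serre_of_br (k : fieldType) (A : algType k) (q : k) (a b : A) : q != 0 ->
  br q a b * b = q *: (b * br q a b) -> serre q b a.
Proof.
rewrite /serre /br => q0 s; apply/eqP; rewrite -subr_eq0.
by move/eqP: s; rewrite -subr_eq0 => /eqP <-; apply/eqP; ncfield k A tt.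
Qed.

(** * Root vectors of the affine word *)

Section AffineRootVectors.
Variables (k : fieldType) (q : k) (m : nat).
Hypotheses (q0 : q != 0) (q2 : q + q^-1 != 0) (qm : q - q^-1 != 0) (m1 : (1 < m)%N).
Local Notation D := (DAf m).
Variables (A : algType k) (g : ugen D -> A).
Hypothesis u : urep q g.

Local Notation ix j := (inord j : dI D).
Definition afE (j : nat) : A := g (UE (ix j)).

Lemma af_cartanE i j : (i <= m)%N -> (j <= m)%N ->
  dpair (@dalpha D (inord i)) (@dalpha D (inord j)) =
  if i == j then 2
  else if (i.+1 == j) || (j.+1 == i) || (i == 0%N) && (j == m) || (j == 0%N) && (i == m) then -1
  else 0.
Proof.
move=> im jm; rewrite af_cartan -!val_eqE /= !af_srcE /= !inordK //.
by case: (eqVneq i 0%N) => [->|i0]; case: (eqVneq j 0%N) => [->|j0]; do !case: eqP => ? //=; lia.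
Qed.
Local Notation up j := (afE j.+1).
Local Notation X := (chain q (fun j => up j)).
Local Notation w1 := (fun j => inord j.+1 : dI D).
Local Notation G l := (lusztigs q (mkseq w1 l) g).

Lemma w1_neq i j : (i < j < m)%N -> w1 j != w1 i.
Proof. by move=> ij; rewrite -val_eqE /= !inordK; lia. Qed.
Lemma w1_adj i : (i.+1 < m)%N -> dpair (@dalpha D (w1 i)) (@dalpha D (w1 i.+1)) = -1.
Proof. by move=> im; rewrite af_cartanE; try lia; by case: eqP => [?|_]; [lia | rewrite eqxx]. Qed.
Lemma w1_far i j : (i.+1 < j < m)%N -> dpair (@dalpha D (w1 i)) (@dalpha D (w1 j)) = 0.
Proof. by move=> ij; rewrite af_cartanE; try lia; by do ![case: eqP => //= ?]; lia. Qed.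
Lemma w1_far_sym i j : (i.+1 < j < m)%N -> dpair (@dalpha D (w1 j)) (@dalpha D (w1 i)) = 0.
Proof. by move=> ij; rewrite (dok_sym (DAf_ok m1)) w1_far. Qed.
Lemma w1_adj_sym i : (i.+1 < m)%N -> dpair (@dalpha D (w1 i.+1)) (@dalpha D (w1 i)) = -1.
Proof. by move=> ij; rewrite (dok_sym (DAf_ok m1)) w1_adj. Qed.

Lemma affine_typeA : typeA q m (fun j => up j).
Proof.
split.
- by move=> i j im jm ij; apply: (ur_EEE u); apply: w1_far; lia.
- by move=> i im; apply: (ur_EsE u); apply: w1_adj.
- by move=> i im; apply: (ur_EsE u); apply: w1_adj_sym.
Qed.

Lemma prefix_chain l : (l < m)%N -> G l (UE (w1 l)) = X l.
Proof. by move=> lm; exact: (@path_chain k q D A m w1 g w1_neq w1_adj w1_far l lm). Qed.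

Lemma prefixS l : G l.+1 = lusztig q (w1 l) (G l).
Proof. exact: lusztigs_mkseqS. Qed.

(** The weight [alpha_1 + .. + alpha_(l+1)] of [X l]. *)
Definition first_root l : dL D :=
  @exist (ivec m.+1 * int) (fun p => sum0 p.1) (vroot ord0 (inord l.+1), 0) (sum0_e _ _).

Lemma af_alpha_w1 j : (j < m)%N -> sval (@dalpha D (w1 j)) = (vroot (inord j) (inord j.+1), 0).
Proof.
move=> jm; rewrite /dalpha /= /QAf_alpha -val_eqE /= inordK //=.
Qed.

Lemma first_rootS l : (l.+1 < m)%N -> dadd (dalpha (w1 l.+1)) (first_root l) = first_root l.+1.
Proof.
move=> lm; apply: QAf_eq; rewrite [LHS]/= [sval (QAf_alpha _)]af_alpha_w1 //.
by congr (_, _); apply/ffunP => j; rewrite !ffunE /=; ring.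
Qed.

Lemma first_root0 : first_root 0 = dalpha (w1 0).
Proof.
apply: QAf_eq; rewrite [RHS]af_alpha_w1 ?(ltnW m1) //=; congr (vroot _ _, _).
by apply: val_inj; rewrite /= inordK.
Qed.

Fixpoint prefix_refl l (mu : dL D) : dL D := if l is l'.+1 then prefix_refl l' (drefl (w1 l') mu) else mu.

Lemma prefix_reflS l mu : prefix_refl l.+1 mu = prefix_refl l (drefl (w1 l) mu). Proof. by []. Qed.

Lemma prefix_K l mu : G l (UK mu) = g (UK (prefix_refl l mu)).
Proof. by elim: l mu => // l IH mu; rewrite prefixS lusztig_K IH. Qed.

Lemma refl_add i (mu la : dL D) : drefl i (dadd mu la) = dadd (drefl i mu) (drefl i la).
Proof.
have pD : QAf_pair (QAf_add mu la) (QAf_alpha i) =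
    QAf_pair mu (QAf_alpha i) + QAf_pair la (QAf_alpha i).
  by have := af_pairE (QAf_add mu la) i; have := af_pairE mu i; have := af_pairE la i;
    rewrite /dpair /= => -> -> ->; rewrite !ffunE; ring.
apply: QAf_eq; rewrite /= /QAf_refl /QAf_comb /= -/(QAf_add mu la) pD.
by congr (_, _); [apply/ffunP => j; rewrite !ffunE|]; ring.
Qed.

Lemma refl_far i (mu : dL D) : dpair mu (dalpha i) = 0 -> drefl i mu = mu.
Proof.
rewrite /= => p0; apply: QAf_eq; rewrite /= p0 [RHS]surjective_pairing.
by congr (_, _); [apply/ffunP => j; rewrite !ffunE|]; rewrite /=; ring.
Qed.

Lemma refl_adj i (mu : dL D) : dpair mu (dalpha i) = -1 -> drefl i mu = dadd mu (dalpha i).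
Proof. by rewrite /= /QAf_refl => ->. Qed.

Lemma prefix_refl_add l mu la : prefix_refl l (dadd mu la) = dadd (prefix_refl l mu) (prefix_refl l la).
Proof. by elim: l mu la => // l IH mu la; rewrite !prefix_reflS refl_add IH. Qed.
Lemma prefix_refl_far l j : (l < j < m)%N -> prefix_refl l (dalpha (w1 j)) = dalpha (w1 j).
Proof.
elim: l => // l IH lj; rewrite prefix_reflS refl_far; first by apply: IH; lia.
by apply: w1_far_sym; lia.
Qed.
Lemma prefix_refl_root l : (l < m)%N -> prefix_refl l (dalpha (w1 l)) = first_root l.
Proof.
elim: l => [|l IH] lm; first by rewrite first_root0.
rewrite prefix_reflS refl_adj ?w1_adj_sym // prefix_refl_add prefix_refl_far; last lia.
by rewrite IH ?first_rootS // ltnW.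
Qed.

Lemma first_root_coord l (j : nat) : (l < m)%N -> (j <= m)%N ->
  (sval (first_root l)).1 (inord j) = (j == 0%N)%:Z - (j == l.+1)%:Z.
Proof. by move=> lm jm; rewrite /= vrootE -!val_eqE /= !inordK. Qed.

Lemma alpha_coord l (j : nat) : (l < m)%N -> (j <= m)%N ->
  (sval (@dalpha D (w1 l))).1 (inord j) = (j == l)%:Z - (j == l.+1)%:Z.
Proof. by move=> lm jm; rewrite af_alpha_w1 //= vrootE -!val_eqE /= !inordK //; lia. Qed.

Lemma pair_w1 mu j : (j < m)%N ->
  dpair mu (@dalpha D (w1 j)) = (sval mu).1 (inord j) - (sval mu).1 (inord j.+1).
Proof.
move=> jm; rewrite af_pairE; congr ((sval mu).1 _ - _).
by apply: val_inj; rewrite /= af_srcE /= !inordK //; lia.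
Qed.

Local Notation coord mu j := ((sval (mu : dL D)).1 (inord j)).
(** The negative counterpart of [X l]; together with the torus element of [first_root l] the two
    form a quantum sl_2 triple. *)
Let f l := G l (UF (w1 l)).

Lemma fvec0 : f 0 = g (UF (w1 0)). Proof. by []. Qed.
Lemma fvecS l : (l.+1 < m)%N ->
  f l.+1 = g (UF (w1 l.+1)) * f l - q *: (f l * g (UF (w1 l.+1))).
Proof.
move=> lm; rewrite /f prefixS lusztig_F (negbTE (w1_neq _)); last lia.
by rewrite w1_adj // eqxx (@path_untouched k q D A m w1 g w1_neq w1_far l l.+1 _).2 //; lia.
Qed.

Lemma K_chain mu l : (l < m)%N ->
  g (UK mu) * X l = q ^ (coord mu 0 - coord mu l.+1) *: (X l * g (UK mu)).
Proof.
elim: l => [|l IH] lm; first by rewrite [X 0]/= /afE (ur_KEE u) pair_w1.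
have h1 := IH (ltnW lm); have h2 := ur_KEE u mu (w1 l.+1); rewrite pair_w1 // in h2.
have -> : coord mu 0 - coord mu l.+2 =
  (coord mu 0 - coord mu l.+1) + (coord mu l.+1 - coord mu l.+2) by ring.
rewrite expfzDr // [X l.+1]/= /br /afE; set x := X l in h1 *.
by ncfield k A (h1, h2).
Qed.

Lemma K_fvec mu l : (l < m)%N ->
  g (UK mu) * f l = q ^ (- (coord mu 0 - coord mu l.+1)) *: (f l * g (UK mu)).
Proof.
elim: l => [|l IH] lm; first by rewrite fvec0 (ur_KFE u) pair_w1.
have h1 := IH (ltnW lm); have h2 := ur_KFE u mu (w1 l.+1); rewrite pair_w1 // in h2.
have -> : - (coord mu 0 - coord mu l.+2) =
  (- (coord mu 0 - coord mu l.+1)) + (- (coord mu l.+1 - coord mu l.+2)) by ring.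
rewrite expfzDr // fvecS //; set x := f l in h1 *.
by ncfield k A (h1, h2).
Qed.

Lemma chain_F l j : (l < j < m)%N -> X l * g (UF (w1 j)) = g (UF (w1 j)) * X l.
Proof.
elim: l => [|l IH] lj; first by apply: (ur_EFne u); rewrite eq_sym w1_neq.
by apply: br_comm => //; [apply: IH; lia | apply: (ur_EFne u); rewrite eq_sym w1_neq].
Qed.

Lemma fvec_E l j : (l < j < m)%N -> g (UE (w1 j)) * f l = f l * g (UE (w1 j)).
Proof.
elim: l => [|l IH] lj; first by apply: (ur_EFne u); rewrite w1_neq.
rewrite fvecS; last lia.
have h1 := IH ltac:(lia).
have h2 : g (UE (w1 j)) * g (UF (w1 l.+1)) = g (UF (w1 l.+1)) * g (UE (w1 j)).
  by apply: (ur_EFne u); rewrite w1_neq.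
by ncfield k A (h1, h2).
Qed.

Let NE (j : nat) :
  ((j == j.+1) = false) * ((j.+1 == j) = false) * ((j == j.+2) = false) * ((j.+2 == j) = false).
Proof. by do !split; lia. Qed.

Local Notation d := (q - q^-1)^-1.
Local Notation K mu := (g (UK mu)).

Lemma K_E mu j : (j < m)%N -> K mu * g (UE (w1 j)) =
  q ^ (coord mu j - coord mu j.+1) *: (g (UE (w1 j)) * K mu).
Proof. by move=> jm; rewrite (ur_KEE u) pair_w1. Qed.
Lemma K_F mu j : (j < m)%N -> K mu * g (UF (w1 j)) =
  q ^ (- (coord mu j - coord mu j.+1)) *: (g (UF (w1 j)) * K mu).
Proof. by move=> jm; rewrite (ur_KFE u) pair_w1. Qed.
Lemma opp_coord mu j : coord (dopp mu) j = - coord mu j.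
Proof. by rewrite /= !ffunE; ring. Qed.

(** The image under [T_1 .. T_l] of the relation between [E_(l+1)] and [F_(l+1)], rebuilt one
    bracket at a time by [br_sl2]. *)
Lemma chain_sl2 l : (l < m)%N ->
  X l * f l = f l * X l + d *: (K (first_root l) - K (dopp (first_root l))).
Proof.
elim: l => [|l IH] lm; first by rewrite fvec0 first_root0; exact: (ur_EFeq u).
have lm' := ltnW lm.
have -> : K (first_root l.+1) = K (dalpha (w1 l.+1)) * K (first_root l) by rewrite (ur_KKE u) first_rootS.
have -> : K (dopp (first_root l.+1)) = K (dopp (dalpha (w1 l.+1))) * K (dopp (first_root l)).
  by rewrite (ur_KKE u) -(dok_oppD (DAf_ok m1)) first_rootS.
have CC := urep_KC (DAf_ok m1) u.
rewrite fvecS // [X l.+1]/= /afE; apply: br_sl2 => //.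
- exact: IH.
- exact: (ur_EFeq u).
- by apply: chain_F; lia.
- by apply: fvec_E; lia.
all: rewrite (K_E, K_F, K_chain, K_fvec) // ?opp_coord !(first_root_coord, alpha_coord) //.
all: by rewrite ?NE ?eqxx ?expzN1 ?expr1z.
Qed.

(** In [T_1 .. T_n E_(l+1)] the letters beyond [l + 2] fix [E_(l+1)], and [br_cancel], applied to
    root vectors of the prefix, turns it into [E_(l+2)]. This is why the second row is built with
    the same brackets as the first. *)
Lemma prefix_E_shift l n : (l.+1 < n <= m)%N -> G n (UE (w1 l)) = up l.+1.
Proof.
elim: n => [|n IH] ln; first lia.
rewrite prefixS lusztig_E; have [ltn|eqn] : (l.+1 < n)%N \/ n = l.+1 by lia.
  rewrite eq_sym (negbTE (w1_neq _)); last lia.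
  by rewrite w1_far_sym; [apply: IH; lia | lia].
rewrite eqn eq_sym (negbTE (w1_neq _)); last lia.
have lm : (l.+1 < m)%N by lia.
have lm' := ltnW lm.
rewrite w1_adj_sym // eqxx prefix_chain // prefixS lusztig_E eqxx prefix_K prefix_refl_root // -/(f l) [X l.+1]/=.
apply: (@br_cancel k A q q0 qm (X l) (f l) (up l.+1) (K (first_root l)) (K (dopp (first_root l)))).
- exact: chain_sl2.
- by apply: fvec_E; lia.
- by rewrite K_E // !first_root_coord // ?NE ?eqxx; congr (_ *: _); exact: expzN1.
- by rewrite K_E // !opp_coord !first_root_coord // ?NE ?eqxx; congr (_ *: _); exact: expr1z.
- by rewrite K_chain // !first_root_coord // ?NE ?eqxx.
- by rewrite (urep_KC (DAf_ok m1) u) (urep_KN (DAf_ok m1) u).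
Qed.

Local Notation o := (afE 0).
(** This is [T_1 E_0], and [af_y0] is [T_1 .. T_m E_0]: only the nodes 1 and [m] are joined to node
    0, so only the first and the last letter create a bracket. *)
Definition afG : A := br q (up 0) o.
Definition af_y0 : A := br q (X m.-1) afG.
Definition af_ey (j : nat) : A := if j is 0 then af_y0 else up j.

Lemma w1_neq0 l : (l < m)%N -> ((inord 0 : dI D) == w1 l) = false.
Proof. by move=> lm; rewrite -val_eqE /= !inordK. Qed.

Lemma w1_zero l : (l < m)%N -> dpair (@dalpha D (w1 l)) (@dalpha D (inord 0)) =
  if (l == 0%N) || (l.+1 == m) then -1 else 0.
Proof. by move=> lm; rewrite af_cartanE //=; do ![case: eqP => //= ?]; lia. Qed.

Lemma prefix_E0 l : (0 < l < m)%N -> G l (UE (inord 0 : dI D)) = afG.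
Proof.
elim: l => // l IH lm; rewrite prefixS lusztig_E w1_neq0; last lia.
rewrite w1_zero; last lia.
case: l IH lm => [|l] IH lm; first by rewrite eqxx.
have -> : (l.+2 == m) = false by lia.
by apply: IH; lia.
Qed.

Lemma prefix_E0_last : G m (UE (inord 0 : dI D)) = af_y0.
Proof.
suff h n : n.+1 = m -> G n.+1 (UE (inord 0 : dI D)) = br q (X n) afG.
  have mE : m.-1.+1 = m by lia.
  by rewrite /af_y0 -(h _ mE); congr (lusztigs q (mkseq _ _) g _); rewrite mE.
move=> nm; rewrite prefixS lusztig_E w1_neq0; last lia.
rewrite w1_zero; last lia.
have -> : (n.+1 == m) = true by apply/eqP.
by rewrite orbT eqxx prefix_chain ?prefix_E0 //; lia.
Qed.

Local Notation w2 := (fun j => inord j : dI D).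

Lemma chatwordE : chatword m = mkseq w1 m ++ mkseq w2 m.
Proof.
rewrite /chatword /mkseq; congr (_ ++ _).
  by rewrite -[iota 1 m]/(iota (1 + 0) m) iotaDl -map_comp.
have -> : iota 0 m = 0%N :: iota 1 m.-1 by case: (m) m1.
rewrite map_cons; congr (_ :: _).
by apply: val_inj; rewrite /= inordK.
Qed.

Lemma affine_rootvec_x l : (l < m)%N ->
  aeval g (nth (FC 0) (@rootvecs k q D (chatword m)) l) = X l.
Proof.
move=> lm; rewrite (@aeval_rootvec k q D A _ _ ord0) chatwordE ?size_cat ?size_mkseq; last lia.
rewrite take_cat nth_cat size_mkseq lm nth_mkseq // take_mkseq 1?ltnW //.
exact: prefix_chain.
Qed.

Lemma affine_rootvec_y l : (l < m)%N ->
  aeval g (nth (FC 0) (@rootvecs k q D (chatword m)) (m + l)) = chain q af_ey l.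
Proof.
move=> lm; rewrite (@aeval_rootvec k q D A _ _ ord0) chatwordE ?size_cat ?size_mkseq; last lia.
rewrite take_cat nth_cat size_mkseq ifN; last lia.
rewrite ifN; last lia.
rewrite addKn nth_mkseq // take_mkseq 1?ltnW // lusztigs_cat.
rewrite (@path_chain k q D A m w2 _ _ _ _ l lm).
- apply: eq_chain => -[|j] jl; first exact: prefix_E0_last.
  by apply: (@prefix_E_shift j m); lia.
- by move=> i j ij; rewrite -val_eqE /= !inordK; lia.
- by move=> i im; rewrite af_cartanE; try lia; case: eqP => [?|_]; [lia | rewrite eqxx].
- by move=> i j ij; rewrite af_cartanE; try lia; do ![case: eqP => //= ?]; lia.
Qed.

Lemma o_comm j : (1 < j < m)%N -> o * afE j = afE j * o.
Proof.
by move=> jm; apply: (ur_EEE u); rewrite af_cartanE; try lia; do ![case: eqP => //= ?]; lia.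
Qed.

Lemma o_serre j : (j == 1)%N || (j == m) -> serre q o (afE j) /\ serre q (afE j) o.
Proof.
move=> jm; split; apply: (ur_EsE u); rewrite af_cartanE; try lia;
  by move: jm; do ![case: eqP => //= ?]; lia.
Qed.

Hypothesis q3 : q ^+ 2 + 1 + q ^- 2 != 0.

Let eA := affine_typeA.

Lemma x0_serre_G : up 0 * afG = q *: (afG * up 0).
Proof. by apply: serre_br => //; have [] := @o_serre 1 isT. Qed.

(** * Serre relations of the second row on the triangle *)

Section RankTwo.
Hypothesis m2 : m = 2%N.
Local Notation x1 := (br q (up 0) (up 1)).

Let s01 : serre q (up 0) (up 1).
Proof. by apply: (typeA_up eA); rewrite m2. Qed.
Let s10 : serre q (up 1) (up 0).
Proof. by apply: (typeA_down eA); rewrite m2. Qed.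

(** The nodes 0 and 2 are joined to each other and to node 1, and both vectors are brackets of [E_1]
    with one of them, as in [fork_serre]. *)
Lemma rank2_X_G : serre q x1 afG.
Proof.
have [so0 s0o] := @o_serre 1 isT; have [] := @o_serre 2; first by rewrite m2.
by move=> so1 s1o; apply: fork_serre.
Qed.

(* [phi] is the Lusztig transform of [up 0]; bracketing with it undoes the
   bracketing with [up 0]. *)
Let phi := - (g (UF (w1 0)) * K (dalpha (w1 0))).

Let phi_cancel (i : dI D) : i != w1 0 -> dpair (dalpha (w1 0)) (dalpha i) = -1 ->
  br q (br q (up 0) (g (UE i))) phi = g (UE i).
Proof.
move=> i0 pi; apply: (@br_cancel k A q q0 qm _ _ _ _ (K (dopp (dalpha (w1 0))))).
- exact: (ur_EFeq u).
- by apply: (ur_EFne u).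
- by rewrite (ur_KEE u) pi expzN1.
- by rewrite (ur_KEE u) (dok_pairN (DAf_ok m1)) pi expr1z.
- by rewrite /afE (ur_KEE u) (dok_diag (DAf_ok m1)).
- by rewrite (urep_KC (DAf_ok m1) u) (urep_KN (DAf_ok m1) u).
Qed.

Let phi_comm (i : dI D) : i != w1 0 -> dpair (dalpha (w1 0)) (dalpha i) = -1 ->
  g (UE i) * phi = q *: (phi * g (UE i)).
Proof.
move=> i0 pi; have h := ur_KEE u (dalpha (w1 0)) i; rewrite pi expzN1 in h.
have h2 : g (UE i) * g (UF (w1 0)) = g (UF (w1 0)) * g (UE i) by apply: (ur_EFne u).
by rewrite /phi; ncfield k A (h, h2).
Qed.

Let p1 : dpair (@dalpha D (w1 0)) (@dalpha D (w1 1)) = -1.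
Proof. by rewrite w1_adj // m2. Qed.
Let n1 : w1 1 != w1 0.
Proof. by rewrite w1_neq // m2. Qed.
Let po : dpair (@dalpha D (w1 0)) (@dalpha D (inord 0)) = -1.
Proof. by rewrite af_cartanE // m2. Qed.
Let no : inord 0 != w1 0.
Proof. by rewrite -val_eqE /= !inordK // m2. Qed.

(** Both vectors are brackets with [x1]: [af_y0] is that of [afG], and [up 1] is recovered as that
    of [phi]. So [fork_serre] transports the Serre relations between [afG] and [phi], which play the
    roles of [T_1 E_0] and [T_1 E_1]. *)
Lemma rank2_serre : serre q af_y0 (up 1) /\ serre q (up 1) af_y0.
Proof.
have XG := rank2_X_G.
have y0E : af_y0 = br q x1 afG by rewrite /af_y0 m2.
have Xphi : serre q x1 phi.
  apply/serreP => //; rewrite (phi_cancel n1 p1).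
  by apply: serre_br_r.
have [so0 s0o] := @o_serre 1 isT.
have Gphi : serre q afG phi.
  by apply/serreP => //; rewrite (phi_cancel no po); apply: serre_br_r.
have phiG : serre q phi afG.
  by apply: serre_of_br => //; rewrite (phi_cancel no po); apply: phi_comm.
have := phi_cancel n1 p1; rewrite -/(up 1) => c1.
rewrite y0E; split.
  by rewrite -[X in serre q _ X]c1; apply: fork_serre.
by rewrite -[X in serre q X _]c1; apply: fork_serre.
Qed.
End RankTwo.

(** * Serre relations of the second row on longer cycles *)

Section HigherRank.
Hypothesis m3 : (2 < m)%N.

Lemma G_comm j : (1 < j)%N -> (j.+1 < m)%N -> afG * up j = up j * afG.
Proof.
move=> j1 jm; apply: br_comm => //; first by apply: (typeA_far eA); lia.
by apply: o_comm; lia.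
Qed.

Lemma G_serre_last : serre q afG (up m.-1) /\ serre q (up m.-1) afG.
Proof.
have mE : m.-1.+1 = m by lia.
have far : up 0 * up m.-1 = up m.-1 * up 0 by apply: (typeA_far eA); lia.
have [so0 s0o] := @o_serre 1 isT; have [] := @o_serre m; first by rewrite eqxx orbT.
rewrite -[in afE m]mE => som smo.
by split; [apply: chain_serre_l | apply: chain_serre_r].
Qed.

(** Along the path 0, 1, 2 the bracket should start at node 0. Reversing it replaces [q] by [q^-1]
    up to a scalar, and the Serre relation is insensitive to both changes. *)
Lemma G_serre_1 : serre q afG (up 1) /\ serre q (up 1) afG.
Proof.
have [so0 s0o] := @o_serre 1 isT.
have far : o * up 1 = up 1 * o by apply: o_comm.
have GE' : afG = - q^-1 *: br q^-1 o (up 0).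
  by rewrite /afG /br invrK; ncfield k A tt.
have s01 : serre q (up 0) (up 1) by apply: (typeA_up eA); lia.
have s10 : serre q (up 1) (up 0) by apply: (typeA_down eA); lia.
have iq0 : q^-1 != 0 by rewrite invr_neq0.
have iq2 : q^-1 + q^-1^-1 != 0 by rewrite invrK addrC.
rewrite GE' -[up 1]scale1r; split; apply: serre_scale => //; apply/serreV.
  by apply: chain_serre_l => //; apply/serreV.
by apply: chain_serre_r => //; apply/serreV.
Qed.

(** The start is [fork_comm] at node 1, whose neighbours 0 and 2 are not joined here. The further
    generators bracketed into [X i] stop before node [m] and commute with [afG]. *)
Lemma X_G_comm i : (0 < i)%N -> (i.+1 < m)%N -> X i * afG = afG * X i.
Proof.
elim: i => // -[|i] IH _ im.
  apply: fork_comm => //; first by apply/esym/o_comm; lia.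
    by apply: (typeA_up eA); lia.
  by have [] := @o_serre 1 isT.
apply: br_comm => //; first by apply: IH; lia.
by apply/esym/G_comm; lia.
Qed.

Lemma X_G_serre : serre q (X m.-1) afG /\ serre q afG (X m.-1).
Proof.
have mE : m.-1 = m.-2.+1 by lia.
have far : X m.-2 * afG = afG * X m.-2 by apply: X_G_comm; lia.
have [s1 s2] := G_serre_last; rewrite mE in s1 s2 *.
have im : (m.-2.+1 < m)%N by lia.
have [s3 s4] := chain_serre q0 q2 eA im.
by split; [apply: chain_serre_l | apply: chain_serre_r].
Qed.

(** Only [j = m - 1] is not a commutation factor by factor: [up j] is then [E_m], a neighbour of
    node 0, and it is the middle of the path formed by [X (m - 2)], [E_m] and [afG]. *)
Lemma y0_comm j : (1 < j < m)%N -> af_y0 * up j = up j * af_y0.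
Proof.
move=> jm; have [jlt|jeq] : (j.+1 < m)%N \/ j = m.-1 by lia.
  apply: br_comm => //; last by apply: G_comm; lia.
  by apply: (chain_below q0 q2 eA); lia.
have mE : m.-1 = m.-2.+1 by lia.
have far : X m.-2 * afG = afG * X m.-2 by apply: X_G_comm; lia.
have [s1 s2] := G_serre_last; rewrite jeq /af_y0 mE in s1 s2 *.
have im : (m.-2.+1 < m)%N by lia.
have [s3 s4] := chain_serre q0 q2 eA im.
by apply/esym/chain_comm.
Qed.

Lemma y0_serre : serre q af_y0 (up 1) /\ serre q (up 1) af_y0.
Proof.
have far : X m.-1 * up 1 = up 1 * X m.-1 by apply: (chain_below q0 q2 eA); lia.
have [s1 s2] := X_G_serre; have [s3 s4] := G_serre_1.
by split; [apply: chain_serre_l | apply: chain_serre_r].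
Qed.

End HigherRank.

Lemma affine_y_typeA : typeA q m af_ey.
Proof.
have [m2|m3] : m = 2%N \/ (2 < m)%N by lia.
  have [s1 s2] := rank2_serre m2.
  split; [by move=> i j; lia | by case=> [|i] //; lia | by case=> [|i] //; lia].
have [s1 s2] := y0_serre m3.
split.
- move=> [|i] [|j] // im jm ij; last exact: (typeA_far eA).
  by apply: y0_comm => //; lia.
- by case=> [|i] // im; apply: (typeA_up eA).
- by case=> [|i] // im; apply: (typeA_down eA).
Qed.

(** Each of the factors [X (m - 1)] and [afG] of the bracket contributes one [q]. *)
Lemma x0y0 : X 0 * af_y0 = q ^+ 2 *: (af_y0 * X 0).
Proof.
have h1 : X 0 * X m.-1 = q *: (X m.-1 * X 0) by apply: (chain_qcomm q0 q2 eA); lia.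
have h2 := x0_serre_G; rewrite -/(X 0) in h2.
by rewrite /af_y0 /br; set x := X 0 in h1 h2 *; set z := X m.-1 in h1 *; ncfield k A (h1, h2).
Qed.

(** At [j = 1] the single factor [q] comes from [X (m - 1)], since [X 1] commutes with [afG]; for
    [m = 2] it comes from the Serre relation instead. Later generators commute with [af_y0]. *)
Lemma xjy0 j : (0 < j < m)%N -> X j * af_y0 = q *: (af_y0 * X j).
Proof.
elim: j => // -[|j] IH jm.
  have [m2|m3] : m = 2%N \/ (2 < m)%N by lia.
    by rewrite /af_y0 m2; apply: serre_br => //; apply: rank2_X_G.
  have h1 : X 1 * X m.-1 = q *: (X m.-1 * X 1) by apply: (chain_qcomm q0 q2 eA); lia.
  have h2 : X 1 * afG = afG * X 1 by apply: X_G_comm => //; lia.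
  by rewrite /af_y0 [br q _ afG]/br; set x := X 1 in h1 h2 *; set z := X m.-1 in h1 *;
    ncfield k A (h1, h2).
have h1 := IH ltac:(lia).
have h2 : up j.+2 * af_y0 = af_y0 * up j.+2 by apply/esym/y0_comm; lia.
have -> : X j.+2 = X j.+1 * up j.+2 - q^-1 *: (up j.+2 * X j.+1) by [].
by set x := X j.+1 in h1 *; set z := af_y0 in h1 h2 *; ncfield k A (h1, h2).
Qed.

Lemma affine_tworow : tworow_rel q m (X) (chain q af_ey).
Proof.
have xe_next i : (i.+1 < m)%N -> X i * up i.+1 = q^-1 *: (up i.+1 * X i) + X i.+1.
  by move=> im; rewrite [X i.+1]/(br q (X i) (up i.+1)) /br addrC subrK.
have xe_top i : (0 < i < m)%N -> X i * up i = q *: (up i * X i).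
  by case: i => // i im; apply: (chain_top q0 q2 eA).
have xe_far i j : (i < m)%N -> (0 < j < m)%N -> j != i -> j != i.+1 ->
    X i * up j = up j * X i.
  move=> im jm ji ji'; have [lt|gt] : (i.+1 < j)%N \/ (j < i)%N by lia.
    by apply: (chain_far q0 q2 eA); lia.
  by apply: (chain_below q0 q2 eA); lia.
have ee_far i j : (0 < i)%N -> (i.+1 < j < m)%N -> up i * up j = up j * up i.
  by move=> i0 ij; apply: (typeA_far eA); lia.
have y0e j : (1 < j < m)%N -> chain q af_ey 0 * up j = up j * chain q af_ey 0.
  case: j => // j jm; apply: (typeA_far affine_y_typeA (i := 0) (j := j.+1)); lia.
have y_next i : (i.+1 < m)%N -> chain q af_ey i.+1 = br q (chain q af_ey i) (up i.+1) by [].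
split.
- by move=> i j ij; apply: (chain_qcomm q0 q2 eA); lia.
- by move=> i j ij; apply: (chain_qcomm q0 q2 affine_y_typeA); lia.
- exact: (tworows_eq q0 q2 xe_top xe_far y_next x0y0 xjy0).
- exact: (tworows_gt q0 q2 xe_far y_next xjy0).
- exact: (tworows_lt q0 q2 xe_next xe_top xe_far ee_far y_next y0e x0y0 xjy0).
Qed.

End AffineRootVectors.

(** * Oscillator representations *)

Section WeightedShifts.
Variables (k : fieldType) (I : zmodType).

Lemma cst1_neq0 : (fun _ : I => 1 : k^o) != 0.
Proof. by apply/eqP => /(congr1 (fun f => f 0)) /eqP; rewrite oner_eq0. Qed.

Notation wendo := (nzendo cst1_neq0).

Lemma wshift_linear (w : I -> k) (s : I) :
  linear (fun (f : I -> k^o) (p : I) => (w p * f (p + s) : k^o)).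
Proof.
move=> c f g; apply/funext => p.
by rewrite -[RHS]/(c * (w p * f (p + s)) + w p * g (p + s))
  -[(c *: f + g) _]/(c * f (p + s) + g (p + s)); ring.
Qed.

(** Positions form a group and all functions on it are allowed, so there is no vacuum and no
    boundary to treat. *)
Definition wshift (w : I -> k) (s : I) : wendo := Endo (wshift_linear w s).

Lemma wshiftE w s f p : wshift w s f p = w p * f (p + s). Proof. by []. Qed.

Lemma wshift_mul w s v t : wshift w s * wshift v t = wshift (fun p => w p * v (p + s)) (s + t).
Proof. by apply: endoP => f; apply/funext => p; rewrite /= -mulrA addrA. Qed.

Lemma wshift_scale c w s : c *: wshift w s = wshift (fun p => c * w p) s.
Proof. by apply: endoP => f; apply/funext => p; rewrite /= -mulrA. Qed.

Lemma wshift_add w v s : wshift w s + wshift v s = wshift (fun p => w p + v p) s.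
Proof. by apply: endoP => f; apply/funext => p; rewrite /= mulrDl. Qed.

Lemma wshift_opp w s : - wshift w s = wshift (fun p => - w p) s.
Proof. by apply: endoP => f; apply/funext => p; rewrite /= mulNr. Qed.

Lemma wshift_one : wshift (fun _ => 1) 0 = 1.
Proof. by apply: endoP => f; apply/funext => p; rewrite /= mul1r addr0. Qed.

Lemma eq_wshift w v s t : w =1 v -> s = t -> wshift w s = wshift v t.
Proof. by move=> /funext -> ->. Qed.

End WeightedShifts.
Notation wendo k I := (nzendo (cst1_neq0 k I)).

Section Oscillator.
Variables (k : fieldType) (q : k) (n : nat) (I : zmodType) (cr : I -> ivec n).
Hypotheses (q0 : q != 0) (qm : q - q^-1 != 0).
Let qm' := sqr_sub1_neq0 q0 qm.

Definition qint (z : int) : k := (q ^ z - q ^ (- z)) / (q - q^-1).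

Let bz0 : Posz (nat_of_bool false) = 0. Proof. by []. Qed.
Let bz1 : Posz (nat_of_bool true) = 1. Proof. by []. Qed.

Lemma subvE (v : ivec n) a b j : (v - vroot a b) j = v j - (j == a)%:Z + (j == b)%:Z.
Proof. by rewrite !ffunE opprB addrA addrAC. Qed.

(* Both [E_i] and [F_i] act by such operators, with the two coordinates
   exchanged. *)
Section MoveOperators.
Variables (J : eqType) (src dst : J -> 'I_n) (sh : J -> I).
Hypotheses (src_inj : injective src) (dst_inj : injective dst).
Hypothesis src_dst : forall i, src i != dst i.
Hypothesis cr_sh : forall p i, cr (p + sh i) = cr p - vroot (src i) (dst i).
Let e i := wshift (fun p => qint (cr p (src i))) (sh i).

Lemma move_comm i j : i != j -> dst i != src j -> src i != dst j -> e i * e j = e j * e i.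
Proof.
move=> ij d1 d2; have s1 : src i != src j by rewrite (inj_eq src_inj).
rewrite !wshift_mul; apply: eq_wshift; last by rewrite addrC.
move=> p; rewrite !cr_sh !subvE (eq_sym (src j) (src i)) (eq_sym (src j) (dst i)).
by rewrite (negbTE s1) (negbTE d1) (negbTE d2) !bz0 ?(subr0, addr0) mulrC.
Qed.

(** The inequality of booleans says that exactly one end is shared, that is, a single bond. At each
    position the claim is then an identity between rational functions of two powers of [q]. *)
Lemma move_serre i j : i != j -> (dst i == src j) != (src i == dst j) -> serre q (e i) (e j).
Proof.
rewrite /serre => ij.
have s1 : (src i == src j) = false by rewrite (inj_eq src_inj); apply/negbTE.
have s2 : (dst i == dst j) = false by rewrite (inj_eq dst_inj); apply/negbTE.
have s1' : (src j == src i) = false by rewrite eq_sym.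
have s2' : (dst j == dst i) = false by rewrite eq_sym.
have ii := negbTE (src_dst i); have jj := negbTE (src_dst j).
have ii' : (dst i == src i) = false by rewrite eq_sym.
have jj' : (dst j == src j) = false by rewrite eq_sym.
have shE1 : sh i + sh j + sh i = sh i + sh i + sh j by rewrite addrAC.
have shE2 : sh j + sh i + sh i = sh i + sh i + sh j by rewrite -addrA addrC.
rewrite !wshift_mul !wshift_scale wshift_opp shE1 shE2 wshift_add => adj.
apply: eq_wshift => // p; rewrite !(addrA p) !cr_sh !subvE.
rewrite !(eqxx, s1, s1', s2, s2', ii, jj, ii', jj') (eq_sym (src j)).
have a0 : q ^ (cr p (src i)) != 0 by rewrite expfz_neq0.
have b0 : q ^ (cr p (src j)) != 0 by rewrite expfz_neq0.
by move: adj; case: (dst i == src j); case: (src i == dst j) => // _;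
  rewrite ?(bz0, bz1) ?(subr0, addr0) /qint ?(opprD, opprK) !expfzDr // -?invr_expz ?expr1z;
  move: (q ^ cr p (src i)) (q ^ cr p (src j)) a0 b0 => a b a0 b0; field; rewrite ?a0 ?b0 ?q0 ?qm'.
Qed.
End MoveOperators.

Variables (D : datum) (src dst : dI D -> 'I_n) (wt : dL D -> ivec n) (sh : dI D -> I).
Hypothesis src_inj : injective src.
Hypothesis dst_inj : injective dst.
Hypothesis src_dst : forall i, src i != dst i.
Hypothesis pairE : forall mu i, dpair mu (dalpha i) = wt mu (src i) - wt mu (dst i).
Hypothesis wt_alpha : forall i, wt (dalpha i) = vroot (src i) (dst i).
Hypothesis wt_add : forall mu la, wt (dadd mu la) = wt mu + wt la.
Hypothesis wt_zero : wt (dzero D) = 0.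
Hypothesis wt_opp : forall mu, wt (dopp mu) = - wt mu.
Hypothesis cr_sh : forall p i, cr (p + sh i) = cr p - vroot (src i) (dst i).

(** The q-oscillator representation: generators move one quantum between the coordinates [src i] and
    [dst i] with a q-integer as coefficient. Occupation numbers may be negative. *)
Definition osc (a : ugen D) : wendo k I :=
  match a with
  | UE i => wshift (fun p => qint (cr p (src i))) (sh i)
  | UF i => wshift (fun p => qint (cr p (dst i))) (- sh i)
  | UK mu => wshift (fun p => q ^ (\sum_j wt mu j * cr p j)) 0
  end.

Let qz0 z : q ^ z != 0. Proof. by rewrite expfz_neq0. Qed.

Lemma cr_shN p i : cr (p - sh i) = cr p + vroot (src i) (dst i).
Proof. by rewrite -[in RHS](subrK (sh i) p) cr_sh subrK. Qed.

Lemma pair_sum mu (v : ivec n) i :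
  \sum_j wt mu j * (v - vroot (src i) (dst i)) j = \sum_j wt mu j * v j - dpair mu (dalpha i).
Proof.
rewrite pairE -vroot_sum -sumrB; apply: eq_bigr => j _.
by rewrite -mulrBr; congr (_ * _); rewrite !ffunE.
Qed.

Lemma pair_sumN mu (v : ivec n) i :
  \sum_j wt mu j * (v + vroot (src i) (dst i)) j = \sum_j wt mu j * v j + dpair mu (dalpha i).
Proof.
rewrite pairE -vroot_sum -big_split; apply: eq_bigr => j _ /=.
by rewrite -mulrDr; congr (_ * _); rewrite !ffunE.
Qed.

Lemma addvE (v : ivec n) i j : (v + vroot (src i) (dst i)) j =
  v j + (j == src i)%:Z - (j == dst i)%:Z.
Proof. by rewrite !ffunE addrA. Qed.

Lemma osc_cartan i j : dpair (dalpha i) (dalpha j) =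
  (i == j)%:Z *+ 2 - (dst i == src j)%:Z - (src i == dst j)%:Z.
Proof.
rewrite pairE wt_alpha !vrootE (inj_eq src_inj) (inj_eq dst_inj) (eq_sym j i).
by rewrite (eq_sym (src j)) (eq_sym (dst j)); ring.
Qed.

Lemma osc_adj i j : dpair (dalpha i) (dalpha j) = -1 ->
  i != j /\ (dst i == src j) != (src i == dst j).
Proof.
rewrite osc_cartan; case: (eqVneq i j) => [<-|ij].
  by rewrite (negbTE (src_dst i)) eq_sym (negbTE (src_dst i)).
by split=> //; move: H; do !case: eqP.
Qed.

Lemma cr_shF p i : cr (p - sh i) = cr p - vroot (dst i) (src i).
Proof. by rewrite cr_shN; apply/ffunP => j; rewrite !ffunE; ring. Qed.

Lemma osc_urep : urep q osc.
Proof.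
split=> /=.
- by rewrite -wshift_one; apply: eq_wshift => // p; rewrite wt_zero big1 // => j _; rewrite ffunE mul0r.
- move=> mu la; rewrite wshift_mul; apply: eq_wshift; last by rewrite addr0.
  move=> p; rewrite addr0 -expfzDr // -big_split wt_add; congr (q ^ _).
  by apply: eq_bigr => j _; rewrite ffunE mulrDl.
- move=> mu i; rewrite !wshift_mul wshift_scale; apply: eq_wshift; last by rewrite addrC.
  move=> p; rewrite addr0 cr_sh pair_sum.
  by rewrite expfzDr // -!invr_expz; have := qz0 (dpair mu (dalpha i)); move: (q ^ _) => c c0; field.
- move=> mu i; rewrite !wshift_mul wshift_scale; apply: eq_wshift; last by rewrite addrC.
  move=> p; rewrite addr0 cr_shN pair_sumN.
  by rewrite expfzDr // -!invr_expz; have := qz0 (dpair mu (dalpha i)); move: (q ^ _) => c c0; field.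
- move=> i j; rewrite osc_cartan; case: (eqVneq i j) => [-> //|ij].
  case: (eqVneq (dst i) (src j)) => [|d1]; first by case: eqP.
  by case: (eqVneq (src i) (dst j)) => [|d2] // _; exact: (move_comm src_inj cr_sh).
- move=> i j; rewrite osc_cartan; case: (eqVneq i j) => [-> //|ij].
  case: (eqVneq (dst i) (src j)) => [|d1]; first by case: eqP.
  case: (eqVneq (src i) (dst j)) => [|d2] // _.
  exact: (move_comm (sh := fun i => - sh i) dst_inj cr_shF).
- by move=> i j /osc_adj[ij adj]; exact: (move_serre src_inj dst_inj src_dst cr_sh).
- have dst_src i : dst i != src i by rewrite eq_sym.
  move=> i j /osc_adj[ij adj]; rewrite eq_sym in adj.
  exact: (move_serre (sh := fun i => - sh i) dst_inj src_inj dst_src cr_shF).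
- move=> i j ij; rewrite !wshift_mul; apply: eq_wshift; last by rewrite addrC.
  move=> p; rewrite cr_sh cr_shN subvE addvE (inj_eq dst_inj) (inj_eq src_inj) (eq_sym j i).
  rewrite (negbTE ij) (eq_sym (dst j)); case: (eqVneq (src i) (dst j)) => [->|_].
    by rewrite bz0 bz1 !addr0 mulrC.
  by rewrite !bz0 ?(subr0, addr0) mulrC.
- move=> i; rewrite !wshift_mul wshift_opp wshift_add wshift_scale addrN addNr wshift_add.
  apply: eq_wshift => // p; rewrite cr_sh cr_shN subvE addvE !eqxx.
  have ii := negbTE (src_dst i); have ii' : (dst i == src i) = false by rewrite eq_sym.
  have wp mu : \sum_j wt mu j * cr p j = \sum_j cr p j * wt mu j.
    by apply: eq_bigr => j _; rewrite mulrC.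
  have wpN : \sum_j wt (dopp (dalpha i)) j * cr p j = - \sum_j wt (dalpha i) j * cr p j.
    by rewrite -sumrN; apply: eq_bigr => j _; rewrite wt_opp ffunE mulNr.
  rewrite wpN wp wt_alpha vroot_sum ii ii' !bz0 !bz1 subr0 addr0.
  rewrite ?(subr0, addr0) /qint ?(opprD, opprK) !expfzDr // -?invr_expz ?expr1z.
  have a0 : q ^ (cr p (src i)) != 0 by rewrite expfz_neq0.
  have b0 : q ^ (cr p (dst i)) != 0 by rewrite expfz_neq0.
  by move: (q ^ cr p (src i)) (q ^ cr p (dst i)) a0 b0 => a b a0 b0; field; rewrite ?a0 ?b0 ?q0 ?qm'.
Qed.

End Oscillator.

(** * Root vectors in a single oscillator *)

Section OscillatorChains.
Variables (k : fieldType) (q : k) (I : zmodType) (m : nat) (cr : I -> ivec m.+1).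
Hypotheses (q0 : q != 0) (qm : q - q^-1 != 0).
Local Notation c j := (inord j : 'I_m.+1).
Local Notation wsh := (@wshift k I).

Let qm' := sqr_sub1_neq0 q0 qm.
Lemma qint_succ (z : int) : qint q (z + 1) - q^-1 * qint q z = q ^ z.
Proof.
have z0 : q ^ z != 0 by rewrite expfz_neq0.
rewrite /qint !opprD !expfzDr // -!invr_expz expr1z.
by move: (q ^ z) z0 => x x0; field; rewrite ?x0 ?q0 ?qm'.
Qed.

Variable sh : nat -> I.
Hypothesis cr_sh : forall p j, (j < m)%N -> cr (p + sh j) = cr p - vroot (c j) (c j.+1).
Let E j := wsh (fun p => qint q (cr p (c j))) (sh j).

Lemma c_eq i j : (i <= m)%N -> (j <= m)%N -> (c i == c j) = (i == j).
Proof. by move=> im jm; rewrite -val_eqE /= !inordK. Qed.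

Lemma cr_shE p j i : (j < m)%N -> (i <= m)%N ->
  cr (p + sh j) (c i) = cr p (c i) - (i == j)%:Z + (i == j.+1)%:Z.
Proof.
move=> jm im; rewrite cr_sh // !ffunE !c_eq //; try lia.
by rewrite opprB addrA addrAC.
Qed.

(** The identity [[z + 1] - q^-1 [z] = q^z] collapses the bracket to one weighted shift. Hence a
    root vector keeps a single q-integer, and each bracket adds only a power of [q]. *)
Lemma br_osc w s j : (j < m)%N -> (forall p, w (p + sh j) = w p) ->
  (forall p, cr (p + s) (c j) = cr p (c j) + 1) ->
  br q (wsh w s) (E j) = wsh (fun p => w p * q ^ (cr p (c j))) (s + sh j).
Proof.
move=> jm wi si; rewrite /br /E !wshift_mul wshift_scale wshift_opp [sh j + s]addrC.
rewrite wshift_add; apply: eq_wshift => // p; rewrite wi si -qint_succ; ring.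
Qed.

Definition xsh l := \sum_(j < l.+1) sh j.
Definition xw l (p : I) := qint q (cr p (c 0)) * q ^ (\sum_(j < l) cr p (c j.+1)).

Lemma cr_xsh p l i : (l < m)%N -> (i <= m)%N ->
  cr (p + xsh l) (c i) = cr p (c i) - (i == 0%N)%:Z + (i == l.+1)%:Z.
Proof.
elim: l p => [|l IH] p lm im; first by rewrite /xsh big_ord_recl big_ord0 addr0 cr_shE.
rewrite /xsh big_ord_recr /= -/(xsh l) addrA cr_shE // IH ?(ltnW lm) //.
by rewrite -!addrA; congr (_ + (_ + _)); rewrite !addrA addrN add0r.
Qed.

Lemma xwS l p : xw l.+1 p = xw l p * q ^ (cr p (c l.+1)).
Proof. by rewrite /xw big_ord_recr /= expfzDr // mulrA. Qed.

Lemma cr_sh_inv l j p : (l < j < m)%N -> cr (p + sh j) (c 0) = cr p (c 0) /\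
  \sum_(i < l) cr (p + sh j) (c i.+1) = \sum_(i < l) cr p (c i.+1).
Proof.
move=> lj; have e i : (i <= l)%N -> cr (p + sh j) (c i) = cr p (c i).
  move=> il; rewrite cr_shE; [|lia|lia].
  have -> : (i == j)%N = false by lia.
  have -> : (i == j.+1)%N = false by lia.
  by rewrite subr0 addr0.
by split; [apply: e | apply: eq_bigr => i _; apply: e].
Qed.

Lemma xw_inv l j p : (l < j < m)%N -> xw l (p + sh j) = xw l p.
Proof. by move=> lj; rewrite /xw; have [-> ->] := cr_sh_inv p lj. Qed.

Lemma osc_chain l : (l < m)%N -> chain q E l = wsh (xw l) (xsh l).
Proof.
elim: l => [|l IH] lm.
  rewrite /= /E; apply: eq_wshift => [p|]; last by rewrite /xsh big_ord_recl big_ord0 addr0.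
  by rewrite /xw big_ord0 expr0z mulr1.
rewrite [chain q E l.+1]/= IH ?(ltnW lm) // br_osc //.
- by apply: eq_wshift => [p|]; [rewrite xwS | rewrite /xsh [RHS]big_ord_recr].
- by move=> p; apply: xw_inv; lia.
- by move=> p; rewrite cr_xsh ?(ltnW lm) // eqxx subr0.
Qed.

Variable sh0 : I.
Hypothesis cr_sh0 : forall p, cr (p + sh0) = cr p - vroot (c m) (c 0).
Hypothesis m1 : (1 < m)%N.
Let E0 := wsh (fun p => qint q (cr p (c m))) sh0.

Lemma cr_sh0E p i : (i <= m)%N ->
  cr (p + sh0) (c i) = cr p (c i) - (i == m)%:Z + (i == 0%N)%:Z.
Proof.
move=> im; rewrite cr_sh0 !ffunE !c_eq //.
by rewrite opprB addrA addrAC.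
Qed.

Lemma osc_G : br q (E 0) E0 =
  wsh (fun p => - (qint q (cr p (c m)) * q ^ (- cr p (c 0) - 1))) (sh 0 + sh0).
Proof.
have mm : (m == 0)%N = false by lia.
have m1' : (m == 1)%N = false by lia.
rewrite /br /E /E0 !wshift_mul wshift_scale wshift_opp [sh0 + _]addrC wshift_add.
apply: eq_wshift => // p.
rewrite cr_shE ?(ltnW m1) // cr_sh0E // mm m1' eq_sym mm subr0 addr0 /= subr0.
have z0 : q ^ (cr p (c 0)) != 0 by rewrite expfz_neq0.
rewrite ?(addr0, subr0) /qint !opprD ?opprK !expfzDr // -!invr_expz ?expr1z.
move: (q ^ cr p (c 0)) (q ^ cr p (c m)) z0 => x y x0.
case: (eqVneq y 0) => [->|y0]; first by rewrite invr0; field; rewrite ?x0 ?q0 ?qm'.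
by field; rewrite ?x0 ?y0 ?q0 ?qm'.
Qed.

Definition ysh l := xsh m.-1 + (sh 0 + sh0) + \sum_(j < l) sh j.+1.
(** This is [xw] times a sign and a power of [q]; the total occupation number in the exponent is
    unchanged by all moves. *)
Definition yw l (p : I) :=
  - (qint q (cr p (c 0)) * q ^ (\sum_j cr p j - cr p (c 0) *+ 2) *
     q ^ (\sum_(j < l) cr p (c j.+1))).
Let ey j := if j is 0 then br q (chain q E m.-1) (br q (E 0) E0) else E j.

Lemma yshS l : ysh l.+1 = ysh l + sh l.+1.
Proof. by rewrite /ysh big_ord_recr /= addrA. Qed.

Lemma cr_ysh p l i : (l < m)%N -> (i <= m)%N ->
  cr (p + ysh l) (c i) = cr p (c i) - (i == 0%N)%:Z + (i == l.+1)%:Z.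
Proof.
elim: l p => [|l IH] p lm im.
  rewrite /ysh big_ord0 addr0 !addrA cr_sh0E // cr_shE // cr_xsh //; last lia.
  rewrite prednK 1?ltnW //; ring.
rewrite yshS addrA.
rewrite cr_shE // IH ?(ltnW lm) //; ring.
Qed.

Lemma tot_sh p j : (j < m)%N -> \sum_i cr (p + sh j) i = \sum_i cr p i.
Proof.
move=> jm; rewrite cr_sh // (eq_bigr (fun i => cr p i - vroot (c j) (c j.+1) i)).
  rewrite sumrB (eqP (sum0_e (c j) (c j.+1))) subr0 //.
by move=> i _; rewrite !ffunE.
Qed.

Lemma ywS l p : yw l.+1 p = yw l p * q ^ (cr p (c l.+1)).
Proof. by rewrite /yw [\sum_(j < l.+1) _]big_ord_recr /= !expfzDr // mulNr -!mulrA. Qed.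

Lemma yw_inv l j p : (l < j < m)%N -> yw l (p + sh j) = yw l p.
Proof.
by move=> lj; rewrite /yw tot_sh; [have [-> ->] := cr_sh_inv p lj | lia].
Qed.

Lemma osc_y0 : br q (chain q E m.-1) (br q (E 0) E0) = wsh (yw 0) (ysh 0).
Proof.
have mm : (m == 0)%N = false by lia.
have mm' : (0%N == m) = false by lia.
have mP : m.-1.+1 = m by lia.
rewrite osc_G osc_chain; last lia.
rewrite /br !wshift_mul wshift_scale wshift_opp [sh 0 + sh0 + _]addrC wshift_add.
apply: eq_wshift => [p|]; last by rewrite /ysh big_ord0 addr0.
rewrite !cr_xsh ?mP // mm eqxx /= /yw big_ord0 expr0z mulr1.
have -> : xw m.-1 (p + (sh 0 + sh0)) =
    qint q (cr p (c 0)) * q ^ (\sum_(j < m.-1) cr p (c j.+1) + 1).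
  rewrite /xw !addrA cr_sh0E // cr_shE ?(ltnW m1) //; rewrite mm' /=; congr (qint q _ * q ^ _); first ring.
  have -> : m.-1 = m.-2.+1 by lia.
  have e (j : nat) : (j.+1 < m)%N ->
      cr (p + sh 0 + sh0) (c j.+1) = cr p (c j.+1) + (j == 0%N)%:Z.
    by move=> jm; rewrite cr_sh0E ?cr_shE ?(ltnW m1) //; lia.
  rewrite [LHS](eq_bigr (fun j : 'I_m.-2.+1 => cr p (c j.+1) + (j == 0%N :> nat)%:Z)).
    by rewrite big_split /=; congr (_ + _); rewrite big_ord_recl big1.
  by move=> j _; apply: e; have := ltn_ord j; lia.
have last_term (F : nat -> int) : \sum_(i < m) F i = \sum_(i < m.-1) F i + F m.-1.
  by transitivity (\sum_(i < m.-1.+1) F i); [rewrite mP | rewrite big_ord_recr].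
have -> : \sum_j cr p j = cr p (c 0) + \sum_(j < m.-1) cr p (c j.+1) + cr p (c m).
  rewrite big_ord_recl -addrA; congr (cr p _ + _); first by apply: val_inj; rewrite /= inordK.
  have -> : \sum_(i < m) cr p (lift ord0 i) = \sum_(i < m) cr p (c i.+1).
    apply: eq_bigr => i _; congr (cr p _); apply: val_inj; rewrite /= inordK //.
    by have := ltn_ord i; lia.
  by rewrite (last_term (fun i => cr p (c i.+1))) mP.
rewrite /xw mm' /=; move: (\sum_(j < m.-1) _) => S.
have x0 : q ^ (cr p (c 0)) != 0 by rewrite expfz_neq0.
have y0 : q ^ (cr p (c m)) != 0 by rewrite expfz_neq0.
have z0 : q ^ S != 0 by rewrite expfz_neq0.
rewrite mulr2n ?(subr0, addr0) /qint ?(opprD, opprK) !expfzDr // -?invr_expz ?expr1z.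
by move: (q ^ cr p (c 0)) (q ^ cr p (c m)) (q ^ S) x0 y0 z0 => x y z x0 y0 z0;
  field; rewrite ?x0 ?y0 ?z0 ?q0 ?qm'.
Qed.

Lemma osc_ychain l : (l < m)%N -> chain q ey l = wsh (yw l) (ysh l).
Proof.
elim: l => [|l IH] lm; first exact: osc_y0.
rewrite [chain q ey l.+1]/= IH ?(ltnW lm) // br_osc //.
- by apply: eq_wshift => [p|]; [rewrite ywS | rewrite yshS].
- by move=> p; apply: yw_inv; lia.
- by move=> p; rewrite cr_ysh ?(ltnW lm) // eqxx subr0.
Qed.

Hypothesis q_free : forall z : int, q ^ z = 1 -> z = 0.

Lemma qint_neq0 z : z != 0 -> qint q z != 0.
Proof.
move=> z0; rewrite /qint; apply: mulf_neq0; last exact: invr_neq0.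
rewrite subr_eq0; apply: contraNneq z0 => e.
have /q_free : q ^ (z + z) = 1 by rewrite expfzDr // {1}e -expfzDr // addNr expr0z.
by move=> zz; clear -zz; lia.
Qed.

Lemma xw_neq0 l p : cr p (c 0) != 0 -> xw l p != 0.
Proof. by move=> p0; apply: mulf_neq0; [apply: qint_neq0 | apply: expfz_neq0]. Qed.

Lemma yw_neq0 l p : cr p (c 0) != 0 -> yw l p != 0.
Proof.
move=> p0; rewrite /yw oppr_eq0; apply: mulf_neq0; last exact: expfz_neq0.
by apply: mulf_neq0; [apply: qint_neq0 | apply: expfz_neq0]. Qed.

End OscillatorChains.

Lemma seq_min (T : eqType) (h : T -> int) (l : seq T) : l != [::] ->
  exists2 x, x \in l & forall y, y \in l -> h x <= h y.
Proof.
elim: l => // a [|b l] IH _.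
  by exists a => [|y]; rewrite ?inE // => /eqP ->.
have [x xl xm] := IH isT.
have [le|lt] := leP (h a) (h x).
  exists a; rewrite ?mem_head // => y; rewrite inE => /orP[/eqP -> //|/xm].
  exact: le_trans.
exists x; first by rewrite inE xl orbT.
by move=> y; rewrite inE => /orP[/eqP ->|/xm //]; apply: ltW.
Qed.

Section GroupedSums.
Variables (k : fieldType) (V : lmodType k) (K : eqType).

(** Keys may repeat in the list, so a coefficient collects all occurrences. *)
Definition coef_of (r : seq (k * K)) (x : K) : k := \sum_(t <- r | t.2 == x) t.1.

Lemma sum_grouped (r : seq (k * K)) (T : K -> V) :
  \sum_(t <- r) t.1 *: T t.2 = \sum_(x <- undup (map snd r)) coef_of r x *: T x.
Proof.
transitivity (\sum_(x <- undup (map snd r)) \sum_(t <- r | t.2 == x) t.1 *: T t.2).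
  rewrite (exchange_big_dep predT) //= big_seq [RHS]big_seq; apply: eq_bigr => t tr.
  rewrite (eq_bigl (fun x => x == t.2)); last by move=> x; rewrite eq_sym.
  by rewrite -big_filter filter_pred1_uniq ?big_seq1 ?undup_uniq // mem_undup map_f.
by apply: eq_bigr => x _; rewrite scaler_suml; apply: eq_bigr => t /eqP ->.
Qed.
End GroupedSums.

(** * Filtration by heights and leading terms *)

Section Filtration.
Variables (k : fieldType) (I : zmodType) (ht : I -> int).
Hypothesis htD : forall a b, ht (a + b) = ht a + ht b.
Local Notation A := (wendo k I).
Local Notation wsh := (@wshift k I).
Implicit Types (T S : A) (n : int).

(* [T] raises heights by at least [n]. *)
Definition Fil n T := forall f p, (forall x, ht p + n <= ht x -> f x = 0) -> T f p = 0.

Lemma Fil_le n n' T : n' <= n -> Fil n T -> Fil n' T.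
Proof. by move=> le F f p f0; apply: F => x px; apply: f0; lia. Qed.

Lemma Fil_add n T S : Fil n T -> Fil n S -> Fil n (T + S).
Proof.
by move=> FT FS f p f0; rewrite endo_addE; have := FT f p f0; have := FS f p f0;
  rewrite -[(T f + S f) p]/(T f p + S f p) => -> ->; rewrite addr0.
Qed.

Lemma Fil_scale n c T : Fil n T -> Fil n (c *: T).
Proof.
move=> FT f p f0; rewrite endo_scaleE -[(c *: T f) p]/(c * T f p) (FT f p f0).
exact: mulr0.
Qed.

Lemma Fil_opp n T : Fil n T -> Fil n (- T).
Proof. by rewrite -scaleN1r; apply: Fil_scale. Qed.

Lemma Fil_sub n T S : Fil n T -> Fil n S -> Fil n (T - S).
Proof. by move=> FT FS; apply: Fil_add => //; apply: Fil_opp. Qed.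

Lemma Fil_mul n n' T S : Fil n T -> Fil n' S -> Fil (n + n') (T * S).
Proof.
move=> FT FS f p f0; rewrite endo_mulE; apply: FT => x px; apply: FS => y xy.
by apply: f0; lia.
Qed.

Lemma Fil_wshift n w s : n <= ht s -> Fil n (wsh w s).
Proof. by move=> ns f p f0; rewrite wshiftE f0 ?mulr0 // htD; lia. Qed.

Lemma Fil_br q n n' T S : Fil n T -> Fil n' S -> Fil (n + n') (br q T S).
Proof.
move=> FT FS; apply: Fil_sub; first exact: Fil_mul.
by apply: Fil_scale; rewrite addrC; apply: Fil_mul.
Qed.

Lemma Fil0 n : Fil n 0. Proof. by []. Qed.

Variable good : I -> Prop.

(** Nonvanishing is asked at good positions only, since q-integers do vanish elsewhere; stability of
    goodness under the shift is what makes leading terms multiplicative. *)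
Definition lead T s := (forall p, good p -> good (p + s)) /\
  exists2 w, (forall p, good p -> w p != 0) & Fil (ht s + 1) (T - wsh w s).

Lemma lead_one : lead 1 0.
Proof.
split=> [p|]; first by rewrite addr0.
by exists (fun _ => 1) => [p _|]; rewrite ?oner_neq0 // wshift_one subrr; apply: Fil0.
Qed.

Lemma lead_mul T S s t : lead T s -> lead S t -> lead (T * S) (s + t).
Proof.
move=> [gs [w w0 Fw]] [gt [v v0 Fv]]; split=> [p gp|]; first by rewrite addrA; apply/gt/gs.
exists (fun p => w p * v (p + s)) => [p gp|].
  by apply: mulf_neq0; [apply: w0 | apply/v0/gs].
rewrite -wshift_mul.
have -> : T * S - wsh w s * wsh v t =
    (T - wsh w s) * wsh v t + (wsh w s * (S - wsh v t) + (T - wsh w s) * (S - wsh v t)).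
  by set X := wsh w s; set Y := wsh v t; ncring k (A : algType k) tt.
have Fs : Fil (ht s) (wsh w s) by apply: Fil_wshift.
have Ft : Fil (ht t) (wsh v t) by apply: Fil_wshift.
apply: Fil_add; last apply: Fil_add.
- by apply: (Fil_le _ (Fil_mul Fw Ft)); rewrite htD; lia.
- by apply: (Fil_le _ (Fil_mul Fs Fv)); rewrite htD; lia.
- by apply: (Fil_le _ (Fil_mul Fw Fv)); rewrite htD; lia.
Qed.

Lemma lead_prod (x : nat -> A) (s : nat -> I) m w :
  (forall i, (i < m)%N -> lead (x i) (s i)) -> all (fun i => i < m)%N w ->
  lead (\prod_(i <- w) x i) (\sum_(i <- w) s i).
Proof.
move=> xs; elim: w => [|i w IH] /=; first by rewrite !big_nil => _; exact: lead_one.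
by case/andP=> im wm; rewrite !big_cons; apply: lead_mul; [apply: xs | apply: IH].
Qed.

(** Among the keys with nonzero coefficient take one of minimal height, [x0]. Apply the sum to the
    indicator function of [p0 + s x0] and evaluate at [p0]: remainders only see greater heights, and
    the leading shifts of other keys miss the point because [s] is injective. So only the term of
    [x0] survives. *)
Lemma lead_indep (K : eqType) (T : K -> A) (s : K -> I) (r : seq (k * K)) p0 :
  good p0 -> (forall x, x \in map snd r -> lead (T x) (s x)) ->
  {in map snd r &, injective s} -> \sum_(t <- r) t.1 *: T t.2 = 0 ->
  forall x, coef_of r x = 0.
Proof.
move=> gp0 lT s_inj; rewrite sum_grouped => sum0.
pose l := [seq x <- undup (map snd r) | coef_of r x != 0].
have [l0|] := eqVneq l [::].
  move=> x; have [xr|xr] := boolP (x \in map snd r); last first.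
    rewrite /coef_of big_seq_cond big1 // => t /andP[tr /eqP tx].
    by case/negP: xr; rewrite -tx map_f.
  apply/eqP; apply: contraTT isT => cx.
  by have := mem_filter (fun x => coef_of r x != 0) x (undup (map snd r));
    rewrite -/l l0 cx mem_undup xr.
case/(seq_min (fun x => ht (s x))) => x0; rewrite mem_filter mem_undup => /andP[cx0 x0r] x0min.
have [_ [w w0 Fw]] := lT x0 x0r.
pose dlt (p : I) : k^o := if p == p0 + s x0 then 1 else 0.
have T0 : T x0 dlt p0 = w p0.
  rewrite -[T x0](subrK (wsh w (s x0))) endo_addE.
  rewrite -[LHS]/((T x0 - wsh w (s x0)) dlt p0 + wsh w (s x0) dlt p0).
  rewrite Fw ?wshiftE ?add0r /dlt ?eqxx ?mulr1 // => x px.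
  by case: eqP => // xE; move: px; rewrite xE htD; lia.
have := congr1 (fun S : A => S dlt p0) sum0.
rewrite /= endo_sumE fct_sumE.
rewrite (bigD1_seq x0) ?undup_uniq ?mem_undup //= big1_seq ?addr0.
  move=> h; have /eqP : coef_of r x0 * w p0 = 0 by rewrite -T0; exact: h.
  by rewrite mulf_eq0 (negbTE cx0) (negbTE (w0 _ gp0)).
move=> x /andP[xx0]; rewrite mem_undup => xr.
rewrite -[LHS]/(coef_of r x * T x dlt p0).
have [->|cx] := eqVneq (coef_of r x) 0; first by rewrite mul0r.
have hx : ht (s x0) <= ht (s x) by apply: x0min; rewrite mem_filter cx mem_undup.
have [_ [v v0 Fv]] := lT x xr.
rewrite -[T x](subrK (wsh v (s x))) endo_addE.
rewrite -[X in _ * X]/((T x - wsh v (s x)) dlt p0 + wsh v (s x) dlt p0).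
rewrite Fv ?wshiftE ?add0r /dlt.
  case: eqP => [/addrI sE|_]; last by rewrite !mulr0.
  by rewrite (s_inj _ _ xr x0r sE) eqxx in xx0.
by move=> y py; case: eqP => // yE; move: py; rewrite yE htD; lia.
Qed.

End Filtration.

(* Positions of a pair of oscillators, with a formal height as third component. *)
Definition twopos n : zmodType := (ivec n * ivec n * int)%type.

(** * Ordered monomials in two rows of oscillators *)

Section TwoRowsOfOscillators.
Variables (k : fieldType) (m : nat).
Local Notation I := (twopos m.+1).
Local Notation A := (wendo k I).
Local Notation c j := (inord j : 'I_m.+1).

Definition row (b : bool) (p : I) : ivec m.+1 := if b then p.1.2 else p.1.1.
Definition ht (p : I) : int := p.2.
Definition rsh (b : bool) (v : ivec m.+1) (t : int) : I := if b then ((0, v), t) else ((v, 0), t).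

Lemma rowD b p p' : row b (p + p') = row b p + row b p'. Proof. by case: b. Qed.
Lemma htD p p' : ht (p + p') = ht p + ht p'. Proof. by []. Qed.
Lemma row_rsh b b' v t : row b (rsh b' v t) = if b == b' then v else 0.
Proof. by case: b b' => -[]. Qed.
Lemma ht_rsh b v t : ht (rsh b v t) = t. Proof. by case: b. Qed.
Lemma rshD b v t v' t' : rsh b v t + rsh b v' t' = rsh b (v + v') (t + t').
Proof. by case: b; rewrite /rsh /= /GRing.add /= /GRing.add /= ?addr0; congr (_, _, _); rewrite ?addr0. Qed.

(** Root vectors lower coordinate 0 by one, so a negative value stays negative and the q-integer of
    that coordinate never vanishes. *)
Definition good (p : I) := (row false p (c 0) < 0) && (row true p (c 0) < 0).

(* Shift attached to the root vector of weight [e_0 - e_(l+1)] on row [b]. *)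
Definition vsh b l t := rsh b (- vroot (c 0) (c l.+1)) t.

Lemma row_vsh0 b b' l t p : (l < m)%N ->
  row b (p + vsh b' l t) (c 0) = row b p (c 0) - (b == b')%:Z.
Proof.
move=> lm; rewrite rowD row_rsh [LHS]ffunE; congr (_ + _).
case: eqP => _; last by rewrite ffunE oppr0.
by rewrite !ffunE eqxx -val_eqE /= !inordK.
Qed.

Lemma good_vsh b l t p : (l < m)%N -> good p -> good (p + vsh b l t).
Proof. by move=> lm; rewrite /good !row_vsh0 //; case: b; lia. Qed.

Definition key_shift (t0 t1 : nat -> int) (x : seq nat * seq nat) : I :=
  \sum_(i <- x.1) vsh false i (t0 i) + \sum_(i <- x.2) vsh true i (t1 i).

Definition key_ok (x : seq nat * seq nat) :=
  [&& all (fun i => i < m)%N x.1, all (fun i => i < m)%N x.2, sorted leq x.1 & sorted leq x.2].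

Lemma row_sum b b' (t : nat -> int) w j : (j < m)%N -> all (fun i => i < m)%N w ->
  row b (\sum_(i <- w) vsh b' i (t i)) (c j.+1) = if b == b' then (count_mem j w)%:Z else 0.
Proof.
move=> jm; elim: w => [|i w IH] /=.
  by rewrite big_nil; case: b; rewrite /= ffunE if_same.
case/andP=> im wm; rewrite big_cons rowD [LHS]ffunE IH // /vsh row_rsh.
case: eqP => _; last by rewrite ffunE addr0.
rewrite !ffunE -!val_eqE /= !inordK //; try lia.
Qed.

(** Coordinate [j + 1] of a row counts the letters [j] of the corresponding word, and a sorted word
    is determined by its letter counts. *)
Lemma key_shift_inj t0 t1 x y : key_ok x -> key_ok y ->
  key_shift t0 t1 x = key_shift t0 t1 y -> x = y.
Proof.
case: x y => [w1 w2] [v1 v2] /and4P[/= w1m w2m sw1 sw2] /and4P[/= v1m v2m sv1 sv2] e.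
have leq_tot : total leq by exact: leq_total.
have part b : row b (key_shift t0 t1 (w1, w2)) = row b (key_shift t0 t1 (v1, v2)) by rewrite e.
have countE u v : all (fun i => i < m)%N u -> all (fun i => i < m)%N v ->
    (forall j, (j < m)%N -> count_mem j u = count_mem j v) -> perm_eq u v.
  move=> um vm cE; apply/allP => j _ /=; apply/eqP.
  have [jm|jm] := ltnP j m; first exact: cE.
  have nin w : all (fun i => i < m)%N w -> count_mem j w = 0%N.
    by move=> wm; apply/count_memPn/negP => /(allP wm); lia.
  by rewrite !nin.
have nu w : sorted leq w -> forall v, sorted leq v -> perm_eq w v -> w = v.
  by move=> sw v sv; apply: (sorted_eq leq_trans anti_leq).
congr (_, _); apply: nu => //; apply: countE => // j jm.
  have h := part false; rewrite /key_shift !rowD in h.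
  have := congr1 (fun v : ivec m.+1 => v (c j.+1)) h; cbv beta.
  by rewrite [LHS]ffunE [RHS]ffunE !row_sum // eqxx !addr0 => -[].
have h := part true; rewrite /key_shift !rowD in h.
have := congr1 (fun v : ivec m.+1 => v (c j.+1)) h; cbv beta.
by rewrite [LHS]ffunE [RHS]ffunE !row_sum // eqxx !add0r => -[].
Qed.

Definition mono (R : pzRingType) (x y : nat -> R) (u : seq nat * seq nat) : R :=
  (\prod_(i <- u.1) x i) * (\prod_(i <- u.2) y i).

Lemma two_row_indep (x y : nat -> A) (t0 t1 : nat -> int) (r : seq (k * (seq nat * seq nat))) :
  (forall l, (l < m)%N -> lead ht good (x l) (vsh false l (t0 l))) ->
  (forall l, (l < m)%N -> lead ht good (y l) (vsh true l (t1 l))) ->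
  all key_ok (map snd r) -> \sum_(t <- r) t.1 *: mono x y t.2 = 0 ->
  forall u, coef_of r u = 0.
Proof.
move=> lx ly okr.
pose p0 : I := ([ffun _ => -1], [ffun _ => -1], 0).
apply: (@lead_indep k I ht htD good _ (mono x y) (key_shift t0 t1) r p0).
- by rewrite /good /row /= !ffunE.
- move=> u /(allP okr) /and4P[u1 u2 _ _].
  by apply: (lead_mul htD); [apply: (lead_prod htD lx u1) | apply: (lead_prod htD ly u2)].
- by move=> u v /(allP okr) ou /(allP okr) ov; apply: key_shift_inj.
Qed.

Lemma wshift_comm (w v : I -> k) (s t : I) :
  (forall p, w (p + t) = w p) -> (forall p, v (p + s) = v p) ->
  wshift w s * wshift v t = wshift v t * wshift w s.
Proof.
move=> wt vs; rewrite !wshift_mul; apply: eq_wshift; last exact: addrC.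
by move=> p; rewrite wt vs mulrC.
Qed.

Lemma row_rshN b v t p : row (~~ b) (p + rsh b v t) = row (~~ b) p.
Proof. by rewrite rowD row_rsh; case: b; rewrite addr0. Qed.

Lemma rshN b v t : - rsh b v t = rsh b (- v) (- t).
Proof. by case: b; rewrite /rsh /GRing.opp /= /GRing.opp /=; congr (_, _, _); rewrite oppr0. Qed.

Lemma sum_vsh b (t : nat -> int) l : (l < m)%N ->
  \sum_(j < l.+1) rsh b (- vroot (c j) (c j.+1)) (t j) = vsh b l (\sum_(j < l.+1) t j).
Proof.
elim: l => [|l IH] lm; first by rewrite !big_ord_recl !big_ord0 !addr0.
rewrite big_ord_recr IH ?(ltnW lm) //= rshD [in RHS]big_ord_recr /=; congr (rsh b _ _).
by apply/ffunP => j; rewrite !ffunE; ring.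
Qed.

Lemma lead_wshift (T : A) w s (t : I) : T = wshift w s -> s = t -> (forall p, good p -> w p != 0) ->
  (forall p, good p -> good (p + t)) -> lead ht good T t.
Proof.
by move=> -> -> w0 gt; split=> //; exists w => //; rewrite subrr.
Qed.

End TwoRowsOfOscillators.

Section RowOscillators.
Variables (k : fieldType) (q : k) (D : datum) (m : nat).
Variables (src dst : dI D -> 'I_m.+1) (wt : dL D -> ivec m.+1).
Local Notation I := (twopos m.+1).
Local Notation A := (wendo k I).

(** The heights [d] enter the shifts but neither the occupation numbers nor the weights, so they can
    be chosen freely without leaving the representation. *)
Definition rowosc b (d : dI D -> int) : ugen D -> A :=
  osc q (row b) src dst wt (fun i => rsh b (- vroot (src i) (dst i)) (d i)).

Lemma rowosc_comm d d' a a' :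
  rowosc false d a * rowosc true d' a' = rowosc true d' a' * rowosc false d a.
Proof.
have r1 v t p : row true (p + rsh false v t) = row true p := row_rshN false v t p.
have r2 v t p : row false (p + rsh true v t) = row false p := row_rshN true v t p.
by case: a => [i|i|mu]; case: a' => [j|j|la]; apply: wshift_comm => p;
  rewrite ?rshN ?r1 ?r2 ?addr0.
Qed.
End RowOscillators.

(** * Independence of ordered monomials, finite type *)

Section FiniteIndependence.
Variables (k : fieldType) (q : k) (m : nat).
Hypotheses (q0 : q != 0) (qm : q - q^-1 != 0).
Hypothesis q_free : forall z : int, q ^ z = 1 -> z = 0.
Local Notation D := (DA m.+1).
Local Notation I := (twopos m.+2).
Local Notation A := (wendo k I).

Definition finosc b : ugen D -> A :=
  @rowosc k q D m.+1 (fun i : 'I_m.+1 => inord i) (fun i : 'I_m.+1 => inord i.+1)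
    (fun mu : QA m.+1 => sval mu) b (fun _ => 0).

Lemma finosc_urep b : urep q (finosc b).
Proof.
have inj (i j : nat) : (i <= m.+1)%N -> (j <= m.+1)%N -> inord i = inord j :> 'I_m.+2 -> i = j.
  by move=> im jm /(congr1 val) /=; rewrite !inordK.
apply: osc_urep => //.
- by move=> i j /inj ij; apply: val_inj; apply: ij; have := ltn_ord i; have := ltn_ord j; lia.
- move=> i j /inj ij; apply: val_inj; apply: eq_add_S; apply: ij; have := ltn_ord i; have := ltn_ord j; lia.
- by move=> i; rewrite -val_eqE /= !inordK; have := ltn_ord i; lia.
- exact: fin_pairE.
- by move=> mu la; apply/ffunP => j; rewrite !ffunE mul1r.
- by move=> mu; apply/ffunP => j; rewrite !ffunE add0r mulN1r.
- by move=> p i; rewrite rowD row_rsh eqxx.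
Qed.

(** Each root vector is exactly a weighted shift on its own row, so there is no remainder and all
    heights can be 0. *)
Lemma finosc_lead b l : (l < m.+1)%N ->
  lead (@ht _) (@good _) (chain q (finE (finosc b)) l) (vsh m.+1 b l 0).
Proof.
move=> lm.
pose sh (j : nat) : I := rsh b (- vroot (inord j) (inord j.+1)) 0.
have cr_sh p j : (j < m.+1)%N -> row b (p + sh j) = row b p - vroot (inord j) (inord j.+1).
  by move=> _; rewrite rowD row_rsh eqxx.
have -> : chain q (finE (finosc b)) l =
    chain q (fun j => wshift (fun p => qint q (row b p (inord j))) (sh j)) l.
  apply: eq_chain => j jl; rewrite /finE /finosc /rowosc /=.
  by apply: eq_wshift => [p|]; rewrite /sh ?inordK //; lia.
rewrite (osc_chain q0 qm cr_sh lm); apply: (lead_wshift (erefl _)).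
- by rewrite /xsh /sh (@sum_vsh _ b (fun _ => 0)) // big1.
- move=> p /andP[p0 p1]; apply: (xw_neq0 q0 qm q_free).
  by case: b {sh cr_sh}; [move: p1 | move: p0]; case: eqP => // ->.
- by move=> p gp; apply: good_vsh.
Qed.

Lemma finite_indep (r : seq (k * (seq nat * seq nat))) :
  all (key_ok m.+1) (map snd r) ->
  \sum_(t <- r) t.1 *: mono (chain q (finE (finosc false))) (chain q (finE (finosc true))) t.2 = 0 ->
  forall u, coef_of r u = 0.
Proof.
move=> okr; apply: (@two_row_indep k m.+1 _ _ (fun _ => 0) (fun _ => 0)) => // l lm;
  exact: finosc_lead.
Qed.
End FiniteIndependence.

(** * Independence of ordered monomials, affine type *)

Section AffineIndependence.
Variables (k : fieldType) (q : k) (m : nat).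
Hypotheses (q0 : q != 0) (q2 : q + q^-1 != 0) (qm : q - q^-1 != 0) (m1 : (1 < m)%N).
Hypothesis q_free : forall z : int, q ^ z = 1 -> z = 0.
Local Notation D := (DAf m).
Local Notation I := (twopos m.+1).
Local Notation A := (wendo k I).
Local Notation c j := (inord j : 'I_m.+1).

(* Heights are chosen so that the leading terms of the root vectors on the
   tensor product are [x'_l] on the first factor and, up to a torus element,
   [y''_l] on the second one. *)
Definition hgt1 (i : dI D) : int :=
  if (i : 'I_m.+1) == 0%N :> nat then (m *+ 2 + 1)%N%:Z
  else if (i : 'I_m.+1) == 1%N :> nat then 0 else 1.
Definition hgt2 (i : dI D) : int := if (i : 'I_m.+1) == 1%N :> nat then m%:Z else 0.

(** With cyclic sources [E_0] moves a quantum from coordinate [m] to coordinate 0. Weights drop the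
    coefficient of delta, as in an evaluation module. *)
Definition afosc b (d : dI D -> int) : ugen D -> A :=
  @rowosc k q D m (@af_src m) id (fun mu : QAf m => (sval mu).1) b d.

Lemma afosc_urep b d : urep q (afosc b d).
Proof.
apply: osc_urep => //.
- exact: af_src_inj.
- by move=> i; apply: af_src_neq; apply: ltnW.
- exact: af_pairE.
- exact: af_alphaE.
- by move=> mu la; apply/ffunP => j; rewrite !ffunE mul1r.
- by move=> mu; apply/ffunP => j; rewrite !ffunE add0r mulN1r.
- by move=> p i; rewrite rowD row_rsh eqxx.
Qed.

Let g1 := afosc false hgt1.
Let g2 := afosc true hgt2.
Let g := ucomb g1 g2.

Lemma aff_comb_urep : urep q g.
Proof.
apply: (urep_comb q0 (DAf_ok m1)); try exact: afosc_urep.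
exact: rowosc_comm.
Qed.

Let u1 : urep q g1. Proof. exact: afosc_urep. Qed.
Let u2 : urep q g2. Proof. exact: afosc_urep. Qed.
Let dok := DAf_ok m1.

Let E1 j : A := afE g1 j.
Let E2 j : A := afE g2 j.
Let kap j : A := g1 (UK (dopp (dalpha (inord j : dI D)))).
Let e2 j : A := kap j * E2 j.
Let X1 := chain q (fun j => E1 j.+1).
Let X2 := chain q (fun j => E2 j.+1).
Let Z := chain q (fun j => e2 j.+1).
Let X := chain q (fun j => afE g j.+1).

Let afE_comb j : afE g j = e2 j + E1 j. Proof. by []. Qed.

Let c12 a b : g1 a * g2 b = g2 b * g1 a. Proof. exact: rowosc_comm. Qed.

(** For such operators the torus factors [kap] of the first tensor factor can be pulled out of
    brackets, which reduces [Z] and the second row to root vectors of the second oscillator. *)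
Let torus_free (v : A) := forall mu, v * g1 (UK mu) = g1 (UK mu) * v.

Let tf_br u v : torus_free u -> torus_free v -> torus_free (br q u v).
Proof. by move=> tu tv mu; apply: br_comm. Qed.

Let tf_E2 j : torus_free (E2 j). Proof. by move=> mu; rewrite /E2 /afE c12. Qed.

Let tf_chain (e : nat -> A) l : (forall j, torus_free (e j)) -> torus_free (chain q e l).
Proof. by move=> te; elim: l => [|l IH]; [apply: te | apply: tf_br]. Qed.

Let torus_br mu la u v : torus_free u -> torus_free v ->
  br q (g1 (UK mu) * u) (g1 (UK la) * v) = g1 (UK (dadd mu la)) * br q u v.
Proof.
move=> tu tv; rewrite -(ur_KKE u1).
have h1 := tu mu; have h2 := tu la; have h3 := tv mu; have h4 := tv la.
have h5 := urep_KC dok u1 mu la.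
by rewrite /br; ncfield k (A : algType k) (h1, h2, h3, h4, h5).
Qed.

Let ZE l : exists mu, Z l = g1 (UK mu) * X2 l.
Proof.
elim: l => [|l [mu IH]]; first by exists (dopp (dalpha (inord 1 : dI D))).
exists (dadd mu (dopp (dalpha (inord l.+2 : dI D)))).
rewrite [Z l.+1]/(br q (Z l) (e2 l.+2)) IH.
by apply: torus_br => //; apply: tf_chain => j.
Qed.

Let G2 := br q (e2 1) (e2 0).
Let ey j := if j is 0 then br q (Z m.-1) G2 else e2 j.+1.

Let G2E : exists mu, G2 = g1 (UK mu) * br q (E2 1) (E2 0).
Proof. by eexists; apply: torus_br. Qed.

Let YE l : exists mu, chain q ey l = g1 (UK mu) * chain q (af_ey q g2) l.
Proof.
have tG : torus_free (br q (E2 1) (E2 0)) by apply: tf_br.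
have tX : torus_free (X2 m.-1) by apply: tf_chain => j.
elim: l => [|l [mu IH]].
  have [mu ZmE] := ZE m.-1; have [la GE] := G2E; exists (dadd mu la).
  by rewrite [LHS]/= ZmE GE; apply: torus_br.
exists (dadd mu (dopp (dalpha (inord l.+2 : dI D)))).
rewrite [LHS]/(br q (chain q ey l) (e2 l.+2)) IH; apply: torus_br => //.
by apply: tf_chain => -[|j]; [exact: (tf_br tX tG) | exact: tf_E2].
Qed.

Let h1v j : (j.+2 <= m)%N -> hgt1 (inord j.+2) = 1.
Proof. by move=> jm; rewrite /hgt1 inordK. Qed.

Let h21 : hgt2 (inord 1) = m.
Proof. by rewrite /hgt2 inordK ?ltnS ?(ltnW m1). Qed.
Let h10 : hgt1 (inord 0) = (m *+ 2 + 1)%N.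
Proof. by rewrite /hgt1 inordK. Qed.

Local Notation F := (Fil (@ht m)).
Let htD' := @htD m.

Let Fil_E1 j : F (hgt1 (inord j)) (E1 j).
Proof. by apply: (Fil_wshift htD'); rewrite ht_rsh. Qed.

Let Fil_kap mu : F 0 (g1 (UK mu)).
Proof. exact: (Fil_wshift htD'). Qed.

Let Fil_e2 j : F (hgt2 (inord j)) (e2 j).
Proof.
rewrite -[hgt2 _]add0r; apply: Fil_mul; first exact: Fil_kap.
by apply: (Fil_wshift htD'); rewrite ht_rsh.
Qed.

Let hgt1_ge0 i : 0 <= hgt1 i. Proof. by rewrite /hgt1; case: eqP => // _; case: eqP. Qed.
Let hgt2_ge0 i : 0 <= hgt2 i. Proof. by rewrite /hgt2; case: eqP. Qed.

Let Fil_E j : F 0 (afE g j).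
Proof.
rewrite afE_comb; apply: Fil_add.
  by refine (Fil_le _ (@Fil_e2 j)).
by refine (Fil_le _ (@Fil_E1 j)).
Qed.

Let Fil_chain n (e : nat -> A) l : F n (e 0%N) -> (forall j, (j < l)%N -> F 0 (e j.+1)) ->
  F n (chain q e l).
Proof.
move=> Fe0; elim: l => [|l IH] Fe //=; rewrite -[n]addr0; apply: Fil_br.
  by apply: IH => j jl; apply: Fe; apply: leqW.
exact: Fe.
Qed.

Let Fil_X l : F 0 (X l). Proof. by apply: Fil_chain => // *; apply: Fil_E. Qed.

Let Fil_Z l : F m (Z l).
Proof.
apply: Fil_chain => [|j jl]; last by refine (Fil_le _ (@Fil_e2 j.+2)).
by have := @Fil_e2 1; rewrite h21.
Qed.

Let X1_kap l : (l.+1 < m)%N -> kap l.+2 * X1 l = q *: (X1 l * kap l.+2).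
Proof.
move=> lm; have h := K_chain q0 q2 qm m1 u1 (dopp (dalpha (inord l.+2 : dI D))) (ltnW lm).
rewrite /X1 /kap h !opp_coord !(alpha_coord q0 q2 qm m1) //; try lia.
have -> : (0%N == l.+1) = false by lia.
have -> : (0%N == l.+2) = false by lia.
have -> : (l.+1 == l.+2) = false by lia.
by rewrite eqxx; congr (_ *: _); exact: expr1z.
Qed.

Let X1_E2 l j : X1 l * E2 j = E2 j * X1 l.
Proof. by elim: l => [|l IH]; [apply: c12 | apply: br_comm => //; apply: c12]. Qed.

(** Commuting the torus part of [e2] past [X1] produces a factor [q], which cancels the [q^-1] of
    the bracket. *)
Let X1_e2 l : (l.+1 < m)%N -> br q (X1 l) (e2 l.+2) = 0.
Proof.
move=> lm; have h1 := X1_kap lm; have h2 := esym (X1_E2 l l.+2).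
by rewrite /br /e2; set x := X1 l in h1 h2 *; ncfield k (A : algType k) (h1, h2).
Qed.

(** Expanding the brackets, a word that leaves the first factor after starting there vanishes by
    [X1_e2]. A mixed word starting with [e2 1] has height [m] from its first letter and at least 1
    more from a letter [E1 j] with [j > 1]. *)
Let X_lead l : (l < m)%N -> F (m%:Z + 1) (X l - X1 l - Z l).
Proof.
elim: l => [|l IH] lm.
  by rewrite [X 0]/(e2 1 + E1 1) [Z 0]/(e2 1) [X1 0]/(E1 1) addrK subrr; apply: Fil0.
have -> : X l.+1 - X1 l.+1 - Z l.+1 = br q (X l - X1 l - Z l) (afE g l.+2) +
   br q (Z l) (E1 l.+2) + br q (X1 l) (e2 l.+2).
  rewrite [X l.+1]/(br q (X l) (afE g l.+2)) afE_comb.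
  rewrite [X1 l.+1]/(br q (X1 l) (E1 l.+2)) [Z l.+1]/(br q (Z l) (e2 l.+2)) /br.
  set a := X l; set b := X1 l; set c := Z l; set d := e2 l.+2; set e := E1 l.+2.
  by ncring k (A : algType k) tt.
rewrite X1_e2 // addr0; apply: Fil_add.
  by rewrite -[_ + 1]addr0; apply: Fil_br; [apply: IH; lia | apply: Fil_E].
by apply: Fil_br; [apply: Fil_Z | have := @Fil_E1 l.+2; rewrite h1v].
Qed.

Let G := br q (afE g 1) (afE g 0).

Let alpha01 : dpair (@dalpha D (inord 0)) (@dalpha D (inord 1)) = -1.
Proof. by rewrite (af_cartanE q0 q2 qm m1) // ltnW. Qed.

Let kap0_E1 : kap 0 * E1 1 = q *: (E1 1 * kap 0).
Proof. by rewrite /kap /E1 /afE (ur_KEE u1) (dok_pairN dok) alpha01 expr1z. Qed.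

Let E1_e20 : br q (E1 1) (e2 0) = 0.
Proof.
have h1 := kap0_E1; have h2 : E2 0 * E1 1 = E1 1 * E2 0 by apply/esym/c12.
by rewrite /br /e2; ncfield k (A : algType k) (h1, h2).
Qed.

(** The term with [E_0] on the first factor is discarded by its height [2 m + 1], and the term with
    [E1 1] and [e2 0] is a vanishing bracket. *)
Let G_lead : F (m *+ 2 + 1)%N (G - G2).
Proof.
have -> : G - G2 = br q (afE g 1) (E1 0) + br q (E1 1) (e2 0).
  rewrite /G /G2 !afE_comb /br; set a := e2 1; set b := E1 1; set c := e2 0; set d := E1 0.
  by ncring k (A : algType k) tt.
rewrite E1_e20 addr0 -[Posz _]add0r; apply: Fil_br; first exact: Fil_E.
by have := @Fil_E1 0; rewrite h10.
Qed.

Let Fil_G2 : F m G2.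
Proof.
rewrite -[Posz m]addr0; apply: Fil_br.
  by have := @Fil_e2 1; rewrite h21.
exact: (Fil_le _ (@Fil_e2 0)).
Qed.

Let alpha0_coord j : (j <= m)%N ->
  (sval (@dalpha D (inord 0))).1 (inord j) = (j == m)%:Z - (j == 0%N)%:Z.
Proof.
by move=> jm; rewrite [sval _]/= af_alphaE vrootE -!val_eqE /= af_srcE /= !inordK.
Qed.

(** The torus parts of [e2 1] and [e2 0] contribute [q^-1] and [q^2], so moving [G2] past [X1] again
    costs exactly the [q] that cancels the bracket. *)
Let X1_G2 : br q (X1 m.-1) G2 = 0.
Proof.
have mP : m.-1.+1 = m by lia.
have lm : (m.-1 < m)%N by lia.
have h1 := K_chain q0 q2 qm m1 u1 (dopp (dalpha (inord 1 : dI D))) lm.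
have h0 := K_chain q0 q2 qm m1 u1 (dopp (dalpha (inord 0 : dI D))) lm.
rewrite !opp_coord mP !alpha0_coord // !eqxx in h0.
rewrite !opp_coord mP !(@alpha_coord k q m q0 q2 qm m1 0) ?(ltnW m1) // in h1.
have m0 : (m == 0%N) = false by lia.
have m1' : (m == 1%N) = false by lia.
have m0' : (0%N == m) = false by lia.
rewrite m0 m0' in h0; rewrite m0 m1' in h1.
have {}h1 : kap 1 * X1 m.-1 = q^-1 *: (X1 m.-1 * kap 1) by rewrite -expzN1.
have {}h0 : kap 0 * X1 m.-1 = q ^+ 2 *: (X1 m.-1 * kap 0) by [].
have h2 := esym (X1_E2 m.-1 0); have h3 := esym (X1_E2 m.-1 1).
have h4 : E2 1 * kap 0 = kap 0 * E2 1 by apply: tf_E2.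
have h5 : E2 0 * kap 1 = kap 1 * E2 0 by apply: tf_E2.
have h6 : E2 0 * kap 0 = kap 0 * E2 0 by apply: tf_E2.
have h7 : E2 1 * kap 1 = kap 1 * E2 1 by apply: tf_E2.
have h8 : kap 1 * kap 0 = kap 0 * kap 1 by apply: (urep_KC dok u1).
rewrite /G2 /br /e2; set x := X1 _ in h1 h0 h2 h3 *.
by ncfield k (A : algType k) (h0, h1, h2, h3, h4, h5, h6, h7, h8).
Qed.

Let Y := chain q (af_ey q g).

(** The kept part has height [2 m], half from [Z] and half from [G2]. Everything discarded has one
    more: the remainder of [X_lead] gives [(m + 1) + m], [G_lead] gives [2 m + 1], and a later
    [E1 j] adds 1. *)
Let Y_lead l : (l < m)%N -> F (m *+ 2 + 1)%N (Y l - chain q ey l).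
Proof.
elim: l => [|l IH] lm.
  have -> : Y 0 - chain q ey 0 = br q (X m.-1 - X1 m.-1 - Z m.-1) G2 +
      br q (X m.-1) (G - G2) + br q (X1 m.-1) G2.
    rewrite [Y 0]/(br q (X m.-1) G) [chain q ey 0]/(br q (Z m.-1) G2) /br.
    set a := X m.-1; set b := X1 m.-1; set c := Z m.-1; set d := G2; set e := G.
    by ncring k (A : algType k) tt.
  rewrite X1_G2 addr0; apply: Fil_add.
    apply: (@Fil_le _ _ _ ((m%:Z + 1) + m%:Z)); first lia.
    by apply: Fil_br; [apply: X_lead; lia | apply: Fil_G2].
  by rewrite -[Posz _]add0r; apply: Fil_br; [apply: Fil_X | apply: G_lead].
have -> : Y l.+1 - chain q ey l.+1 = br q (Y l - chain q ey l) (afE g l.+2) +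
    br q (chain q ey l) (E1 l.+2).
  rewrite [Y l.+1]/(br q (Y l) (afE g l.+2)) afE_comb.
  rewrite [chain q ey l.+1]/(br q (chain q ey l) (e2 l.+2)) /br.
  set a := Y l; set b := chain q ey l; set c := e2 l.+2; set d := E1 l.+2.
  by ncring k (A : algType k) tt.
apply: Fil_add.
  by rewrite -[Posz _]addr0; apply: Fil_br; [apply: IH; lia | apply: Fil_E].
apply: (@Fil_le _ _ _ ((m%:Z + m%:Z) + 1)); first lia.
apply: Fil_br; last by have := @Fil_E1 l.+2; rewrite h1v.
apply: Fil_chain => [|j jl]; last by refine (Fil_le _ (@Fil_e2 j.+2)).
by apply: Fil_br; [apply: Fil_Z | apply: Fil_G2].
Qed.

Let sh b (d : dI D -> int) (j : nat) : I := rsh b (- vroot (c j) (c j.+1)) (d (inord j.+1)).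
Let sh0 : I := rsh true (- vroot (c m) (c 0)) (hgt2 (inord 0)).

Let cr_sh b d p j : (j < m)%N -> row b (p + sh b d j) = row b p - vroot (c j) (c j.+1).
Proof. by move=> _; rewrite rowD row_rsh eqxx. Qed.
Let cr_sh0 p : row true (p + sh0) = row true p - vroot (c m) (c 0).
Proof. by rewrite rowD row_rsh. Qed.

Let Eosc b d j := wshift (fun p => qint q (row b p (c j))) (sh b d j).

Let afE_osc b d j : (j < m)%N -> afE (afosc b d) j.+1 = Eosc b d j.
Proof.
move=> jm; have srcE : af_src (inord j.+1) = c j.
  by apply: val_inj; rewrite /= af_srcE !inordK //; lia.
by apply: eq_wshift => [p|]; rewrite /= srcE.
Qed.

Let afE0_osc : afE g2 0 = wshift (fun p => qint q (row true p (c m))) sh0.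
Proof.
have srcE : af_src (inord 0) = c m.
  by apply: val_inj; rewrite /= af_srcE !inordK //; lia.
by apply: eq_wshift => [p|]; rewrite /= srcE.
Qed.

Let chain_osc b d l : (l < m)%N ->
  chain q (fun j => afE (afosc b d) j.+1) l = chain q (Eosc b d) l.
Proof. by move=> lm; apply: eq_chain => j jl; apply: afE_osc; lia. Qed.

Let row_good b (p : I) : good p -> row b p (c 0) != 0.
Proof. by move=> /andP[]; case: b; lia. Qed.

Let sum_hgt1 l : (l < m)%N -> \sum_(j < l.+1) hgt1 (inord j.+1) = l.
Proof.
move=> lm; rewrite big_ord_recl [X in X + _](_ : _ = 0); last first.
  by rewrite /hgt1 /= inordK // ltnS ltnW.
rewrite (eq_bigr (fun _ => 1)) => [|j _].
  by rewrite sumr_const card_ord add0r; lia.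
by have := ltn_ord j; rewrite lift0 => jm; apply: h1v; lia.
Qed.

(** The height [l < m] of [X1 l] lies below the height [m] of [Z l], so the first factor leads. *)
Lemma affine_lead_x l : (l < m)%N -> lead (@ht m) (@good m) (X l) (vsh m false l l).
Proof.
move=> lm; split=> [p|]; first exact: good_vsh.
exists (xw q (row false) l) => [p gp|]; first by apply: (xw_neq0 q0 qm q_free); apply: row_good.
have <- : X1 l = wshift (xw q (row false) l) (vsh m false l l).
  rewrite [X1 l](chain_osc _ _ lm) (osc_chain q0 qm (@cr_sh false hgt1) lm).
  apply: eq_wshift => //; rewrite /xsh /sh.
  by rewrite (@sum_vsh m false (fun j => hgt1 (inord j.+1))) // sum_hgt1.
rewrite ht_rsh -[X l - X1 l](subrK (Z l)); apply: Fil_add.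
  by refine (Fil_le _ (X_lead lm)); lia.
by refine (Fil_le _ (Fil_Z l)); lia.
Qed.

Let h2v j : (0 < j < m)%N -> hgt2 (inord j.+1) = 0.
Proof. by move=> jm; rewrite /hgt2 inordK; [case: eqP; lia | lia]. Qed.

Let ysh_vsh l : (l < m)%N -> ysh m (sh true hgt2) sh0 l = vsh m true l (m *+ 2)%N.
Proof.
elim: l => [|l IH] lm.
  have mP : m.-1.+1 = m by lia.
  have sm : \sum_(j < m.-1.+1) hgt2 (inord j.+1) = m.
    rewrite big_ord_recl h21 big1 ?addr0 // => j _.
    by have := ltn_ord j; rewrite lift0 => jm; apply: h2v; lia.
  have h20 : hgt2 (inord 0) = 0 by rewrite /hgt2 inordK.
  rewrite /ysh big_ord0 addr0 /xsh /sh.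
  rewrite (@sum_vsh m true (fun j => hgt2 (inord j.+1))); last lia.
  rewrite sm /vsh /sh0 !rshD mP h20 h21; congr (rsh true _ _); last by lia.
  by apply/ffunP => j; rewrite !ffunE; ring.
rewrite yshS IH ?(ltnW lm) // /vsh /sh rshD h2v ?addr0; last lia.
by congr (rsh true _ _); apply/ffunP => j; rewrite !ffunE; ring.
Qed.

Lemma affine_lead_y l : (l < m)%N -> lead (@ht m) (@good m) (Y l) (vsh m true l (m *+ 2)%N).
Proof.
move=> lm; split=> [p|]; first exact: good_vsh.
have [mu YmuE] := YE l.
pose w p := q ^ (\sum_j (sval mu).1 j * row false p j) * yw q (row true) l p.
exists w => [p gp|].
  by apply: mulf_neq0; [apply: expfz_neq0 | apply: (yw_neq0 q0 qm q_free); apply: row_good].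
have <- : chain q ey l = wshift w (vsh m true l (m *+ 2)%N).
  rewrite YmuE.
  have -> : chain q (af_ey q g2) l = wshift (yw q (row true) l) (vsh m true l (m *+ 2)%N).
    rewrite -ysh_vsh // -(osc_ychain q0 qm (@cr_sh true hgt2) cr_sh0 m1 lm).
    apply: eq_chain => -[_|j jl]; last by apply: afE_osc; lia.
    rewrite /af_ey /af_y0 /afG afE0_osc chain_osc; last lia.
    by rewrite -/g2 [afE g2 1]afE_osc // ltnW.
  rewrite [g1 _]/(wshift _ 0) wshift_mul; apply: eq_wshift => [p|]; last by rewrite add0r.
  by rewrite addr0.
by rewrite ht_rsh; apply: Y_lead.
Qed.

Lemma affine_indep (r : seq (k * (seq nat * seq nat))) :
  all (key_ok m) (map snd r) ->
  \sum_(t <- r) t.1 *: mono X Y t.2 = 0 -> forall u, coef_of r u = 0.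
Proof.
move=> okr; apply: (@two_row_indep k m _ _ (fun l => l%:Z) (fun _ => (m *+ 2)%N%:Z)) => // l lm.
  exact: affine_lead_x.
exact: affine_lead_y.
Qed.

End AffineIndependence.

(** * Straightening *)

Section Straightening.
Variables (k : fieldType) (q : k) (m : nat).
Hypothesis q0 : q != 0.
Local Notation small := (all (fun i => i < m)%N).

Definition tworow_gen (R : Type) (x y : nat -> R) (a : bool * 'I_m) : R :=
  if a.1 then y a.2 else x a.2.

(** An expression is taken over all algebras at once: straightening coefficients that do not depend
    on the algebra are what allows relations to be transferred from one side to the other. *)
Definition uexpr := forall A : algType k, (nat -> A) -> (nat -> A) -> A.

Definition key_sum (r : seq (k * (seq nat * seq nat))) : uexpr :=
  fun A x y => \sum_(t <- r) t.1 *: mono x y t.2.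

Definition spanned (ok : seq nat * seq nat -> bool) (u : uexpr) :=
  exists2 r, all ok (map snd r) &
  forall (A : algType k) (x y : nat -> A), tworow_rel q m x y -> u A x y = key_sum r x y.

Definition small_key (t : seq nat * seq nat) := small t.1 && small t.2.

Lemma spanned_ext ok (u v : uexpr) : spanned ok v ->
  (forall (A : algType k) (x y : nat -> A), tworow_rel q m x y -> u A x y = v A x y) ->
  spanned ok u.
Proof. by move=> [r okr rE] uv; exists r => // A x y xy; rewrite uv // rE. Qed.

Lemma spanned_add ok (u v : uexpr) : spanned ok u -> spanned ok v ->
  spanned ok (fun A x y => u A x y + v A x y).
Proof.
move=> [r okr rE] [s oks sE]; exists (r ++ s); first by rewrite map_cat all_cat okr.
by move=> A x y xy; rewrite rE // sE // /key_sum big_cat.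
Qed.

Lemma spanned_scale ok c (u : uexpr) : spanned ok u -> spanned ok (fun A x y => c *: u A x y).
Proof.
move=> [r okr rE]; exists [seq (c * t.1, t.2) | t <- r]; first by rewrite -map_comp.
move=> A x y xy; rewrite rE // /key_sum big_map scaler_sumr.
by apply: eq_bigr => t _; rewrite scalerA.
Qed.

Lemma spanned_mono (ok : seq nat * seq nat -> bool) t :
  ok t -> spanned ok (fun A x y => mono x y t).
Proof.
move=> okt; exists [:: (1, t)]; first by rewrite /= okt.
by move=> A x y _; rewrite /key_sum big_seq1 scale1r.
Qed.

Lemma spanned_zero ok : spanned ok (fun A x y => 0).
Proof. by exists [::] => // A x y _; rewrite /key_sum big_nil. Qed.

Lemma spanned_lin (ok ok' : seq nat * seq nat -> bool) (u : uexpr) (f : forall A : algType k, (nat -> A) -> (nat -> A) -> A -> A) :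
  (forall (A : algType k) (x y : nat -> A) a b, f A x y (a + b) = f A x y a + f A x y b) ->
  (forall (A : algType k) (x y : nat -> A) c a, f A x y (c *: a) = c *: f A x y a) ->
  (forall t, ok t -> spanned ok' (fun A x y => f A x y (mono x y t))) ->
  spanned ok u -> spanned ok' (fun A x y => f A x y (u A x y)).
Proof.
move=> fD fZ ft [r okr rE].
apply: (@spanned_ext _ _ (fun A x y => f A x y (key_sum r x y))); last first.
  by move=> A x y xy; rewrite rE.
elim: r okr {rE} => [_|[c t] r IH /andP[/= okt okr]].
  apply: spanned_ext (spanned_zero _) _ => A x y _; rewrite /key_sum big_nil.
  by rewrite -[X in f A x y X](scale0r 0) fZ scale0r.
apply: spanned_ext (spanned_add (spanned_scale c (ft t okt)) (IH okr)) _.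
by move=> A x y _; rewrite /key_sum big_cons fD fZ.
Qed.

(** When [j < i], the correction term exchanges the indices between the rows, so the letter that
    continues is [y j]; as the induction is on the word with the index arbitrary, both continuations
    are covered. *)
Lemma y_move w : forall i, (i < m)%N -> small w ->
  exists2 r : seq (k * (seq nat * nat)), all (fun t => small t.2.1 && (t.2.2 < m)%N) r &
  forall (A : algType k) (x y : nat -> A), tworow_rel q m x y ->
    y i * \prod_(j <- w) x j = \sum_(t <- r) t.1 *: (\prod_(j <- t.2.1) x j * y t.2.2).
Proof.
elim: w => [|j w IH] i im /=.
  by move=> _; exists [:: (1, ([::], i))]; rewrite /= ?im // => A x y _;
    rewrite big_seq1 !big_nil scale1r mulr1 mul1r.
case/andP=> jm wm; have [r okr rE] := IH i im wm.
have cons_ok a (s : seq (k * (seq nat * nat))) c : (a < m)%N ->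
    all (fun t => small t.2.1 && (t.2.2 < m)%N) s ->
    all (fun t => small t.2.1 && (t.2.2 < m)%N) [seq (c * t.1, (a :: t.2.1, t.2.2)) | t <- s].
  by move=> am oks; rewrite all_map; apply/allP => t /(allP oks) /=; rewrite am.
have cons_sum (A : algType k) (x y : nat -> A) a (s : seq (k * (seq nat * nat))) c :
    \sum_(t <- [seq (c * t.1, (a :: t.2.1, t.2.2)) | t <- s])
      t.1 *: (\prod_(j <- t.2.1) x j * y t.2.2) =
    c *: (x a * \sum_(t <- s) t.1 *: (\prod_(j <- t.2.1) x j * y t.2.2)).
  rewrite big_map mulr_sumr scaler_sumr; apply: eq_bigr => t _.
  by rewrite /= big_cons -scalerAr scalerA mulrA.
case: (ltngtP i j) => ij.
- exists [seq (q^-1 * t.1, (j :: t.2.1, t.2.2)) | t <- r]; first exact: cons_ok.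
  move=> A x y xy; rewrite cons_sum -rE // big_cons mulrA.
  have := tr_xy_gt xy (i := i) (j := j); rewrite ij jm => /(_ isT) h.
  by rewrite [x j * _]mulrA h -scalerAl scalerA mulVf // scale1r.
- have [s oks sE] := IH j jm wm.
  exists ([seq (q^-1 * t.1, (j :: t.2.1, t.2.2)) | t <- r] ++
          [seq (- (q^-1 * (q - q^-1)) * t.1, (i :: t.2.1, t.2.2)) | t <- s]).
    by rewrite all_cat !cons_ok.
  move=> A x y xy; rewrite big_cat /= !cons_sum -rE // -sE // big_cons mulrA.
  have := tr_xy_lt xy (i := j) (j := i); rewrite ij im => /(_ isT) h.
  rewrite !mulrA h; set W := \prod_(_ <- _) _; set a := y i; set b := x j; set c := x i; set d := y j.
  by ncfield k A tt.
- exists [seq (q ^- 2 * t.1, (j :: t.2.1, t.2.2)) | t <- r]; first exact: cons_ok.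
  move=> A x y xy; rewrite cons_sum -rE // big_cons mulrA -ij.
  have h := tr_xy_eq xy im.
  by rewrite [x i * _]mulrA h -scalerAl scalerA mulVf ?expf_neq0 // scale1r.
Qed.

Lemma spanned_gen (g : bool * 'I_m) (u : uexpr) : spanned small_key u ->
  spanned small_key (fun A x y => tworow_gen x y g * u A x y).
Proof.
apply: (@spanned_lin _ _ u (fun A x y a => tworow_gen x y g * a)).
- by move=> *; rewrite mulrDr.
- by move=> *; rewrite scalerAr.
case: g => [[] i] [w v] /andP[/= wm vm]; rewrite /tworow_gen /=; last first.
  apply: spanned_ext (@spanned_mono small_key ((i : nat) :: w, v) _) _.
    by rewrite /small_key /= ltn_ord wm.
  by move=> A x y _; rewrite /mono /= big_cons mulrA.
have [r okr rE] := y_move (ltn_ord i) wm.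
exists [seq (t.1, (t.2.1, t.2.2 :: v)) | t <- r].
  rewrite -map_comp all_map; apply/allP => t /(allP okr) /andP[t1 t2].
  by rewrite /small_key /= t1 t2.
move=> A x y xy; rewrite /mono /= mulrA rE // mulr_suml /key_sum big_map.
by apply: eq_bigr => t _; rewrite -scalerAl /mono /= big_cons mulrA.
Qed.

Lemma spanned_mul (P : fterm k (bool * 'I_m)) : forall u : uexpr, spanned small_key u ->
  spanned small_key (fun A x y => aeval (tworow_gen x y) P * u A x y).
Proof.
elim: P => [g|c|P IHP Q IHQ|P IHP Q IHQ] u su.
- exact: spanned_gen.
- apply: spanned_ext (spanned_scale c su) _ => A x y _; exact: mulr_algl.
- apply: spanned_ext (spanned_add (IHP _ su) (IHQ _ su)) _ => A x y _.
  by rewrite aevalD mulrDl.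
- apply: spanned_ext (IHP _ (IHQ _ su)) _ => A x y _.
  by rewrite aevalM mulrA.
Qed.

Lemma spanned_words (P : fterm k (bool * 'I_m)) :
  spanned small_key (fun A x y => aeval (tworow_gen x y) P).
Proof.
apply: spanned_ext (spanned_mul P (@spanned_mono small_key ([::], [::]) isT)) _.
by move=> A x y _; rewrite /mono !big_nil !mulr1.
Qed.

Fixpoint insert_letter (i : nat) (w : seq nat) : seq nat :=
  if w is j :: w' then if (i <= j)%N then i :: w else j :: insert_letter i w' else [:: i].

Lemma insert_letter_perm i w : perm_eq (insert_letter i w) (i :: w).
Proof.
elim: w => //= j w IH; case: leqP => // _.
by rewrite perm_sym (perm_catCA [:: i] [:: j] w) /= perm_cons perm_sym.
Qed.

Lemma insert_letter_sorted i w : sorted leq w -> sorted leq (insert_letter i w).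
Proof.
have tr : transitive leq := leq_trans.
elim: w => //= j w IH sw; case: leqP => [ij|ji] /=; first by rewrite ij.
move: sw; rewrite (path_sortedE tr) => /andP[jw sw].
rewrite (path_sortedE tr) IH // andbT (perm_all _ (insert_letter_perm i w)) /=.
by rewrite (ltnW ji).
Qed.

Lemma insert_letter_prod i w : (i < m)%N -> small w ->
  exists c : k, forall (A : algType k) (z : nat -> A),
    (forall i j, (i < j < m)%N -> z i * z j = q *: (z j * z i)) ->
    z i * \prod_(j <- w) z j = c *: \prod_(j <- insert_letter i w) z j.
Proof.
move=> im; elim: w => /= [_|j w IH /andP[jm wm]].
  by exists 1 => A z _; rewrite scale1r big_seq1 big_nil mulr1.
case: leqP => [ij|ji]; first by exists 1 => A z _; rewrite scale1r !big_cons.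
have [c cE] := IH wm; exists (q^-1 * c) => A z zz.
have h : z j * z i = q *: (z i * z j) by apply: zz; rewrite ji.
rewrite !big_cons -scalerA scalerAr -cE // !mulrA h -scalerAl scalerA mulVf //.
by rewrite scale1r.
Qed.

Lemma sort_word w : small w -> exists2 v, small v && sorted leq v &
  exists c : k, forall (A : algType k) (z : nat -> A),
    (forall i j, (i < j < m)%N -> z i * z j = q *: (z j * z i)) ->
    \prod_(j <- w) z j = c *: \prod_(j <- v) z j.
Proof.
elim: w => [_|i w IH /= /andP[im wm]].
  by exists [::] => //; exists 1 => A z _; rewrite scale1r.
have [v /andP[vm sv] [c cE]] := IH wm.
have [d dE] := insert_letter_prod im vm.
exists (insert_letter i v).
  by rewrite (perm_all _ (insert_letter_perm i v)) /= im vm insert_letter_sorted.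
by exists (c * d) => A z zz; rewrite big_cons cE // -scalerAr dE // scalerA.
Qed.

(** [spanned_words] already puts the first row before the second. Inside a row letters q-commute, so
    sorting costs only a scalar. *)
Theorem straighten (P : fterm k (bool * 'I_m)) :
  spanned (key_ok m) (fun A x y => aeval (tworow_gen x y) P).
Proof.
apply: (@spanned_lin small_key (key_ok m) _ (fun A x y a => a)) (spanned_words P) => //.
move=> [w v] /andP[/= wm vm].
have [w' /andP[w'm sw] [c cE]] := sort_word wm.
have [v' /andP[v'm sv] [d dE]] := sort_word vm.
apply: spanned_ext (spanned_scale (c * d) (@spanned_mono (key_ok m) (w', v') _)) _.
  by rewrite /key_ok /= w'm v'm sw sv.
move=> A x y xy; rewrite /mono /= (cE _ _ (tr_xx xy)) (dE _ _ (tr_yy xy)).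
by rewrite -scalerAl -scalerAr scalerA.
Qed.

End Straightening.

(** * The smash product *)

Section TensorSquare.
Variables (k : fieldType) (G : Type) (rel : fterm k G -> fterm k G -> Prop).
Hypothesis cons : ~ feq rel (FC 1) (FC 0).
Local Notation U := (fquot cons).
Local Notation pi := (fpi cons).

Definition tquot of ~ feq rel (FC 1) (FC 0) := cquot (teq rel).
Local Notation TT := (tquot cons).

HB.instance Definition _ := gen_eqMixin TT.
HB.instance Definition _ := gen_choiceMixin TT.

Definition tpi (x : tterm k G) : TT := cpi (teq rel) x.
Definition trepr (u : TT) : tterm k G := crepr u.

Lemma tpiP x y : tpi x = tpi y <-> teq rel x y.
Proof.
exact: (cpiP (@teq_refl _ _ rel) (@teq_sym _ _ rel) (@teq_trans _ _ rel)).
Qed.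

Lemma treprK u : tpi (trepr u) = u. Proof. exact: creprK. Qed.
Lemma trepr_pi x : teq rel (trepr (tpi x)) x. Proof. by apply/tpiP; rewrite treprK. Qed.
Lemma tquotP (P : TT -> Prop) : (forall x, P (tpi x)) -> forall u, P u.
Proof. by move=> h u; rewrite -(treprK u). Qed.

Let tadd (u v : TT) : TT := tpi (TAdd (trepr u) (trepr v)).
Let tscal (c : k) (v : TT) : TT := tpi (TScal c (trepr v)).

Let taddE x y : tadd (tpi x) (tpi y) = tpi (TAdd x y).
Proof. by apply/tpiP; apply: teq_addc; apply: trepr_pi. Qed.
Let tscalE c x : tscal c (tpi x) = tpi (TScal c x).
Proof. by apply/tpiP; apply: teq_scalc; apply: trepr_pi. Qed.

Let taddA : associative tadd.
Proof.
by elim/tquotP => x; elim/tquotP => y; elim/tquotP => z; rewrite !taddE; apply/tpiP; apply: teq_addA.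
Qed.
Let taddC : commutative tadd.
Proof. by elim/tquotP => x; elim/tquotP => y; rewrite !taddE; apply/tpiP; apply: teq_addC. Qed.
Let tadd0 : left_id (tpi TZero) tadd.
Proof. by elim/tquotP => x; rewrite !taddE; apply/tpiP; apply: teq_add0. Qed.
Let taddN : left_inverse (tpi TZero) (tscal (-1)) tadd.
Proof. by elim/tquotP => x; rewrite taddC tscalE taddE; apply/tpiP; apply: teq_addN. Qed.
HB.instance Definition _ := @GRing.isZmodule.Build TT (tpi TZero) (tscal (-1)) tadd
  taddA taddC tadd0 taddN.

Let tscalA a b v : tscal a (tscal b v) = tscal (a * b) v.
Proof. by elim/tquotP: v => x; rewrite !tscalE; apply/tpiP; apply: teq_scalA. Qed.
Let tscal1 : left_id 1 tscal.
Proof. by elim/tquotP => x; rewrite tscalE; apply/tpiP; apply: teq_scal1. Qed.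
Let tscalDr : right_distributive tscal +%R.
Proof.
move=> c; elim/tquotP => x; elim/tquotP => y.
by rewrite [_ + _]taddE !tscalE [RHS]taddE; apply/tpiP; apply: teq_scalDr.
Qed.
Let tscalDl v : {morph tscal^~ v : a b / a + b}.
Proof.
move=> a b; elim/tquotP: v => x; rewrite !tscalE [RHS]taddE.
by apply/tpiP; apply: teq_scalDl.
Qed.
HB.instance Definition _ := @GRing.Zmodule_isLmodule.Build k TT tscal
  tscalA tscal1 tscalDr tscalDl.

Lemma tpiD x y : tpi (TAdd x y) = tpi x + tpi y. Proof. by rewrite [RHS]taddE. Qed.
Lemma tpiZ c x : tpi (TScal c x) = c *: tpi x. Proof. by rewrite [RHS]tscalE. Qed.

Definition tens (u v : U) : TT := tpi (TP (frepr u) (frepr v)).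

Lemma tensE a h : tens (pi a) (pi h) = tpi (TP a h).
Proof.
by apply/tpiP; apply: teq_trans (teq_eq_l _ (frepr_pi cons a)) (teq_eq_r _ (frepr_pi cons h)).
Qed.

Lemma tensDl u u' v : tens (u + u') v = tens u v + tens u' v.
Proof.
elim/fquotP: u => x; elim/fquotP: u' => y; elim/fquotP: v => z.
by rewrite -fpiD !tensE -tpiD; apply/tpiP; apply: teq_lin_l.
Qed.
Lemma tensDr u v v' : tens u (v + v') = tens u v + tens u v'.
Proof.
elim/fquotP: u => x; elim/fquotP: v => y; elim/fquotP: v' => z.
by rewrite -fpiD !tensE -tpiD; apply/tpiP; apply: teq_lin_r.
Qed.
Lemma tensZl c u v : tens (c *: u) v = c *: tens u v.
Proof.
elim/fquotP: u => x; elim/fquotP: v => y.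
by rewrite -mulr_algl -fpiC -fpiM !tensE -tpiZ; apply/tpiP; apply: teq_scal_l.
Qed.
Lemma tensZr c u v : tens u (c *: v) = c *: tens u v.
Proof.
elim/fquotP: u => x; elim/fquotP: v => y.
by rewrite -mulr_algl -fpiC -fpiM !tensE -tpiZ; apply/tpiP; apply: teq_scal_r.
Qed.

Lemma tpi_flat x : tpi x = \sum_(p <- tflat x) p.1.1 *: tens (pi p.1.2) (pi p.2).
Proof.
elim: x => [a h|x IHx y IHy|c x IH|] /=.
- by rewrite big_seq1 scale1r tensE.
- by rewrite big_cat tpiD IHx IHy.
- by rewrite tpiZ IH big_map scaler_sumr; apply: eq_bigr => p _; rewrite scalerA.
- by rewrite big_nil.
Qed.

Section Lift.
Variables (V : lmodType k) (phi : U -> U -> V).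
Hypothesis phiDl : forall u u' v, phi (u + u') v = phi u v + phi u' v.
Hypothesis phiDr : forall u v v', phi u (v + v') = phi u v + phi u v'.
Hypothesis phiZl : forall c u v, phi (c *: u) v = c *: phi u v.
Hypothesis phiZr : forall c u v, phi u (c *: v) = c *: phi u v.

Fixpoint teval (x : tterm k G) : V :=
  match x with
  | TP a h => phi (pi a) (pi h)
  | TAdd x y => teval x + teval y
  | TScal c x => c *: teval x
  | TZero => 0
  end.

Lemma teval_sound x y : teq rel x y -> teval x = teval y.
Proof.
elim=> {x y} //=.
- by move=> x y z _ -> _ ->.
- by move=> x x' y y' _ -> _ ->.
- by move=> c x x' _ ->.
- by move=> x y z; rewrite addrA.
- by move=> x y; rewrite addrC.
- by move=> x; rewrite add0r.
- by move=> x; rewrite scaleN1r subrr.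
- by move=> x; rewrite scale1r.
- by move=> a b x; rewrite scalerA.
- by move=> a b x; rewrite scalerDl.
- by move=> a x y; rewrite scalerDr.
- by move=> a a' h; rewrite fpiD.
- by move=> a h h'; rewrite fpiD.
- by move=> c a h; rewrite fpiM fpiC mulr_algl.
- by move=> c a h; rewrite fpiM fpiC mulr_algl.
- by move=> a a' h /(fpiP cons) ->.
- by move=> a h h' /(fpiP cons) ->.
Qed.

Definition tlift (u : TT) : V := teval (trepr u).

Lemma tliftE x : tlift (tpi x) = teval x.
Proof. by apply: teval_sound; apply: trepr_pi. Qed.

Lemma tlift_tens u v : tlift (tens u v) = phi u v.
Proof. by rewrite tliftE /= !freprK. Qed.

Lemma tlift_linear : linear tlift.
Proof.
move=> c; elim/tquotP => x; elim/tquotP => y.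
by rewrite -tpiZ -tpiD !tliftE.
Qed.
End Lift.

Variables (t0 : TT) (t0_neq0 : t0 != 0).
Local Notation EE := (nzendo t0_neq0).

Lemma endo_tens (f g : EE) : (forall u v, f (tens u v) = g (tens u v)) -> f = g.
Proof.
move=> fg; apply: endoP; elim/tquotP => x; rewrite tpi_flat.
elim: (tflat x) => [|p s IH]; first by rewrite big_nil !endo0.
by rewrite big_cons !endoD !endoZ fg IH.
Qed.

Section TensorMap.
Variables f g : U -> U.
Hypotheses (fl : linear f) (gl : linear g).

Let phi u v := tens (f u) (g v).

Definition tmap : EE := Endo (@tlift_linear _ phi
  (fun u u' v => etrans (congr1 (tens^~ _) (lin_add fl u u')) (tensDl _ _ _))
  (fun u v v' => etrans (congr1 (tens _) (lin_add gl v v')) (tensDr _ _ _))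
  (fun c u v => etrans (congr1 (tens^~ _) (lin_scale fl c u)) (tensZl _ _ _))
  (fun c u v => etrans (congr1 (tens _) (lin_scale gl c v)) (tensZr _ _ _))).

Lemma tmapE u v : tmap (tens u v) = tens (f u) (g v).
Proof.
apply: tlift_tens.
- by move=> *; rewrite /phi lin_add // tensDl.
- by move=> *; rewrite /phi lin_add // tensDr.
- by move=> *; rewrite /phi lin_scale // tensZl.
- by move=> *; rewrite /phi lin_scale // tensZr.
Qed.
End TensorMap.

Let id_lin : linear (@id U). Proof. by []. Qed.
Let lmul_lin (a : U) : linear ( *%R a).
Proof. by move=> c u v; rewrite mulrDr scalerAr. Qed.
Let rmul_lin (a : U) : linear ( *%R^~ a).
Proof. by move=> c u v; rewrite mulrDl scalerAl. Qed.

Definition ML (a : U) : EE := tmap (lmul_lin a) id_lin.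
Definition MR (a : U) : EE := tmap (rmul_lin a) id_lin.
Definition ML2 (a : U) : EE := tmap id_lin (lmul_lin a).

Lemma MLE a u v : ML a (tens u v) = tens (a * u) v. Proof. exact: tmapE. Qed.
Lemma MRE a u v : MR a (tens u v) = tens (u * a) v. Proof. exact: tmapE. Qed.
Lemma ML2E a u v : ML2 a (tens u v) = tens u (a * v). Proof. exact: tmapE. Qed.

Lemma ML_mul a b : ML (a * b) = ML a * ML b.
Proof. by apply: endo_tens => u v; rewrite endo_mulE !MLE mulrA. Qed.
Lemma MR_mul a b : MR (a * b) = MR b * MR a.
Proof. by apply: endo_tens => u v; rewrite endo_mulE !MRE mulrA. Qed.
Lemma ML2_mul a b : ML2 (a * b) = ML2 a * ML2 b.
Proof. by apply: endo_tens => u v; rewrite endo_mulE !ML2E mulrA. Qed.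

Lemma ML_lin : linear ML.
Proof.
move=> c a b; apply: endo_tens => u v; rewrite endo_addE endo_scaleE !MLE mulrDl -scalerAl.
by rewrite tensDl tensZl.
Qed.
Lemma MR_lin : linear MR.
Proof.
move=> c a b; apply: endo_tens => u v; rewrite endo_addE endo_scaleE !MRE mulrDr -scalerAr.
by rewrite tensDl tensZl.
Qed.
Lemma ML2_lin : linear ML2.
Proof.
move=> c a b; apply: endo_tens => u v; rewrite endo_addE endo_scaleE !ML2E mulrDl -scalerAl.
by rewrite tensDr tensZr.
Qed.

Lemma ML_one : ML 1 = 1.
Proof. by apply: endo_tens => u v; rewrite MLE mul1r. Qed.
Lemma MR_one : MR 1 = 1.
Proof. by apply: endo_tens => u v; rewrite MRE mulr1. Qed.
Lemma ML2_one : ML2 1 = 1.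
Proof. by apply: endo_tens => u v; rewrite ML2E mul1r. Qed.

Lemma ML_MR a b : ML a * MR b = MR b * ML a.
Proof. by apply: endo_tens => u v; rewrite !endo_mulE MRE !MLE MRE mulrA. Qed.
Lemma ML_ML2 a b : ML a * ML2 b = ML2 b * ML a.
Proof. by apply: endo_tens => u v; rewrite !endo_mulE ML2E !MLE ML2E. Qed.
Lemma MR_ML2 a b : MR a * ML2 b = ML2 b * MR a.
Proof. by apply: endo_tens => u v; rewrite !endo_mulE ML2E !MRE ML2E. Qed.

End TensorSquare.

Notation lall P s := (foldr (fun x Q => P x /\ Q) True s).

Lemma lall_cat (T : Type) (P : T -> Prop) s1 s2 : lall P s1 -> lall P s2 -> lall P (s1 ++ s2).
Proof. by elim: s1 => //= x s1 IH [px /IH h] /h. Qed.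

Lemma lall_map (T T' : Type) (f : T -> T') (P : T -> Prop) (P' : T' -> Prop) s :
  (forall x, P x -> P' (f x)) -> lall P s -> lall P' (map f s).
Proof. by move=> h; elim: s => //= x s IH [/h px /IH]. Qed.

Lemma eq_lall_sum (T : Type) (P : T -> Prop) (V : zmodType) (f f' : T -> V) s :
  (forall x, P x -> f x = f' x) -> lall P s -> \sum_(x <- s) f x = \sum_(x <- s) f' x.
Proof.
move=> h; elim: s => [_|x s IH /= [/h px /IH e]]; first by rewrite !big_nil.
by rewrite !big_cons px e.
Qed.

Section PowerIndependence.
Variables (k : fieldType) (q : k).
Hypothesis q0 : q != 0.
Hypothesis q_free : forall z : int, q ^ z = 1 -> z = 0.

(** Passing from [P(c)] to [P(q c) - q^n P(c)] kills the coefficient of degree [n] and multiplies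
    each lower one by [q^i - q^n], which is nonzero because [q] is no root of unity. *)
Lemma powers_free (V : lmodType k) n (v : nat -> V) :
  (forall c : k, c != 0 -> \sum_(i < n) c ^+ i *: v i = 0) -> forall i, (i < n)%N -> v i = 0.
Proof.
elim: n v => // n IH v h.
have qin i : (i < n)%N -> q ^+ i - q ^+ n != 0.
  move=> ltin; rewrite subr_eq0; apply/eqP => qq.
  have : q ^ (n%:Z - i%:Z) = 1.
    by rewrite expfzDr // -invr_expz -!exprnP -qq mulfV // expf_neq0.
  by move/q_free; lia.
have v0 i : (i < n)%N -> v i = 0.
  move=> ltin; apply: (scalerI (qin i ltin)); rewrite scaler0.
  apply: (IH (fun i => (q ^+ i - q ^+ n) *: v i)) => // c c0.
  have h1 := h (q * c) (mulf_neq0 q0 c0); have h2 := h c c0.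
  have : \sum_(i < n.+1) (q * c) ^+ i *: v i - q ^+ n *: \sum_(i < n.+1) c ^+ i *: v i = 0.
    by rewrite h1 h2 scaler0 subrr.
  rewrite scaler_sumr -sumrB big_ord_recr /= scalerA exprMn subrr addr0 => hh.
  rewrite -[RHS]hh; apply: eq_bigr => j _.
  by rewrite !scalerA exprMn -scalerBl mulrBr mulrC [c ^+ j * q ^+ n]mulrC.
move=> i; rewrite ltnS leq_eqVlt => /orP[/eqP->|/v0 //].
have := h 1 (oner_neq0 _); rewrite big_ord_recr big1 /= => [|j _]; last by rewrite v0 ?scaler0.
by rewrite add0r expr1n scale1r.
Qed.
End PowerIndependence.

(** * Antipode and coproduct in representations *)

Section Antipode.
Variables (k : fieldType) (q : k) (m : nat).
Hypotheses (q0 : q != 0).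
Local Notation D := (DA m).
Variables (A : algType k) (g : ugen D -> A).
Hypothesis u : urep q g.

Let s x : A := aeval g (antip x).
Let sM x y : s (FMul x y) = s y * s x. Proof. by []. Qed.
Let sC c : s (FC c) = c%:A. Proof. by []. Qed.
Let sZ c x : s (FMul (FC c) x) = c *: s x. Proof. by rewrite sM sC mulr_algr. Qed.
Let sB x y : s (FSub x y) = s x - s y.
Proof. by rewrite -scaleN1r -sZ. Qed.
Let sK mu : s (gK k mu) = g (UK (dopp mu)). Proof. by []. Qed.
Let sE i : s (gE k i) = - (g (UK (dalpha i)) * g (UE i)).
Proof. by rewrite /s [antip _]/= aeval_scale scaleN1r. Qed.
Let sF i : s (gF k i) = - (g (UF i) * g (UK (dopp (dalpha i)))).
Proof. by rewrite /s [antip _]/= aeval_scale scaleN1r. Qed.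

(** [antip] reverses products, so it is not a substitution and is checked relation by relation.
    Right multiplication reverses products once more, which makes right multiplication by antipodes
    a representation, [gS]. *)
Lemma aeval_antip x y : urel q x y -> aeval g (antip x) = aeval g (antip y).
Proof.
have dok := @DA_ok m.
have qn0 (n : int) : q ^ n != 0 by rewrite expfz_neq0.
have KE i j := ur_KEE u (dalpha i) j.
have NF i j : g (UK (dopp (dalpha i))) * g (UF j) =
    q ^ dpair (dalpha i) (dalpha j) *: (g (UF j) * g (UK (dopp (dalpha i)))).
  by rewrite (ur_KFE u) (dok_pairN dok) opprK.
have KK := urep_KC dok u.
rewrite -/(s x) -/(s y); case=> {x y}; rewrite ?(sZ, sB, sM, sK, sE, sF, sC).
- by rewrite (dok_opp0 dok) (ur_K0E u) scale1r.
- by move=> mu la; rewrite !(sM, sK) (ur_KKE u) (dok_oppD dok) (dok_addC dok).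
- move=> mu i; rewrite !(sZ, sM, sK, sE).
  have h1 := ur_KEE u (dopp mu) i; rewrite (dok_pairN dok) -invr_expz in h1.
  by have h2 := KK (dopp mu) (dalpha i); ncfield k A (h1, h2).
- move=> mu i; rewrite !(sZ, sM, sK, sF).
  have h1 := ur_KFE u (dopp mu) i; rewrite (dok_pairN dok) opprK in h1.
  rewrite -invr_expz.
  by have h2 := KK (dopp mu) (dopp (dalpha i)); ncfield k A (h1, h2).
- move=> i j /orP[/eqP ij|/eqP/(dok_two dok) ->] //; rewrite !(sM, sE).
  have h1 := KE i j; have h2 := KE j i; rewrite (dok_sym dok) in h2.
  rewrite ij expr0z in h1 h2.
  have h3 := KK (dalpha i) (dalpha j); have h4 := ur_EEE u ij.
  have h5 := KE i i; have h6 := KE j j; rewrite !(dok_diag dok) -!exprnP in h5 h6.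
  by ncfield k A (h1, h2, h3, h4, h5, h6).
- move=> i j /orP[/eqP ij|/eqP/(dok_two dok) ->] //; rewrite !(sM, sF).
  have h1 := NF i j; have h2 := NF j i; rewrite (dok_sym dok) in h2.
  rewrite ij expr0z in h1 h2.
  have h3 := KK (dopp (dalpha i)) (dopp (dalpha j)); have h4 := ur_FFE u ij.
  have h5 := NF i i; have h6 := NF j j; rewrite !(dok_diag dok) -!exprnP in h5 h6.
  by ncfield k A (h1, h2, h3, h4, h5, h6).
- move=> i j ij; rewrite !(sZ, sM, sB, sE).
  have h1 := KE i j; have h2 := KE j i; have h0 := KE i i.
  rewrite (dok_sym dok) in h2; rewrite ij -[-1]/(- (1 : int)) -invr_expz expr1z in h1 h2.
  rewrite (dok_diag dok) -exprnP in h0.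
  have h3 := KK (dalpha i) (dalpha j); have := ur_EsE u ij; rewrite /serre => h4.
  have h5 := KE j j; rewrite (dok_diag dok) -exprnP in h5.
  by ncfield k A (h0, h1, h2, h5, h3, h4).
- move=> i j ij; rewrite !(sZ, sM, sB, sF).
  have h1 := NF i j; have h2 := NF j i; have h0 := NF i i.
  rewrite (dok_sym dok) in h2; rewrite ij -[-1]/(- (1 : int)) -invr_expz expr1z in h1 h2.
  rewrite (dok_diag dok) -exprnP in h0.
  have h3 := KK (dopp (dalpha i)) (dopp (dalpha j)); have := ur_FsE u ij; rewrite /serre => h4.
  have h5 := NF j j; rewrite (dok_diag dok) -exprnP in h5.
  by ncfield k A (h0, h1, h2, h5, h3, h4).
- move=> i j; rewrite !(sM, sB, sE, sF).
  have h1 := KE i j; have h2 := NF j i; rewrite (dok_sym dok) in h2.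
  have h3 := ur_KFE u (dalpha i) j; have h5 := ur_KEE u (dopp (dalpha j)) i.
  rewrite (dok_pairN dok) (dok_sym dok) -!invr_expz in h3 h5.
  have h6 := KK (dopp (dalpha j)) (dalpha i).
  case: (eqVneq i j) h1 h2 h3 h5 h6 => [<-|ij] h1 h2 h3 h5 h6.
    rewrite sZ sB !sK (dok_oppK dok).
    have h4 := ur_EFeq u i; have h7 := urep_KN dok u (dalpha i).
    by set d := (q - q^-1)^-1 in h4 *; ncfield k A (h2, h3, h5, h6, h4, h7).
  by have h4 := ur_EFne u ij; rewrite sC scale0r; ncfield k A (h2, h3, h5, h6, h4).
Qed.
End Antipode.

Lemma consistent_of_urep (k : fieldType) (q : k) (D : datum) (A : algType k) (g : ugen D -> A) :
  q != 0 -> datum_ok D -> urep q g -> ~ feq (@urel k q D) (FC 1) (FC 0).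
Proof.
move=> q0 ok /(urepP q0 g ok) /aeval_sound s /s /eqP.
by rewrite /aeval /= scale1r scale0r oner_eq0.
Qed.

Section Coproduct.
Variables (k : fieldType) (m : nat).
Local Notation D := (DA m).
Local Notation uterm := (fterm k (ugen D)).
Variables (A : algType k) (g1 g2 : ugen D -> A).
Hypothesis g12 : forall a b, g1 a * g2 b = g2 b * g1 a.

Lemma aeval_comm x y : aeval g1 x * aeval g2 y = aeval g2 y * aeval g1 x.
Proof.
have c a z : g1 a * aeval g2 z = aeval g2 z * g1 a.
  elim: z => [b|c|z1 IH1 z2 IH2|z1 IH1 z2 IH2]; rewrite ?aevalC ?aevalD ?aevalM.
  - exact: g12.
  - by rewrite mulr_algl mulr_algr.
  - by rewrite mulrDr mulrDl IH1 IH2.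
  - by rewrite mulrA IH1 -mulrA IH2 mulrA.
elim: x => [a|c'|x1 IH1 x2 IH2|x1 IH1 x2 IH2]; rewrite ?aevalC ?aevalD ?aevalM.
- exact: c.
- by rewrite mulr_algl mulr_algr.
- by rewrite mulrDr mulrDl IH1 IH2.
- by rewrite -mulrA IH2 mulrA IH1 mulrA.
Qed.

(** This turns sums over the list [cop x], such as those in [act], into values of a single
    assignment. *)
Lemma cop_eval (x : uterm) :
  \sum_(p <- cop x) aeval g1 p.1 * aeval g2 p.2 = aeval (ucomb g1 g2) x.
Proof.
elim: x => [[i|i|mu]|c|x IHx y IHy|x IHx y IHy] /=.
- by rewrite big_cons big_seq1 aevalC scale1r mulr1.
- by rewrite big_cons big_seq1 aevalC scale1r mul1r.
- by rewrite big_seq1.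
- by rewrite big_seq1 /= !aevalC scale1r mulr1.
- by rewrite big_cat IHx IHy.
- rewrite big_allpairs_dep aevalM -IHx -IHy mulr_suml; apply: eq_bigr => p _.
  rewrite mulr_sumr; apply: eq_bigr => r _; rewrite !aevalM !mulrA; congr (_ * _).
  by rewrite -!mulrA aeval_comm.
Qed.
End Coproduct.

Section PositiveTerms.
Variables (k : fieldType) (m : nat).
Local Notation uterm := (fterm k (ugen (DA m))).

Lemma cop_pos (x : uterm) : posterm x -> lall (fun p => posterm p.2) (cop x).
Proof.
elim: x => [[i|i|mu]|c|x IHx y IHy|x IHx y IHy] //= [px py].
  by apply: lall_cat; [apply: IHx | apply: IHy].
move/IHx: px; move/IHy: py => sy; elim: (cop x) => //= p s IH [pp ps].
by apply: lall_cat; [apply: lall_map sy => r pr | apply: IH].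
Qed.
End PositiveTerms.

(** * Left multiplications of the smash product as operators *)

Section SmashOperators.
Variables (k : fieldType) (q : k) (m : nat).
Hypotheses (q0 : q != 0) (qm : q - q^-1 != 0).
Hypothesis q_free : forall z : int, q ^ z = 1 -> z = 0.
Local Notation D := (DA m.+1).
Local Notation uterm := (fterm k (ugen D)).
Let dok : datum_ok D := DA_ok m.+1.
Local Notation rel := (@urel k q D).
Local Notation fosc b := (@finosc k q m b).

Lemma fin_consistent : ~ feq rel (FC 1) (FC 0).
Proof. exact: consistent_of_urep q0 dok (finosc_urep m q0 qm false). Qed.

Local Notation U := (fquot fin_consistent).
Local Notation pi := (fpi fin_consistent).
Local Notation TT := (tquot fin_consistent).
Local Notation W := (wendo k (twopos m.+2)).

Let osc_ok b : rel_ok rel (fosc b).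
Proof. by apply/(urepP q0 _ dok); apply: finosc_urep. Qed.

Lemma flift_add (A : algType k) (g : ugen D -> A) : rel_ok rel g ->
  forall u v : U, flift g (u + v) = flift g u + flift g v.
Proof. by move=> ok; apply: lin_add => c; apply: flift_linear. Qed.

Lemma flift_scale (A : algType k) (g : ugen D -> A) : rel_ok rel g ->
  forall c (u : U), flift g (c *: u) = c *: flift g u.
Proof. by move=> ok; apply: lin_scale => c; apply: flift_linear. Qed.

Let phi (u v : U) : W := flift (fosc false) u * flift (fosc true) v.
Let phiDl u u' v : phi (u + u') v = phi u v + phi u' v.
Proof. by rewrite /phi flift_add ?mulrDl. Qed.
Let phiDr u v v' : phi u (v + v') = phi u v + phi u v'.
Proof. by rewrite /phi flift_add ?mulrDr. Qed.
Let phiZl c u v : phi (c *: u) v = c *: phi u v.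
Proof. by rewrite /phi flift_scale ?scalerAl. Qed.
Let phiZr c u v : phi u (c *: v) = c *: phi u v.
Proof. by rewrite /phi flift_scale ?scalerAr. Qed.

(** The two oscillators act on different rows and commute. This map detects tensors: it shows that
    [1 (x) 1] is nonzero and later separates ordered monomials. *)
Definition finpair : TT -> W := tlift phi.

Lemma finpair_tens u v :
  finpair (tens u v) = flift (fosc false) u * flift (fosc true) v.
Proof. exact: (tlift_tens phiDl phiDr phiZl phiZr). Qed.

Lemma finpair_linear : linear finpair.
Proof. exact: (tlift_linear phiDl phiDr phiZl phiZr). Qed.

Lemma flift_one b : flift (fosc b) (1 : U) = 1.
Proof.
have -> : (1 : U) = pi (FC 1) by rewrite fpiC scale1r.
by rewrite fliftE // aevalC scale1r.
Qed.

Lemma tens11_neq0 : tens (1 : U) (1 : U) != 0.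
Proof.
apply/eqP => /(congr1 finpair); rewrite finpair_tens !flift_one mulr1 (lin_zero finpair_linear).
by move/eqP; rewrite oner_eq0.
Qed.
Local Notation E := (nzendo tens11_neq0).
Local Notation ML := (ML tens11_neq0).
Local Notation MR := (MR tens11_neq0).
Local Notation ML2 := (ML2 tens11_neq0).

Definition gU (a : ugen D) : U := pi (FG a).
Lemma gU_urep : urep q gU.
Proof. by apply/(urepP q0 _ dok); apply: fpi_ok. Qed.

Definition gL (a : ugen D) : E := ML (gU a).
Definition gS (a : ugen D) : E := MR (pi (antip (FG a))).
Definition gL2 (a : ugen D) : E := ML2 (gU a).

Lemma gL_eval x : aeval gL x = ML (pi x).
Proof.
elim: x => [a|c|x IHx y IHy|x IHx y IHy] //.
- by rewrite aevalC fpiC (lin_scale (ML_lin _)) ML_one.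
- by rewrite aevalD fpiD (lin_add (ML_lin _)) IHx IHy.
- by rewrite aevalM fpiM ML_mul IHx IHy.
Qed.

Lemma gL2_eval x : aeval gL2 x = ML2 (pi x).
Proof.
elim: x => [a|c|x IHx y IHy|x IHx y IHy] //.
- by rewrite aevalC fpiC (lin_scale (ML2_lin _)) ML2_one.
- by rewrite aevalD fpiD (lin_add (ML2_lin _)) IHx IHy.
- by rewrite aevalM fpiM ML2_mul IHx IHy.
Qed.

Lemma gS_eval x : aeval gS x = MR (pi (antip x)).
Proof.
elim: x => [a|c|x IHx y IHy|x IHx y IHy] //.
- by rewrite aevalC fpiC (lin_scale (MR_lin _)) MR_one.
- by rewrite aevalD /= fpiD (lin_add (MR_lin _)) IHx IHy.
- by rewrite aevalM /= fpiM MR_mul IHx IHy.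
Qed.

Lemma gL_urep : urep q gL.
Proof.
by apply/(urepP q0 _ dok) => x y r; rewrite !gL_eval (fpi_rel _ r).
Qed.
Lemma gL2_urep : urep q gL2.
Proof. by apply/(urepP q0 _ dok) => x y r; rewrite !gL2_eval (fpi_rel _ r). Qed.
Lemma gS_urep : urep q gS.
Proof.
by apply/(urepP q0 _ dok) => x y r; rewrite !gS_eval !fpiE (aeval_antip q0 gU_urep r).
Qed.

Lemma gL_gS a b : gL a * gS b = gS b * gL a. Proof. exact: ML_MR. Qed.

(* [gAct] is the adjoint action of [pi_A h] on the first tensor factor, and
   [gLL] the left multiplication by [1 # h] in the smash product. *)
Definition gAct (a : ugen D) : E := aeval (ucomb gL gS) (piA_gen k a).
Definition gLL : ugen D -> E := ucomb gAct gL2.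
Notation Lh := (aeval gLL).

Lemma gAct_eval h : aeval gAct h = aeval (ucomb gL gS) (piA h).
Proof. by rewrite /piA aeval_fmap. Qed.

Lemma act_sum h v :
  pi (act h v) = \sum_(p <- cop (piA h)) pi p.1 * pi v * pi (antip p.2).
Proof.
rewrite /act; elim: (cop _) => [|p s IH] /=; first by rewrite big_nil fpiC scale0r.
by rewrite big_cons fpiD !fpiM IH.
Qed.

Lemma act_mul h h' v : pi (act (FMul h h') v) = pi (act h (act h' v)).
Proof.
rewrite [RHS]act_sum act_sum /= big_allpairs_dep; apply: eq_bigr => p _.
rewrite act_sum mulr_sumr mulr_suml; apply: eq_bigr => r _ /=.
by rewrite !fpiM !mulrA.
Qed.

Lemma gAct_tens h v (w : U) : aeval gAct h (tens (pi v) w) = tens (pi (act h v)) w.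
Proof.
rewrite gAct_eval -cop_eval; last exact: gL_gS.
rewrite act_sum endo_sumE; elim: (cop _) => [|p s IH].
  rewrite !big_nil; have := tensZl 0 (0 : U) w; rewrite !scale0r => ->.
  by [].
by rewrite !big_cons tensDl -IH gL_eval gS_eval endo_mulE MRE MLE mulrA.
Qed.

Let ML_add := lin_add (ML_lin tens11_neq0).
Let ML_scale := lin_scale (ML_lin tens11_neq0).

Let ML0 := lin_zero (ML_lin tens11_neq0).

Lemma gAct_E (i : dI D) : gAct (UE i) =
  if (val i == 0)%N then 0 else gL (UK (dopp (dalpha i))) * gS (UE i) + gL (UE i).
Proof. by rewrite /gAct /=; case: ifP => //; rewrite aevalC scale0r. Qed.

Lemma act_K mu v : pi (act (gK k mu) v) = gU (UK mu) * pi v * gU (UK (dopp mu)).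
Proof. by rewrite act_sum [piA _]/= big_seq1. Qed.

Lemma act_C c v : pi (act (FC c) v) = c *: pi v.
Proof. by rewrite act_sum [piA _]/= big_seq1 !fpiC scale1r mulr1 mulr_algl. Qed.

Lemma act_E (i : dI D) v : pi (act (gE k i) v) =
  if (val i == 0)%N then 0 else
  gU (UE i) * pi v - gU (UK (dopp (dalpha i))) * pi v * (gU (UK (dalpha i)) * gU (UE i)).
Proof.
rewrite act_sum -[piA _]/(if (val i == 0)%N then FC 0 else gE k i); case: ifP => _; first by rewrite [cop _]/= big_seq1 !fpiC scale0r !mul0r.
rewrite [cop _]/= big_cons big_seq1 /= !fpiM !fpiC scale1r mulr1 addrC mulr_algl scaleN1r mulrN.
by [].
Qed.

Lemma gLL_E i : gLL (UE i) =
  gL (UK (dopp (dalpha i))) * gS (UK (dopp (dalpha i))) * gL2 (UE i) + gAct (UE i).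
Proof. by []. Qed.

Lemma gLL_K mu : gLL (UK mu) = gL (UK mu) * gS (UK mu) * gL2 (UK mu).
Proof. by []. Qed.

Let gL_ML x y : gL x * ML y = ML (gU x * y). Proof. by rewrite ML_mul. Qed.
Let gS_ML x y : gS x * ML y = ML y * gS x. Proof. by rewrite [RHS]ML_MR. Qed.
Let gL2_ML x y : gL2 x * ML y = ML y * gL2 x. Proof. by rewrite [RHS]ML_ML2. Qed.

Lemma KN_gU mu : gU (UK (dopp mu)) * gU (UK mu) = 1.
Proof. by rewrite (ur_KKE gU_urep) (dok_addC dok) (dok_addN dok) (ur_K0E gU_urep). Qed.

Lemma gLL_K_ML mu b :
  gLL (UK mu) * ML b = ML (gU (UK mu) * b * gU (UK (dopp mu))) * gLL (UK mu).
Proof.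
rewrite gLL_K -mulrA gL2_ML mulrA -[_ * gS _ * ML b]mulrA gS_ML mulrA gL_ML !mulrA.
by rewrite -[gL (UK mu)]/(ML (gU (UK mu))) -ML_mul -[_ * _ * gU (UK mu)]mulrA KN_gU mulr1.
Qed.

Lemma gLL_E_ML (i : dI D) b :
  gLL (UE i) * ML b = ML (gU (UK (dopp (dalpha i))) * b * gU (UK (dalpha i))) * gLL (UE i) +
    ML (if (val i == 0)%N then 0 else
      gU (UE i) * b - gU (UK (dopp (dalpha i))) * b * (gU (UK (dalpha i)) * gU (UE i))).
Proof.
rewrite gLL_E gAct_E.
have KN : gU (UK (dalpha i)) * gU (UK (dopp (dalpha i))) = 1 by apply: (urep_KN dok gU_urep).
set K := UK (dopp (dalpha i)) in KN *; set K' := UK (dalpha i) in KN *.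
have e1 : ML (gU K * b * gU K') * gL K = ML (gU K * b).
  by rewrite -ML_mul -mulrA KN mulr1.
have e2 : gL K * gS K * gL2 (UE i) * ML b =
    ML (gU K * b * gU K') * (gL K * gS K * gL2 (UE i)).
  rewrite [RHS]mulrA [X in _ = X * _]mulrA e1 -[LHS]mulrA gL2_ML [LHS]mulrA.
  by rewrite -[_ * gS K * ML b]mulrA gS_ML [gL K * _]mulrA gL_ML.
rewrite mulrDl e2 mulrDr -addrA; congr (_ + _); case: ifP => _.
  by rewrite mul0r mulr0 ML0 addr0.
rewrite mulrDl -mulrA gS_ML mulrA gL_ML mulrDr mulrA e1 -addrA; congr (_ + _).
by rewrite gL_ML -ML_mul -ML_add; congr ML; rewrite mulrA addrC subrK.
Qed.

(** The rule for moving [1 # h] past [b # 1]. It is checked on the generators, and products follow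
    since acting by a product is acting twice. *)
Lemma Lh_ML h b : posterm h ->
  Lh h * ML (pi b) = \sum_(p <- cop h) ML (pi (act p.1 b)) * Lh p.2.
Proof.
elim: h b => [[i|i|mu]|c|x IHx y IHy|x IHx y IHy] b //.
- move=> _; rewrite [cop _]/= big_cons big_seq1 aevalC scale1r mulr1 act_K act_E !aevalG.
  by rewrite (dok_oppK dok) gLL_E_ML.
- by move=> _; rewrite [cop _]/= big_seq1 act_K !aevalG gLL_K_ML.
- by move=> _; rewrite [cop _]/= big_seq1 act_C !aevalC ML_scale scale1r mulr1 mulr_algl.
- by case=> px py; rewrite aevalD mulrDl [cop _]/= big_cat IHx ?IHy.
- case=> px py; rewrite aevalM -mulrA IHy // [cop _]/= big_allpairs_dep mulr_sumr exchange_big /=.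
  apply: eq_bigr => r _; rewrite mulrA IHx // mulr_suml; apply: eq_bigr => p _ /=.
  by rewrite act_mul aevalM mulrA.
Qed.

(** Left multiplication by a tensor term. It is defined on terms, because a priori [Lh h] depends on
    the term [h] and not only on its class. *)
Fixpoint Lx (x : tterm k (ugen D)) : E :=
  match x with
  | TP a h => ML (pi a) * Lh h
  | TAdd x y => Lx x + Lx y
  | TScal c x => c *: Lx x
  | TZero => 0
  end.

Lemma Lx_flat x : Lx x = \sum_(p <- tflat x) p.1.1 *: (ML (pi p.1.2) * Lh p.2).
Proof.
elim: x => [a h|x IHx y IHy|c x IH|] /=.
- by rewrite big_seq1 scale1r.
- by rewrite big_cat IHx IHy.
- by rewrite IH big_map scaler_sumr; apply: eq_bigr => p _; rewrite scalerA.
- by rewrite big_nil.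
Qed.

Lemma Lx_sum s : Lx (tsum s) = \sum_(x <- s) Lx x.
Proof. by elim: s => [|x s IH]; rewrite ?big_nil // big_cons /= IH. Qed.

Lemma Lx_smul x y : tpos x -> Lx (smul x y) = Lx x * Lx y.
Proof.
move=> px; rewrite /smul Lx_sum big_allpairs_dep (Lx_flat x) (Lx_flat y) mulr_suml.
apply: eq_lall_sum px => u pu; rewrite mulr_sumr; apply: eq_bigr => v _.
rewrite Lx_sum big_map -scalerAl -scalerAr scalerA.
rewrite mulrA -[_ * Lh _ * _]mulrA Lh_ML // mulr_sumr mulr_suml scaler_sumr.
by apply: eq_bigr => p _ /=; rewrite fpiM ML_mul aevalM !mulrA.
Qed.

Lemma tpos_sum s : lall (@tpos k m.+1) s -> tpos (tsum s).
Proof.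
by rewrite /tpos; elim: s => //= x s IH [px /IH]; apply: lall_cat.
Qed.

Lemma tpos_smul (x y : tterm k (ugen D)) : tpos x -> tpos y -> tpos (smul x y).
Proof.
rewrite /smul => px py; apply: tpos_sum.
have {}px : lall (fun p => posterm p.2) (tflat x) := px.
have {}py : lall (fun p => posterm p.2) (tflat y) := py.
move: px py; elim: (tflat x) => //= u s IH [pu ps] py.
apply: lall_cat; last exact: IH.
apply: lall_map py => v pv; apply: tpos_sum.
by apply: lall_map (cop_pos pu) => p pp; split=> //; split.
Qed.

Let pi1 : pi (FC 1) = 1. Proof. by rewrite fpiC scale1r. Qed.

Lemma gAct_E_unit (i : dI D) (w : U) : gAct (UE i) (tens 1 w) = 0.
Proof.
have := gAct_tens (gE k i) (FC 1) w; rewrite aevalG pi1 => ->.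
have tens0 : tens (0 : U) w = 0 by have := tensZl 0 (0 : U) w; rewrite !scale0r.
rewrite act_E pi1; case: ifP => // _; rewrite !mulr1 mulrA KN_gU mul1r subrr.
exact: tens0.
Qed.

(** The [E_i] act on the unit by 0 and the [K_mu] by 1, so only the second tensor factor is
    affected. *)
Lemma Lh_unit h g : posterm h -> Lh h (tens 1 (pi g)) = tens 1 (pi h * pi g).
Proof.
elim: h g => [[i|i|mu]|c|x IHx y IHy|x IHx y IHy] g //.
- move=> _; rewrite aevalG gLL_E.
  have SK : pi (antip (FG (UK (dopp (dalpha i))))) = gU (UK (dalpha i)).
    by rewrite -[antip _]/(gK k (dopp (dopp (dalpha i)))) (dok_oppK dok).
  rewrite endo_addE gAct_E_unit addr0 !endo_mulE ML2E MRE MLE mul1r SK KN_gU.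
  by [].
- move=> _; rewrite aevalG gLL_K !endo_mulE ML2E MRE MLE mul1r.
  rewrite -[pi (antip _)]/(gU (UK (dopp mu))) (urep_KN dok gU_urep).
  by [].
- move=> _; rewrite aevalC endo_scaleE fpiC mulr_algl tensZr.
  by [].
- by case=> px py; rewrite aevalD endo_addE IHx // IHy // fpiD mulrDl tensDr.
- by case=> px py; rewrite aevalM endo_mulE IHy // -fpiM IHx // !fpiM mulrA.
Qed.

(** A positive element is recovered from its left multiplication by applying it to the unit;
    computations with operators thus give equalities in the smash product. *)
Lemma tpi_Lx x : tpos x -> tpi fin_consistent x = Lx x (tens 1 1).
Proof.
move=> px; rewrite tpi_flat Lx_flat endo_sumE; apply: eq_lall_sum px => p pp.
have := Lh_unit (FC 1) pp; rewrite fpiC scale1r mulr1 => Lh1.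
by rewrite endo_scaleE endo_mulE Lh1 MLE mulr1.
Qed.

(** * Independence of the representative *)

Section WellDefined.
Let tw (c : k) (i : dI D) : k := if (val i == 0)%N then c else 1.
(** The twist scales [E_1] in the left and the right multiplication alike, hence scales its adjoint
    action by [c], and leaves the torus part and the second tensor factor alone. *)
Let gT c : ugen D -> E := ucomb (ucomb (utwist (tw c) gL) (utwist (tw c) gS)) gL2.

Let gT_urep c : c != 0 -> urep q (gT c).
Proof.
move=> c0; have tw0 i : tw c i != 0 by rewrite /tw; case: ifP => // _; rewrite oner_eq0.
have cL a b : utwist (tw c) gL a * gL2 b = gL2 b * utwist (tw c) gL a.
  by case: a => [i|i|mu] /=; rewrite -?scalerAl -?scalerAr ?[gL _ * _]ML_ML2.
have cS a b : utwist (tw c) gS a * gL2 b = gL2 b * utwist (tw c) gS a.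
  by case: a => [i|i|mu] /=; rewrite -?scalerAl -?scalerAr ?[gS _ * _]MR_ML2.
apply: urep_comb gL2_urep _ => //.
  apply: urep_comb => //; [exact: urep_twist gL_urep | exact: urep_twist gS_urep|].
  move=> [i|i|mu] [j|j|la] /=; rewrite -?scalerAl -?scalerAr ?gL_gS ?scalerA //;
    by rewrite -?scalerAl ?scalerA mulrC.
have cM (x y z : E) : x * z = z * x -> y * z = z * y -> x * y * z = z * (x * y).
  by move=> h h'; rewrite -mulrA h' mulrA h mulrA.
by case=> [i|i|mu] b; rewrite /ucomb ?mulrDl ?mulrDr !cM ?cL ?cS.
Qed.

(* Twisting [E_1] by [c] makes [Lh] the constant term of the polynomial in [c]
   given by a representation, hence [Lh] only depends on the class of [h]. *)
Let Lh_poly h : posterm h -> exists2 p : {poly E},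
  p`_0 = Lh h & forall c, c != 0 -> aeval (gT c) h = p.[c%:A].
Proof.
elim: h => [[i|i|mu]|c|x IHx y IHy|x IHx y IHy] //=.
- move=> _; set a := gL (UK (dopp (dalpha i))); set b := gS (UK (dopp (dalpha i))).
  have gTE c : gT c (UE i) = a * b * gL2 (UE i) + tw c i *: (a * gS (UE i) + gL (UE i)).
    by rewrite /gT /= -scalerAr -scalerDr.
  case i0 : (val i == 0)%N.
    exists ((a * b * gL2 (UE i))%:P + (a * gS (UE i) + gL (UE i))%:P * 'X).
      by rewrite coefD coefC coefMX addr0 aevalG gLL_E gAct_E i0 addr0.
    by move=> c c0; rewrite aevalG gTE /tw i0 hornerD hornerC hornerMX hornerC mulr_algr.
  exists ((a * b * gL2 (UE i) + (a * gS (UE i) + gL (UE i)))%:P).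
    by rewrite coefC aevalG gLL_E gAct_E i0.
  by move=> c c0; rewrite aevalG gTE /tw i0 scale1r hornerC.
- by move=> _; exists ((gLL (UK mu))%:P) => [|c _]; rewrite ?coefC ?hornerC.
- by move=> _; exists (c%:A%:P) => [|d _]; rewrite ?coefC ?hornerC aevalC.
- case=> /IHx[p p0 pE] /IHy[r r0 rE]; exists (p + r) => [|c c0].
    by rewrite coefD p0 r0.
  by rewrite hornerD -pE // -rE.
- case=> /IHx[p p0 pE] /IHy[r r0 rE]; exists (p * r) => [|c c0].
    by rewrite coef0M p0 r0.
  (* The coefficients do not commute with each other, but evaluation at the central element [c%:A]
     is still multiplicative. *)
  by rewrite hornerM_comm -?pE // -?rE // /comm_poly mulr_algl mulr_algr.
Qed.

(** For [c != 0] the two polynomials agree at [c], because [gT c] respects all relations including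
    those with the [F_i]. By [powers_free] every coefficient of their difference vanishes, in
    particular the constant one. *)
Lemma Lh_wd h h' : posterm h -> posterm h' -> pi h = pi h' -> Lh h = Lh h'.
Proof.
move=> /Lh_poly[p <- pE] /Lh_poly[p' <- pE'] /fpiP hh'.
apply/eqP; rewrite -subr_eq0 -coefB; apply/eqP; set d := p - p'.
have [|d0] := ltnP 0%N (size d); last by rewrite nth_default.
apply: (@powers_free k q q0 q_free E (size d) (fun i => d`_i)) => c c0.
have : d.[c%:A] = 0.
  rewrite hornerD hornerN -pE // -pE' // (aeval_sound _ hh') ?subrr //.
  by apply/(urepP q0 _ dok); apply: gT_urep.
rewrite horner_coef => e; rewrite -[RHS]e; apply: eq_bigr => i _.
have -> : (c%:A : E) ^+ i = (c ^+ i)%:A.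
  by elim: (i : nat) => [|n IH]; rewrite ?scale1r // !exprS IH -scalerAl mul1r scalerA.
by rewrite mulr_algr.
Qed.
End WellDefined.

Lemma gLL_typeA : typeA q m.+1 (finE gLL).
Proof.
have rel h h' : posterm h -> posterm h' -> urel q h h' -> Lh h = Lh h'.
  by move=> ph ph' r; apply: Lh_wd => //; apply: fpi_rel.
have sE (i j : dI D) : dpair (dalpha i) (dalpha j) = -1 -> serre q (gLL (UE i)) (gLL (UE j)).
  move=> ij; apply/serreP => //; have := rel _ _ _ _ (@ur_Eserre k q D i j ij).
  by rewrite aeval_scale !aevalM !aeval_qbr !aevalG => -> //=; do !split.
split.
- move=> i j im jm ij; apply: (rel (FMul (gE k _) (gE k _)) (FMul (gE k _) (gE k _))) => //.
  by apply: ur_EE; rewrite fin_cartan -val_eqE /= !inordK; lia.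
- by move=> i im; apply: sE; rewrite fin_cartan -val_eqE /= !inordK; lia.
- by move=> i im; apply: sE; rewrite fin_cartan -val_eqE /= !inordK; lia.
Qed.

(** * Two-row relations in the smash product *)

Let xU := chain q (finE gU).
Let e := finE gLL.

Lemma K_rootvec mu l : (l < m.+1)%N ->
  gU (UK mu) * xU l = q ^ (sval mu (inord 0) - sval mu (inord l.+1)) *: (xU l * gU (UK mu)).
Proof.
elim: l => [|l IH] lm.
  by rewrite /xU /= /finE (ur_KEE gU_urep) fin_pairE !inordK.
have h1 := IH (ltnW lm); have h2 := ur_KEE gU_urep mu (inord l.+1).
rewrite fin_pairE !inordK // in h2.
rewrite -[gU (UE _)]/(finE gU l.+1) in h2.
rewrite [xU l.+1]/(br q (xU l) (finE gU l.+1)) /br.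
have -> : q ^ (sval mu (inord 0) - sval mu (inord l.+2)) =
    q ^ (sval mu (inord 0) - sval mu (inord l.+1)) * q ^ (sval mu (inord l.+1) - sval mu (inord l.+2)).
  by rewrite -expfzDr //; congr (q ^ _); ring.
set a := q ^ _ in h1 *; set b := q ^ _ in h2 *.
by ncfield k (U : algType k) (h1, h2).
Qed.

Lemma K_rootvec_conj i j : (i < m.+1)%N -> (j < m.+1)%N ->
  let al := @dalpha D (inord i) in
  gU (UK (dopp al)) * xU j * gU (UK al) =
  q ^ ((j.+1 == i)%:Z - (j == i)%:Z - (i == 0%N)%:Z) *: xU j.
Proof.
move=> im jm al; rewrite K_rootvec // -scalerAl -mulrA KN_gU mulr1; congr (q ^ _ *: _).
by rewrite /= !ffunE !add0r !mulN1r -!val_eqE /= !inordK ?eqSS; lia.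
Qed.

(** The scalar [c] is conjugation by the torus element in the first term of the coproduct of [E_i];
    the last summand is the adjoint action on the root vector. *)
Lemma e_rootvec i j : (0 < i < m.+1)%N -> (j < m.+1)%N ->
  let c := q ^ ((j.+1 == i)%:Z - (j == i)%:Z) in
  e i * ML (xU j) = c *: (ML (xU j) * e i) + ML (finE gU i * xU j - c *: (xU j * finE gU i)).
Proof.
move=> /andP[i0 im] jm; rewrite /e /finE gLL_E_ML ifN; last by rewrite /= inordK // -lt0n.
have := K_rootvec_conj im jm; rewrite (gtn_eqF i0) subr0 => /= h.
by rewrite [_ * (_ * _)]mulrA h ML_scale -!scalerAl.
Qed.

(** Index 0 is [E_1], which [pi_A] kills: the adjoint part is absent and only torus conjugation is
    left. *)
Lemma e0_rootvec j : (j < m.+1)%N ->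
  ML (xU j) * e 0%N = q ^ (1 + (j == 0%N)%:Z) *: (e 0%N * ML (xU j)).
Proof.
move=> jm; rewrite /e /finE gLL_E_ML ifT ?ML0 ?addr0; last by rewrite /= inordK.
rewrite (K_rootvec_conj (ltn0Sn m) jm) ML_scale -scalerAl scalerA -expfzDr //.
by rewrite [X in q ^ X](_ : _ = 0) ?scale1r // eqxx /=; lia.
Qed.

Hypothesis q2 : q + q^-1 != 0.

(** The adjoint action of [E_(i+2)], with 0-based index [i + 1], sends [xU i] to [-q] times
    [xU (i + 1)], and otherwise these generators other than [E_1] kill root vectors. With
    [e_rootvec] this gives the exchange rules between the first row and the operators [e]. *)
Lemma smash_tworow : tworow_rel q m.+1 (fun j => ML (xU j)) (chain q e).
Proof.
have eA := gLL_typeA; have gA := fin_typeA q0 gU_urep.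
have ML_sub a b : ML (a - b) = ML a - ML b.
  by rewrite -scaleN1r ML_add ML_scale scaleN1r.
have xe_far i j : (i < m.+1)%N -> (0 < j < m.+1)%N -> j != i -> j != i.+1 ->
    ML (xU i) * e j = e j * ML (xU i).
  move=> im jm ji ji1; rewrite e_rootvec // (eq_sym i.+1) (negbTE ji1) (eq_sym i) (negbTE ji).
  rewrite subr0 expr0z !scale1r.
  have [lt|gt] : (i.+1 < j)%N \/ (j < i)%N by lia.
    by rewrite (chain_far q0 q2 gA) ?subrr ?ML0 ?addr0 //; lia.
  by rewrite (chain_below q0 q2 gA) ?subrr ?ML0 ?addr0 //; lia.
have xe_top i : (0 < i < m.+1)%N -> ML (xU i) * e i = q *: (e i * ML (xU i)).
  case: i => // i im; rewrite e_rootvec ?eqxx //.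
  rewrite (_ : (i.+2 == i.+1) = false); last lia.
  rewrite -[q ^ _]/(q^-1) /xU (chain_top q0 q2 gA) // scalerA mulVf // scale1r subrr ML0 addr0.
  by rewrite scalerA divff // scale1r.
have xe_next i : (i.+1 < m.+1)%N ->
    ML (xU i) * e i.+1 = q^-1 *: (e i.+1 * ML (xU i)) + ML (xU i.+1).
  move=> im; rewrite e_rootvec // ?(ltnW im) // eqxx (_ : (i == i.+1) = false); last lia.
  rewrite -[q ^ _]/(q) [xU i.+1]/(br q (xU i) (finE gU i.+1)) /br !ML_sub !ML_scale.
  set a := ML (xU i) * _; set b := ML (_ * xU i); set c := ML (xU i * _).
  by ncfield k (E : algType k) tt.
have ee_far i j : (0 < i)%N -> (i.+1 < j < m.+1)%N -> e i * e j = e j * e i.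
  by move=> i0 ij; apply: (typeA_far eA); lia.
have y0e j : (1 < j < m.+1)%N -> chain q e 0 * e j = e j * chain q e 0.
  by move=> j1; apply: (typeA_far eA); lia.
have x0y0 : ML (xU 0) * chain q e 0 = q ^+ 2 *: (chain q e 0 * ML (xU 0)) by exact: e0_rootvec.
have xy0 j : (0 < j < m.+1)%N -> ML (xU j) * chain q e 0 = q *: (chain q e 0 * ML (xU j)).
  move=> /andP[j0 jm]; rewrite [chain q e 0]/(e 0%N) e0_rootvec // (gtn_eqF j0) addr0.
  by rewrite expr1z.
have y_next i : (i.+1 < m.+1)%N -> chain q e i.+1 = br q (chain q e i) (e i.+1) by [].
split.
- move=> i j ij; rewrite -!ML_mul -ML_scale /xU.
  by rewrite (chain_qcomm q0 q2 gA) //; lia.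
- by move=> i j ij; apply: (chain_qcomm q0 q2 eA); lia.
- by apply: (tworows_eq q0 q2 xe_top xe_far y_next x0y0 xy0).
- by apply: (tworows_gt q0 q2 xe_far y_next xy0).
- by apply: (tworows_lt q0 q2 xe_next xe_top xe_far ee_far y_next y0e x0y0 xy0).
Qed.

(** Root vectors as explicit brackets of the [E_i], which makes them visibly admissible as right
    tensor factors. *)
Fixpoint xpos (j : nat) : uterm :=
  if j is j'.+1 then qbr q (xpos j') (gE k (inord j : dI D)) else gE k (inord 0 : dI D).

Lemma xpos_pos j : posterm (xpos j).
Proof. by elim: j => //= j IH; do !split. Qed.

Lemma aeval_xpos (A : algType k) (g : ugen D -> A) j : aeval g (xpos j) = chain q (finE g) j.
Proof. by elim: j => //= j IH; rewrite aeval_qbr IH. Qed.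

Lemma xpos_rootvec j : (j < m.+1)%N ->
  feq rel (xpos j) (nth (FC 0) (@rootvecs k q D (cword m.+1)) j).
Proof.
by move=> jm; apply/(fpiP fin_consistent); rewrite !fpiE aeval_xpos finite_rootvec.
Qed.

(** * Comparison of the two algebras through words in root vectors *)

Hypothesis q3 : q ^+ 2 + 1 + q ^- 2 != 0.
Hypothesis m0 : (0 < m)%N.
Local Notation G2 := (bool * 'I_m.+1)%type.
Local Notation aff := (DAf m.+1).
Local Notation affterm := (fterm k (ugen aff)).
Let m1 : (1 < m.+1)%N := m0.
Let affok : datum_ok aff := DAf_ok m1.
Local Notation affrel := (@urel k q aff).

Definition theta_gen (a : G2) : tterm k (ugen D) :=
  if a.1 then TP (FC 1) (xpos a.2) else TP (xpos a.2) (FC 1).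

Fixpoint theta (P : fterm k G2) : tterm k (ugen D) :=
  match P with
  | FG a => theta_gen a
  | FC c => tscal m.+1 c
  | FAdd P Q => TAdd (theta P) (theta Q)
  | FMul P Q => smul (theta P) (theta Q)
  end.

Definition psi (P : fterm k G2) : E := aeval (tworow_gen (fun j => ML (xU j)) (chain q e)) P.

Lemma theta_pos P : tpos (theta P).
Proof.
elim: P => [[[] j]|c|P IHP Q IHQ|P IHP Q IHQ] //=.
- by rewrite /tpos /=; split=> //; apply: xpos_pos.
- by apply: lall_cat.
- exact: tpos_smul.
Qed.

Lemma pi_xpos j : pi (xpos j) = xU j.
Proof. by rewrite fpiE aeval_xpos. Qed.

Lemma Lx_theta P : Lx (theta P) = psi P.
Proof.
elim: P => [[[] j]|c|P IHP Q IHQ|P IHP Q IHQ] /=.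
- by rewrite pi1 ML_one mul1r aeval_xpos.
- by rewrite aevalC scale1r mulr1 pi_xpos.
- by rewrite pi1 ML_one mul1r aevalC scale1r /psi aevalC.
- by rewrite IHP IHQ.
- by rewrite Lx_smul ?IHP ?IHQ //; apply: theta_pos.
Qed.

Lemma tpi_theta P : tpi fin_consistent (theta P) = psi P (tens 1 1).
Proof. by rewrite tpi_Lx ?Lx_theta //; apply: theta_pos. Qed.

Lemma xpos_Uc j : (j < m.+1)%N -> Uc q (xpos j : uterm).
Proof.
move=> jm; exists (nth (FC 0) (@rootvecs k q D (cword m.+1)) j); last exact: xpos_rootvec.
apply: fgen_S; have : (j < size (@rootvecs k q D (cword m.+1)))%N.
  by rewrite size_rootvecs /cword size_enum_ord.
elim: (rootvecs q _) j {jm} => // x s IH [|j] /= js; first by left.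
by right; apply: IH.
Qed.

Lemma theta_sgen P : sgen q (theta P).
Proof.
elim: P => [[[] j]|c|P IHP Q IHQ|P IHP Q IHQ] /=.
- by apply: sg_right; [apply: xpos_pos | apply: xpos_Uc].
- by apply: sg_left; apply: xpos_Uc.
- exact: sg_scal.
- exact: sg_add.
- exact: sg_mul.
Qed.

Definition aff_root (a : G2) : affterm :=
  nth (FC 0) (@rootvecs k q aff (chatword m.+1)) (if a.1 then m.+1 + a.2 else a.2)%N.

Lemma aeval_root (A : algType k) (g : ugen aff -> A) P : urep q g ->
  aeval g (fmap aff_root P) =
  aeval (tworow_gen (chain q (fun j => afE g j.+1)) (chain q (af_ey q g))) P.
Proof.
move=> u; rewrite aeval_fmap; apply: eq_aeval => -[[] j]; rewrite /aff_root /tworow_gen /=.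
  by rewrite (affine_rootvec_y q0 q2 qm _ u).
by rewrite (affine_rootvec_x q0 q2 qm).
Qed.

Lemma aff_consistent : ~ feq affrel (FC 1) (FC 0).
Proof. exact: consistent_of_urep q0 affok (aff_comb_urep q0 qm m1). Qed.

Lemma Y_unit w : (\prod_(i <- w) chain q e i) (tens 1 1) = tens 1 (\prod_(i <- w) xU i).
Proof.
elim: w => [|i w IH]; first by rewrite !big_nil.
rewrite !big_cons endo_mulE IH -aeval_xpos -pi_xpos.
by elim/fquotP: (\prod_(_ <- _) _) => g; rewrite Lh_unit //; apply: xpos_pos.
Qed.

Lemma X_tens w (u v : U) :
  (\prod_(i <- w) ML (xU i)) (tens u v) = tens ((\prod_(i <- w) xU i) * u) v.
Proof.
elim: w => [|i w IH]; first by rewrite !big_nil mul1r.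
by rewrite !big_cons endo_mulE IH MLE mulrA.
Qed.

Lemma flift_xprod b w : flift (fosc b) (\prod_(i <- w) xU i) =
  \prod_(i <- w) chain q (finE (fosc b)) i.
Proof.
elim: w => [|i w IH]; first by rewrite !big_nil flift_one.
by rewrite !big_cons fliftM // IH -pi_xpos fliftE // aeval_xpos.
Qed.

(** On the unit an ordered monomial splits into its first word on the left and its second word on
    the right, which the pair of oscillators turns back into a product over two rows. *)
Lemma finpair_mono t :
  finpair (mono (fun j => ML (xU j)) (chain q e) t (tens 1 1)) =
  mono (chain q (finE (fosc false))) (chain q (finE (fosc true))) t.
Proof.
by rewrite /mono endo_mulE Y_unit X_tens mulr1 finpair_tens !flift_xprod.
Qed.

Section Comparison.
Variables P Q : fterm k G2.

Let vanish r : (forall u, coef_of r u = 0) ->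
  forall (A : algType k) (x y : nat -> A), key_sum r x y = 0.
Proof.
move=> r0 A x y; rewrite /key_sum sum_grouped big1 // => t _.
by rewrite r0 scale0r.
Qed.

(** One straightened form [r] of [P - Q] serves both algebras. Equality on either side forces all
    its coefficients to vanish, by independence on that side; then [r] vanishes on the other side
    too. *)
Lemma theta_eq :
  feq affrel (fmap aff_root P) (fmap aff_root Q) <-> Smash_eq q (theta P) (theta Q).
Proof.
have [r okr rE] := straighten q0 (FSub P Q).
have zero (r0 : forall u, coef_of r u = 0) (A : algType k) (x y : nat -> A) :
    tworow_rel q m.+1 x y -> aeval (tworow_gen x y) P = aeval (tworow_gen x y) Q.
  by move=> /rE /eqP; rewrite aeval_sub vanish // subr_eq0 => /eqP.
split=> [/aeval_sound PQ|/(tpiP fin_consistent) PQ].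
  apply/(tpiP fin_consistent); rewrite !tpi_theta; congr (endo_fun _ (tens 1 1)).
  suff r0 : forall u, coef_of r u = 0 by exact: (zero r0 _ _ _ smash_tworow).
  have u := aff_comb_urep q0 qm m1.
  apply: (affine_indep q0 q2 qm m1 q_free okr).
  have := rE _ _ _ (affine_tworow q0 q2 qm m1 u q3).
  rewrite /key_sum => <-; rewrite aeval_sub -!aeval_root //.
  by rewrite PQ ?subrr //; apply/(urepP q0 _ affok).
have r0 : forall u, coef_of r u = 0.
  apply: (finite_indep q0 qm q_free okr).
  have := rE _ _ _ smash_tworow; rewrite aeval_sub => /(congr1 (fun f : E => f (tens 1 1))).
  rewrite endo_addE endo_oppE; rewrite !tpi_theta in PQ.
  rewrite -/(psi P) -/(psi Q) PQ subrr /key_sum => /esym /(congr1 finpair).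
  rewrite (lin_zero finpair_linear) => h; rewrite -[RHS]h {h}; elim: (r) => [|t s IH]; first by rewrite !big_nil (lin_zero finpair_linear).
  by rewrite !big_cons endo_addE endo_scaleE finpair_linear -IH finpair_mono.
pose g (a : ugen aff) : fquot aff_consistent := fpi aff_consistent (FG a).
have u : urep q g by apply/(urepP q0 _ affok); apply: fpi_ok.
apply/(fpiP aff_consistent); rewrite !fpiE !(aeval_root _ u).
exact: (zero r0 _ _ _ (affine_tworow q0 q2 qm m1 u q3)).
Qed.
End Comparison.

Lemma inl_nth (T : Type) (d x : T) s : inl x s <-> exists2 i, (i < size s)%N & x = nth d s i.
Proof.
elim: s => [|y s IH] /=; first by split=> // -[].
split=> [[->|/IH[i iS ->]]|[[|i] iS xE]]; [by exists 0%N | by exists i.+1 | by left |].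
by right; apply/IH; exists i.
Qed.

Lemma fsub_word (G I : Type) (rel : fterm k G -> fterm k G -> Prop) (S : fterm k G -> Prop)
    (r : I -> fterm k G) x :
  (forall y, S y -> exists i, y = r i) -> fsub rel S x -> exists P, feq rel x (fmap r P).
Proof.
move=> Sr [y Sy xy]; suff [P yP] : exists P, y = fmap r P by exists P; rewrite -yP.
elim: Sy => {x y xy}.
- by move=> y /Sr[i ->]; exists (FG i).
- by move=> c; exists (FC c).
- by move=> x y _ [P ->] _ [Q ->]; exists (FAdd P Q).
- by move=> x y _ [P ->] _ [Q ->]; exists (FMul P Q).
Qed.

Lemma fsub_fmap (G I : Type) (rel : fterm k G -> fterm k G -> Prop) (S : fterm k G -> Prop)
    (r : I -> fterm k G) P : (forall i, S (r i)) -> fsub rel S (fmap r P).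
Proof.
move=> Sr; exists (fmap r P); last exact: feq_refl.
by elim: P => [i|c|P IHP Q IHQ|P IHP Q IHQ] /=;
  [apply: fgen_S | apply: fgen_C | apply: fgen_add | apply: fgen_mul].
Qed.

Lemma size_chatword : size (@rootvecs k q aff (chatword m.+1)) = (m.+1 + m.+1)%N.
Proof. by rewrite size_rootvecs size_cat /= !size_map !size_iota. Qed.

Lemma Uchat_word x : Uchat q x -> exists P, feq affrel x (fmap aff_root P).
Proof.
apply: fsub_word => y /(inl_nth (FC 0))[i]; rewrite size_chatword => im ->.
have [lt|ge] := ltnP i m.+1; first by exists (false, Ordinal lt).
have lt : (i - m.+1 < m.+1)%N by lia.
by exists (true, Ordinal lt); rewrite -[in LHS](subnKC ge).
Qed.

Lemma Uchat_fmap P : Uchat q (fmap aff_root P).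
Proof.
apply: fsub_fmap => -[b j]; apply/(inl_nth (FC 0)); exists (if b then m.+1 + j else j)%N => //.
by rewrite size_chatword; have := ltn_ord j; case: b; lia.
Qed.

Lemma Uc_word u : Uc q u -> exists P,
  pi u = pi (fmap (fun j : 'I_m.+1 => xpos j) P).
Proof.
pose r (j : 'I_m.+1) := nth (FC 0) (@rootvecs k q D (cword m.+1)) j.
move/(@fsub_word _ _ _ _ r) => [y /(inl_nth (FC 0))[i]|P uP].
  by rewrite size_rootvecs /cword size_enum_ord => im ->; exists (Ordinal im).
exists P; rewrite (iffRL (fpiP _ _ _) uP) !fpiE !aeval_fmap; apply: eq_aeval => j.
by rewrite -!fpiE; apply/fpiP/feq_sym/xpos_rootvec.
Qed.

(** A generator [1 # h] may use any positive term for [h]; [Lh_wd] replaces it by a word in the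
    [xpos j] without changing left multiplication. *)
Lemma sgen_theta y : sgen q y -> exists P, tpos y /\ Lx y = psi P.
Proof.
elim=> {y}.
- move=> u /Uc_word[P uP]; exists (fmap (fun j => FG (false, j)) P); split=> //.
  rewrite /= aevalC scale1r mulr1 uP -gL_eval /psi !aeval_fmap; apply: eq_aeval => j.
  by rewrite gL_eval pi_xpos.
- move=> h ph /Uc_word[P hP]; exists (fmap (fun j => FG (true, j)) P).
  split; first by split.
  rewrite /= pi1 ML_one mul1r (Lh_wd ph _ hP); last first.
    by elim: (P) => [j|c|P1 IH1 P2 IH2|P1 IH1 P2 IH2] //=; apply: xpos_pos.
  by rewrite /psi !aeval_fmap; apply: eq_aeval => j; rewrite aeval_xpos.
- move=> c; exists (FC c); split; first by do !split.
  by rewrite -Lx_theta.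
- move=> x y _ [P [px xP]] _ [Q [py yQ]]; exists (FAdd P Q).
  by rewrite /= xP yQ; split=> //; apply: lall_cat.
- move=> x y _ [P [px xP]] _ [Q [py yQ]]; exists (FMul P Q).
  by rewrite Lx_smul // xP yQ; split=> //; apply: tpos_smul.
Qed.

(** An element of the subalgebra has no preferred word in the root vectors, so one is chosen, and
    [theta_eq] makes the class of the result independent of the choice. Outside the subalgebra the
    value is the default [1 # 1]. *)
Definition smash_iso (x : affterm) : tterm k (ugen D) :=
  if pselect (exists P, feq affrel x (fmap aff_root P)) is left h
  then theta (sval (cid h)) else tone k m.+1.

Lemma smash_isoP x P : feq affrel x (fmap aff_root P) ->
  Smash_eq q (smash_iso x) (theta P).
Proof.
move=> xP; rewrite /smash_iso; case: pselect => [h|[]]; last by exists P.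
by case: cid => Q /= xQ; apply/theta_eq; apply: feq_trans xP; apply: feq_sym.
Qed.

Lemma smash_isoE x : Uchat q x -> exists2 P, feq affrel x (fmap aff_root P) &
  smash_iso x = theta P.
Proof.
move/Uchat_word => ex; rewrite /smash_iso; case: pselect => // h.
by case: cid => P /= xP; exists P.
Qed.

Lemma smash_iso_correct :
  alg_iso (@Ueq k q aff) FAdd FMul FC (@Uchat k q m.+1)
    (@Smash_eq k q m.+1) TAdd (@smul k m.+1) (@tscal k m.+1) (@Usharp k q m.+1) smash_iso.
Proof.
split=> [x /smash_isoE[P _ ->]|].
  split; first exact: theta_pos.
  by exists (theta P); [apply: theta_sgen | apply: teq_refl].
split=> [x y /smash_isoE[P xP ->] /smash_isoE[Q yQ ->]|].
  split=> [xy|/theta_eq PQ].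
    by apply/theta_eq; apply: feq_trans yQ; apply: feq_trans xy; apply: feq_sym.
  by apply: feq_trans (feq_sym yQ); apply: feq_trans PQ.
split=> [c|]; first by apply: (@smash_isoP _ (FC c)); apply: feq_refl.
split=> [x y /smash_isoE[P xP ->] /smash_isoE[Q yQ ->]|].
  by apply: (@smash_isoP _ (FAdd P Q)); apply: feq_addc.
split=> [x y /smash_isoE[P xP ->] /smash_isoE[Q yQ ->]|].
  by apply: (@smash_isoP _ (FMul P Q)); apply: feq_mulc.
move=> z [_ [y /sgen_theta[P [py yP]] zy]]; exists (fmap aff_root P); first exact: Uchat_fmap.
apply: teq_trans (smash_isoP (feq_refl _ _)) _; apply: teq_trans (teq_sym zy).
by apply/(tpiP fin_consistent); rewrite tpi_theta tpi_Lx // yP.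
Qed.

End SmashOperators.

Theorem theorem6p3 (k : closedFieldType) (q : k) (m : nat) :
  [pchar k] =i pred0 ->
  q != 0 ->
  (forall p : {poly int}, p != 0 -> (map_poly (fun z : int => z%:~R) p).[q] != 0) ->
  (1 < m)%N ->
  exists f : fterm k (ugen (DAf m)) -> tterm k (ugen (DA m)),
    alg_iso
      (@Ueq k q (DAf m)) FAdd FMul FC (@Uchat k q m)
      (@Smash_eq k q m) TAdd (@smul k m) (@tscal k m) (@Usharp k q m)
      f.
Proof.
move=> _ q0 transc; case: m => // m m1.
(* Transcendence applied to [X^n - 1] shows that [q] is no root of unity. *)
have qX n : (0 < n)%N -> q ^+ n <> 1.
  move=> n0 qn; have /transc : ('X^n - 1 : {poly int}) != 0.
    by rewrite monic_neq0 // monicXnsubC.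
  rewrite -[map_poly _]/(map_poly intr) rmorphB /= map_polyXn rmorph1.
  by rewrite hornerD hornerN hornerXn hornerC qn subrr eqxx.
have q_free (z : int) : q ^ z = 1 -> z = 0.
  case: z => [[|n]|n] //; first by move/(qX n.+1 isT).
  by rewrite NegzE -invr_expz => /(congr1 GRing.inv); rewrite invrK invr1 => /(qX n.+1 isT).
have qm : q - q^-1 != 0.
  rewrite subr_eq0; apply/eqP => qq; apply: (qX 2) => //.
  by rewrite expr2 {2}qq divff.
have q2 : q + q^-1 != 0.
  rewrite addr_eq0; apply/eqP => qq; apply: (qX 4) => //.
  have q2 : q ^+ 2 = -1 by rewrite expr2 {2}qq mulrN divff.
  by rewrite (exprM q 2 2) q2 sqrrN expr1n.
have q3 : q ^+ 2 + 1 + q ^- 2 != 0.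
  apply/eqP => e; apply: (qX 6) => //; apply/eqP; rewrite -subr_eq0.
  (* The q-number is, up to a power of [q], a factor of [q^6 - 1]. *)
  have -> : q ^+ 6 - 1 = (q ^+ 2 - 1) * q ^+ 2 * (q ^+ 2 + 1 + q ^- 2) by field.
  by rewrite e mulr0.
by exists (@smash_iso k q m); apply: smash_iso_correct.
Qed.
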